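(* For every pre-Tango curve $C$, the generalized Raynaud surface $X$ over $C$ constructed in the context is normal. In particular, $X$ is Cohen-Macaulay. Moreover, $X$ is smooth if $C$ is a Tango curve.
   Context: Pre-Tango and Tango curves. Let $k$ be an algebraically closed field of characteristic $p>0$ and $C$ a smooth projective curve over $k$ of genus $g\ge 2$ with function field $K(C)$. The Tango invariant of $C$ is $n(C):=\max\{\deg[\frac{(df)}{p}] : f\in K(C)\setminus K(C)^p\}$, where $[\cdot]$ denotes round down of coefficients; one has $0\le n(C)\le\frac{2(g-1)}{p}$. The curve $C$ is called a pre-Tango curve if $n(C)>0$, and a Tango curve if $n(C)=\frac{2(g-1)}{p}$. This means that there is an ample divisor $D$ on $C$ with $(df)\ge pD\,(>0)$ (respectively $(df)=pD\,(>0)$) for some $f\in K(C)\setminus K(C)^p$; the invertible sheaf $\mathcal L=\mathcal O_C(D)$ is then called a pre-Tango structure (respectively a Tango structure) of $C$. Construction of the generalized Raynaud surface. Let $C$ be a pre-Tango curve with a pre-Tango structure $\mathcal L=\mathcal O_C(D)$, and take $f_0\in K(C)\setminus K(C)^p$ with $(df_0)\ge pD$. Fix an integer $e\ge 2$ prime to $p$ with $e\mid\deg\mathcal L$, and an ample invertible sheaf $\mathcal N$ on $C$ with $\mathcal L=\mathcal N^{e}$. Fix an integer $\ell\ge 2$ with $\ell\mid p+1$ and $\ell\mid e$. Let $F$ be the Frobenius morphism of $C$ and $\mathcal B^1$ the image of $F_*d:F_*\mathcal O_C\to F_*\Omega^1_C$, so $0\to\mathcal O_C\to F_*\mathcal O_C\to\mathcal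 B^1\to0$ is exact. Then $H^0(C,\mathcal B^1\otimes\mathcal L^{-1})=\{df: (df)\ge pD\}$, and the connecting map $\eta:H^0(C,\mathcal B^1\otimes\mathcal L^{-1})\to H^1(C,\mathcal L^{-1})$ is injective with image the kernel of $F^*:H^1(C,\mathcal L^{-1})\to H^1(C,\mathcal L^{-p})$. The class $\eta(df_0)\neq0$ defines a non-split extension $0\to\mathcal O_C\to\mathcal E\to\mathcal L\to0$ with $\mathcal E$ locally free of rank 2, while $0\to\mathcal O_C\to F^*\mathcal E\to\mathcal L^{p}\to0$ splits. Let $\pi:P=\mathbb P(\mathcal E)=\mathrm{Proj}\,S(\mathcal E)\to C$ ($\pi_*\mathcal O_P(1)=\mathcal E$), and let $E\subset P$ be the section of $\pi$ which is the zero divisor of the section $s\in H^0(P,\mathcal O_P(1))=H^0(C,\mathcal E)$ that is the image of $1\in H^0(C,\mathcal O_C)$; so $\mathcal O_P(E)\cong\mathcal O_P(1)$. The splitting gives an exact sequence $0\to\mathcal O_C\to F^*\mathcal E\otimes\mathcal L^{-p}\to\mathcal L^{-p}\to 0$; the image of $1$ in $H^0(C,F^*\mathcal E\otimes\mathcal L^{-p})$ defines a section curve $\Gamma'$ of $P'=\mathbb P(F^*\mathcal E\otimes \mathcal L^{-p})\cong\mathbb P(F^*\mathcal E)\to C$. Let $C''\subset P$ be the preimage of $\Gamma'$ under the relative Frobenius $P\to P'$ over $C$ ($p$-th power on the fibre coordinates). Then $\mathcal O_P(C'')\cong\mathcal O_P(p)\otimes\pi^*\mathcal L^{-p}$ and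 $E\cap C''=\emptyset$. Put $\mathcal M:=\mathcal O_P\big(-\tfrac{p+1}{\ell}\big)\otimes\pi^*\mathcal N^{pe/\ell}$, so $\mathcal M^{-\ell}=\mathcal O_P(E+C'')$. Let $\psi:X:=\mathcal{S}pec\big(\bigoplus_{i=0}^{\ell-1}\mathcal M^i\big)\to P$ be the cyclic cover of degree $\ell$ ramified at $E+C''$, the algebra structure being tensor product followed, when $i+j\ge\ell$, by multiplication with the section of $\mathcal M^{-\ell}$ defining $E+C''$.
   Formalization: Smoothness is stated when C is a Tango curve and the chosen L = O_C(D), f_0 is a Tango structure, (df_0) = pD; if only (df_0) ≥ pD with strict inequality at some point, X is singular there even when C is a Tango curve. *)

(* Defs.v *)
(* MathComp world; boolp gives points of a curve a choiceType structure. *)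
From HB Require Import structures.
From mathcomp Require Import all_boot all_order all_algebra.
From mathcomp Require Import fraction qpoly mxpoly boolp.
From mathcomp Require Import mpoly freeg.

Set Implicit Arguments.
Unset Strict Implicit.
Unset Printing Implicit Defensive.

Import Order.TTheory GRing.Theory Num.Theory.
Local Open Scope ring_scope.

Section Algebra.
Variable S : comNzRingType.
Implicit Types (A I P : S -> Prop) (s : seq S).

Definition in_span s (a : S) :=
  exists c : nat -> S, a = \sum_(i < size s) c i * s`_i.

Definition ideal I :=
  [/\ I 0, forall a b, I a -> I b -> I (a + b) & forall a b, I b -> I (a * b)].

(* [P] is a prime ideal of the subring [A] of [S]. *)
Definition prime_in A P :=
  [/\ forall a, P a -> A a,
      P 0 /\ ~ P 1,
      forall a b, P a -> P b -> P (a + b),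
      forall a b, A a -> P b -> P (a * b)
    & forall a b, A a -> A b -> P (a * b) -> P a \/ P b].

Definition prime_ideal P := prime_in (fun=> True) P.

Definition nonunit (a : S) := ~ exists b, a * b = 1.

Definition noetherian :=
  forall I, ideal I -> exists s, forall a, I a <-> in_span s a.

Definition noetherian_local :=
  noetherian /\ forall a b, nonunit a -> nonunit b -> nonunit (a + b).

Definition prime_chain (n : nat) :=
  exists Q : nat -> S -> Prop,
    (forall i, (i <= n)%N -> prime_ideal (Q i)) /\
    (forall i, (i < n)%N ->
       (forall a, Q i a -> Q i.+1 a) /\ (exists a, Q i.+1 a /\ ~ Q i a)).

Definition krull_dim (n : nat) := prime_chain n /\ ~ prime_chain n.+1.

(* Regular sequences contained in the maximal ideal of a local ring. *)
Definition regular_seq s :=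
  forall i, (i < size s)%N ->
    nonunit s`_i /\
    (forall a, in_span (take i s) (s`_i * a) -> in_span (take i s) a).

Definition depth (n : nat) :=
  (exists s, regular_seq s /\ size s = n) /\
  (forall s, regular_seq s -> (size s <= n)%N).

Definition cohen_macaulay_local :=
  noetherian_local /\ exists d, krull_dim d /\ depth d.

Definition regular_local :=
  noetherian_local /\
  exists d, krull_dim d /\
    exists s, size s = d /\ forall a, nonunit a <-> in_span s a.

(* Domains that are integrally closed in their fraction field, i.e. in any
   field containing them, as far as fractions are concerned. *)
Definition normal_domain :=
  (forall a b : S, a * b = 0 -> a = 0 \/ b = 0) /\
  (forall (L : fieldType) (f : {rmorphism S -> L}), injective f ->
     forall a b, b != 0 -> integralOver f (f a / f b) ->
       exists c, f c = f a / f b).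

End Algebra.

(* [S], with [phi] restricted to [A], is the localization of the subring [A]
   of [T] at its prime ideal [P]; [phi] is irrelevant outside [A]. *)
Definition is_localization (T : comNzRingType) (A P : T -> Prop)
    (S : comNzRingType) (phi : T -> S) :=
  [/\ [/\ phi 1 = 1,
          forall a b, A a -> A b -> phi (a + b) = phi a + phi b
        & forall a b, A a -> A b -> phi (a * b) = phi a * phi b],
      forall b, A b -> ~ P b -> ~ nonunit (phi b),
      forall s, exists a b, [/\ A a, A b, ~ P b & s * phi b = phi a]
    & forall a, A a -> (phi a = 0 <-> exists b, [/\ A b, ~ P b & b * a = 0])].

(* A smooth projective (connected) curve over the algebraically closed field
   [k] is given by its function field, a function field in one variable over
   [k]; its closed points are the discrete valuations of that field over
   [k]. *)

Definition function_field1 (k K : fieldType) (cst : {rmorphism k -> K}) :=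
  exists t : K,
    (forall P : {poly k}, P != 0 -> (map_poly cst P).[t] != 0) /\
    exists b : seq K, forall y : K, exists P Q : nat -> {poly k},
      (forall i, Q i != 0) /\
      y = \sum_(i < size b)
            (map_poly cst (P i)).[t] / (map_poly cst (Q i)).[t] * b`_i.

Record curve (k : closedFieldType) := Curve {
  ratfun :> fieldType;
  cst : {rmorphism k -> ratfun};
  curveP : function_field1 cst }.

Section Curve.
Variables (k : closedFieldType) (C : curve k).

(* The value [val 0 = 0] is a mere convention. *)
Record point := Point {
  val :> C -> int;
  val0 : val 0 = 0;
  valM : forall f g, f != 0 -> g != 0 -> val (f * g) = val f + val g;
  valD : forall f g, f != 0 -> g != 0 -> f + g != 0 ->
           Num.min (val f) (val g) <= val (f + g);
  val_cst : forall a : k, val (cst C a) = 0;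
  val_unif : exists t, t != 0 /\ val t = 1 }.

HB.instance Definition _ := gen_eqMixin point.
HB.instance Definition _ := gen_choiceMixin point.

Lemma val1 (x : point) : x 1 = 0.
Proof. by rewrite -(rmorph1 (cst C)) val_cst. Qed.

Lemma valX (x : point) t m : t != 0 -> x (t ^+ m) = x t *+ m.
Proof.
move=> t0; elim: m => [|m IH]; first by rewrite expr0 val1 mulr0n.
by rewrite exprS valM ?expf_neq0 // IH mulrS.
Qed.

Lemma valV (x : point) t : t != 0 -> x t^-1 = - x t.
Proof.
move=> t0; apply: (addrI (x t)).
by rewrite -valM ?invr_eq0 // divff // val1 subrr.
Qed.

Lemma valN (x : point) t : x (- t) = x t.
Proof.
have [->|t0] := eqVneq t 0; first by rewrite oppr0.
rewrite -mulN1r valM ?oppr_eq0 ?oner_eq0 //.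
by rewrite -(rmorph1 (cst C)) -(rmorphN (cst C)) val_cst add0r.
Qed.

Lemma val_surj (x : point) (n : int) : exists2 t, t != 0 & x t = n.
Proof.
have [t [t0 xt]] := val_unif x.
case: n => m; first by exists (t ^+ m); rewrite ?expf_neq0 // valX // xt natz.
by exists (t ^- m.+1); rewrite ?invr_eq0 ?valV ?expf_neq0 // valX // xt natz NegzE.
Qed.

Definition divisor := {freeg point / int}.

Implicit Types (x : point) (D F W : divisor) (f : C).

(* The stalk at [x] of the invertible sheaf O_C(D), as a subsheaf of the
   constant sheaf of rational functions. *)
Definition OC D x : pred C := [pred f | (f == 0) || (- coeff x D <= x f)].

Definition H0 D f := forall x, OC D x f.

(* O_C(D) is ample: O_C(F + nD) is globally generated for all n >> 0,
   whatever the invertible sheaf O_C(F). *)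
Definition ample D :=
  forall F, exists n0 : nat, forall n : nat, (n0 <= n)%N ->
    forall x, exists f,
      [/\ f != 0, H0 (F + D *+ n) f & x f = - coeff x (F + D *+ n)].

Definition derivation (Delta : C -> C) :=
  [/\ forall f g, Delta (f + g) = Delta f + Delta g,
      forall f g, Delta (f * g) = f * Delta g + Delta f * g
    & forall a : k, Delta (cst C a) = 0].

(* df vanishes to order exactly [n] at [x]: if [t] is a uniformizer and
   [Delta] is d/dt, then df = Delta(f) dt and dt generates the stalk of the
   sheaf of differentials. *)
Definition ord_diff x f (n : int) :=
  exists t Delta,
    [/\ t != 0 /\ x t = 1, derivation Delta, Delta t = 1, Delta f != 0
      & x (Delta f) = n].

Definition div_diff f W := forall x, ord_diff x f (coeff x W).

(* The genus is the dimension of the space of regular differentials, which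
   is H^0(C, O_C(W)) . ds for any canonical divisor W = (ds). *)
Definition genus (g : nat) :=
  exists s W, div_diff s W /\
    exists b : seq C,
      [/\ size b = g, forall i, (i < g)%N -> H0 W b`_i,
          forall f, H0 W f ->
            exists a : nat -> k, f = \sum_(i < g) cst C (a i) * b`_i
        & forall a : nat -> k, \sum_(i < g) cst C (a i) * b`_i = 0 ->
            forall i, (i < g)%N -> a i = 0].

Variable p : nat.

Definition not_pth_power f := ~ exists h, f = h ^+ p.

Definition floor_div W : divisor := fgmap xpredT (fun n => (n %/ p%:Z)%Z) W.

Definition tango_invariant (n : int) :=
  (exists f W, [/\ not_pth_power f, div_diff f W & deg (floor_div W) = n]) /\
  (forall f W, not_pth_power f -> div_diff f W -> deg (floor_div W) <= n).

Definition pre_tango_curve := exists n, tango_invariant n /\ 0 < n.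

Definition tango_curve (g : nat) :=
  exists n, tango_invariant n /\ n * p%:Z = 2 * (g%:Z - 1).

Definition pre_tango_structure D f :=
  [/\ ample D, not_pth_power f
    & exists W, div_diff f W /\ forall x, coeff x D *+ p <= coeff x W].

Definition tango_structure D f :=
  [/\ ample D, not_pth_power f & div_diff f (D *+ p)].

(* Representatives of eta(df) in H^1(C, O_C(-D)), as families [c] of rational
   functions. Locally at x, df lifts along d to a section f - c_x^p of
   F_*O_C(-pD); globally over the function field it lifts to f; the family c
   of the p-th roots of the differences of both lifts represents the
   image of df under the connecting map. *)
Definition eta_cocycle D f (c : point -> C) :=
  forall x, OC (- (D *+ p)) x (f - c x ^+ p).

Section Bundle.
Variables (D : divisor) (c : point -> C).

(* The extension 0 -> O_C -> EE -> O_C(D) -> 0 of class (c_x)_x, as a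
   subsheaf of the constant sheaf K(C)^2: the maps are r |-> (r, 0) and
   (r, l) |-> l, and l |-> (- c_x * l, l) is a splitting at x. *)
Definition EE x (v : C * C) := OC D x v.2 && OC 0 x (v.1 + c x * v.2).

(* F^*EE, embedded in F^*(K(C)^2) = K(C)^2 *)
Definition FEE x (v : C * C) :=
  exists n (b : nat -> C) (e : nat -> C * C),
    (forall i, (i < n)%N -> OC 0 x (b i) /\ EE x (e i)) /\
    v = (\sum_(i < n) b i * (e i).1 ^+ p, \sum_(i < n) b i * (e i).2 ^+ p).

Lemma frobenius_splitting f x b : p \in [pchar k] -> eta_cocycle D f c ->
  OC (D *+ p) x b -> FEE x (- f * b, b).
Proof.
move=> hp hc hb.
have hpC : p \in [pchar C] by rewrite (fmorph_pchar (cst C)).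
have p_gt0 := prime_gt0 (pcharf_prime hpC).
have [l l0 xl] := val_surj x (- coeff x D).
pose B i := if i is 0%N then (c x ^+ p - f) * b else b / l ^+ p.
pose E i : C * C := if i is 0%N then (1, 0) else (- (c x * l), l).
exists 2, B, E; split; last first.
  rewrite !big_ord_recl !big_ord0 /= !addr0 expr1n mulr1 expr0n gtn_eqF //.
  rewrite mulr0 add0r divfK ?expf_neq0 //; congr pair.
  have -> : (- (c x * l)) ^+ p = - (c x ^+ p * l ^+ p).
    by rewrite -!(pFrobenius_autE hpC) -rmorphM -rmorphN.
  have lp : l ^+ p != 0 by rewrite expf_neq0.
  rewrite mulrN (mulrC (c x ^+ p)) mulrA divfK //.
  by rewrite mulrBl (mulrC b) addrAC subrr add0r mulNr.
case=> [|[|//]] _; split; rewrite /EE /OC /= ?coeff0 ?oppr0.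
- have [->|b0] := eqVneq b 0; first by rewrite mulr0 eqxx.
  have [->|d0] := eqVneq (c x ^+ p - f) 0; first by rewrite mul0r eqxx.
  have /orP[|hc'] := hc x; first by rewrite -opprB oppr_eq0 (negPf d0).
  rewrite valM // -opprB valN; apply/orP; right.
  move: hc' hb; rewrite /OC /= (negPf b0) /= coeffN opprK => h1 h2.
  by rewrite -(subrr (coeff x (D *+ p))) lerD.
- by rewrite eqxx /= mulr0 addr0 val1 lexx orbT.
- have [->|b0] := eqVneq b 0; first by rewrite mul0r eqxx.
  rewrite valM ?invr_eq0 ?expf_neq0 // valV ?expf_neq0 // valX // xl.
  move: hb; rewrite /OC /= (negPf b0) /= coeffMn mulNrn opprK => h.
  by apply/orP; right; rewrite -lerBlDr sub0r.
- by rewrite xl lexx orbT addNr eqxx.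
Qed.

(* The stalk of S(EE) at x is a subring of the symmetric algebra of K(C)^2,
   which we write K(C)[X_0, X_1], with (r, l) in degree 1 written as below. *)
Definition linform (v : C * C) : {mpoly C[2]} :=
  v.1 *: 'X_0 + v.2 *: 'X_1.

Inductive SE x : {mpoly C[2]} -> Prop :=
| SE_const a of OC 0 x a : SE x a%:MP
| SE_lin v of EE x v : SE x (linform v)
| SE_add (P Q : {mpoly C[2]}) of SE x P & SE x Q : SE x (P + Q)
| SE_mul (P Q : {mpoly C[2]}) of SE x P & SE x Q : SE x (P * Q).

(* The points of Proj S(EE) over Spec O_{C,x}. *)
Definition Proj_point x (q : {mpoly C[2]} -> Prop) :=
  [/\ prime_in (SE x) q,
      forall (h : {mpoly C[2]}) d, q h -> q (pihomog mdeg d h)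
    & exists v, EE x v /\ ~ q (linform v)].

Local Notation Q := {fraction {mpoly C[2]}}.

(* The stalk of O_P(n) at q. *)
Definition OP (n : int) x q (z : Q) :=
  exists (i j : nat) (a b : {mpoly C[2]}),
    [/\ SE x a /\ a \is i.-homog, SE x b /\ b \is j.-homog,
        ~ q b, i%:Z - j%:Z = n & z = tofrac a / tofrac b].

(* The stalk of O_P(n) (x) pi^*O_C(F) at q. *)
Definition OPC (n : int) F x q (z : Q) :=
  exists f u, [/\ OC F x f, OP n x q u & z = tofrac f%:MP * u].

End Bundle.

(* Equation of E: the section of O_P(1) given by 1 in H^0(C, O_C). *)
Definition eqE : {mpoly C[2]} := linform (1, 0).

(* The splitting O_C(pD) -> F^*EE is b |-> (- f b, b), see
   [frobenius_splitting]; it is unique since H^0(C, O_C(-pD)) = 0.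
   Twisted by O_C(-pD), it maps 1 to (- f, 1), which gives the equation of
   Gamma' in P(F^*EE). *)
Definition eqGamma f : {mpoly C[2]} := linform (- f, 1).

(* Equation of C'', pulled back from Gamma' by relative Frobenius; a section
   of O_P(p) (x) pi^*O_C(-pD). *)
Definition eqC'' f : {mpoly C[2]} := eqGamma f \mPo [tuple 'X_i ^+ p | i < 2].

End Curve.

(* [rd_iso] is a rational function, multiplication by which is an isomorphism
   from O_C(D) to O_C(eN), i.e. from L to the e-th power of the sheaf of
   [rd_N]. *)
Record raynaud_datum (k : closedFieldType) (C : curve k) (p : nat) :=
  RaynaudDatum {
    rd_D : divisor C;
    rd_f : C;
    rd_fP : pre_tango_structure p rd_D rd_f;
    rd_c : point C -> C;
    rd_cP : eta_cocycle p rd_D rd_f rd_c;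
    rd_e : nat;
    rd_e_ge2 : (2 <= rd_e)%N;
    rd_e_coprime : coprime rd_e p;
    rd_e_dvd : (rd_e%:Z %| deg rd_D)%Z;
    rd_N : divisor C;
    rd_N_ample : ample rd_N;
    rd_iso : C;
    rd_iso_neq0 : rd_iso != 0;
    rd_isoP : forall x : point C, x rd_iso = coeff x rd_D - coeff x rd_N *+ rd_e;
    rd_l : nat;
    rd_l_ge2 : (2 <= rd_l)%N;
    rd_l_dvdp : (rd_l %| p.+1)%N;
    rd_l_dvde : (rd_l %| rd_e)%N }.

Section Raynaud.
Variables (k : closedFieldType) (C : curve k) (p : nat).
Variable R : raynaud_datum C p.

Local Notation Q := {fraction {mpoly (ratfun C)[2]}}.
Local Notation e := (rd_e R).
Local Notation l := (rd_l R).

(* The stalk at q of M^i, where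
   M = O_P(- (p+1)/l) (x) pi^*O_C(N)^(pe/l). *)
Definition MM (i : nat) x q : Q -> Prop :=
  OPC (rd_D R) (rd_c R) (- ((p.+1 %/ l) * i)%N%:Z)
      (rd_N R *+ ((p * e %/ l) * i)) x q.

(* The section of M^-l defining E + C'': product of the equations of E and
   C'', after identification of L^-p with N^-pe. *)
Definition branch : Q :=
  tofrac ((rd_iso R)^-1 ^+ p *: (eqE C * eqC'' p (rd_f R))).

Lemma branch_section x q : p \in [pchar k] ->
  Proj_point (rd_D R) (rd_c R) x q ->
  OPC (rd_D R) (rd_c R) p.+1%:Z (- (rd_N R *+ (p * e))) x q branch.
Proof.
move=> hp [[_ [_ q1] _ _ _] _ _].
set D := rd_D R; set c := rd_c R; set f := rd_f R; set N := rd_N R.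
have hpC : p \in [pchar C] by rewrite (fmorph_pchar (cst C)).
have a0 := rd_iso_neq0 R; set a := rd_iso R in a0 *.
have [b b0 xb] := val_surj x (coeff x N *+ (p * e)).
have [u u0 xu] := val_surj x (coeff x D).
pose g := b^-1 * a^-1 ^+ p * u ^+ p.
have g0 : g != 0 by rewrite !mulf_neq0 ?invr_eq0 ?expf_neq0 ?invr_eq0.
have xg : x g = 0.
  rewrite /g !valM ?mulf_neq0 ?invr_eq0 ?expf_neq0 ?invr_eq0 //.
  rewrite valV // !valX ?invr_eq0 // valV // rd_isoP xb xu -/D -/N.
  by rewrite opprB mulrnBl -mulrnA mulnC addrA addNr add0r addNr.
have hX : EE D c x (1, 0).
  by rewrite /EE /OC /= eqxx mulr0 addr0 coeff0 val1 oppr0 lexx orbT.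
have hY : EE D c x (- (c x * u^-1), u^-1).
  by rewrite /EE /OC /= valV // xu lexx orbT addNr eqxx.
pose h := (c x ^+ p - f) / u ^+ p.
have hh : OC 0 x h.
  rewrite /OC /= coeff0 oppr0 /h.
  have [->|d0] := eqVneq (c x ^+ p - f) 0; first by rewrite mul0r eqxx.
  have := rd_cP R x; rewrite /OC /= -/c -/f -/D -opprB oppr_eq0 (negPf d0) /=.
  rewrite valN coeffN opprK coeffMn => hx; apply/orP; right.
  by rewrite valM ?invr_eq0 ?expf_neq0 // valV ?expf_neq0 // valX // xu subr_ge0.
pose X := linform (1, 0) : {mpoly C[2]}.
pose Y := linform (- (c x * u^-1), u^-1) : {mpoly C[2]}.
pose G := g%:MP * (X * (Y ^+ p + h%:MP * X ^+ p)).
have SX m (P : {mpoly C[2]}) : SE D c x P -> SE D c x (P ^+ m).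
  move=> SP; elim: m => [|m IH]; last by rewrite exprS; exact: SE_mul.
  by rewrite expr0 -mpolyC1; apply: SE_const; rewrite /OC /= coeff0 val1 oppr0 lexx orbT.
have lin (v : C * C) : linform v \is 1.-homog.
  by rewrite /linform rpredD // rpredZ // dhomogX /= mdeg1.
have Xp : X = 'X_0 by rewrite /X /linform /= scale1r scale0r addr0.
have hpM : p \in [pchar {mpoly C[2]}].
  apply/andP; split; first exact: pcharf_prime hpC.
  by rewrite -mpolyC_nat (pcharf0 hpC) mpolyC0.
have Yp : Y ^+ p = (u ^- p) *: ('X_1 ^+ p - c x ^+ p *: 'X_0 ^+ p).
  have -> : Y = u^-1 *: ('X_1 - c x *: 'X_0).
    by rewrite /Y /linform /= scaleNr scalerBr scalerA addrC mulrC.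
  have FB (P P' : {mpoly C[2]}) : (P - P') ^+ p = P ^+ p - P' ^+ p.
    by rewrite -!(pFrobenius_autE hpM) -rmorphB.
  by rewrite exprZn exprVn FB exprZn.
have C''p : eqC'' p f = 'X_1 ^+ p - f *: 'X_0 ^+ p.
  rewrite /eqC'' /eqGamma /linform /= scale1r comp_mpolyD comp_mpolyZ.
  by rewrite !comp_mpolyXU -!tnth_nth !tnth_mktuple scaleNr addrC.
exists b, (tofrac G / tofrac 1); split.
- by rewrite /OC /= xb coeffN opprK coeffMn lexx orbT.
- exists p.+1, 0%N, G, 1; split=> //; last by rewrite subr0.
    split.
      apply: SE_mul; first by apply: SE_const; rewrite /OC /= coeff0 xg oppr0 lexx orbT.
      apply: SE_mul; first exact: SE_lin.
      apply: SE_add; first by apply: SX; exact: SE_lin.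
      by apply: SE_mul; [exact: SE_const | apply: SX; exact: SE_lin].
    have Lp (v : C * C) : linform v ^+ p \is p.-homog.
      by have := dhomogMn p (lin v); rewrite mul1n.
    rewrite /G mul_mpolyC rpredZ //.
    have -> : p.+1 = (1 + p)%N by rewrite add1n.
    apply: dhomogM; first exact: lin.
    by rewrite rpredD ?mul_mpolyC ?rpredZ ?Lp.
  split; last exact: dhomog1.
  by rewrite -mpolyC1; apply: SE_const; rewrite /OC /= coeff0 val1 oppr0 lexx orbT.
rewrite rmorph1 divr1 -rmorphM; congr tofrac.
have -> : G = (g * u ^- p) *: (X * eqC'' p f).
  rewrite /G mul_mpolyC -scalerA; congr (_ *: _); rewrite scalerAr; congr (_ * _).
  rewrite C''p Yp Xp mul_mpolyC /h mulrC -scalerA -scalerDr; congr (_ *: _).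
  by rewrite scalerBl addrA subrK.
rewrite mul_mpolyC scalerA; congr (_ *: _).
by rewrite /g -!mulrA divff ?expf_neq0 // mulr1 mulVKf.
Qed.

(* The sum of the M^i, i < l, where Z^i labels the summand M^i, and two
   summands multiply by Z^i * Z^j = branch * Z^(i + j - l) for i + j >= l. *)
Definition cyclic_alg := {poly %/ ('X^l - branch%:P)}.

Definition psiOX x q (z : cyclic_alg) :=
  forall i, (i < l)%N -> MM i x q (z : {poly Q})`_i.

(* [S] is (isomorphic to) the local ring of X at one of its points; the
   points of X = Spec(psi_*O_X) over Spec O_{P,q} are the primes of the stalk
   of psi_*O_X at q. *)
Definition raynaud_stalk (S : comNzRingType) :=
  exists x q (P : cyclic_alg -> Prop) (phi : cyclic_alg -> S),
    [/\ Proj_point (rd_D R) (rd_c R) x q,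
        prime_in (psiOX x q) P
      & is_localization (psiOX x q) P phi].

End Raynaud.

(* A scheme enters below through its local rings only, up to isomorphism. *)
Definition stalks := comNzRingType -> Prop.

Definition normal_scheme (X : stalks) := forall S, X S -> normal_domain S.

Definition cohen_macaulay_scheme (X : stalks) :=
  forall S, X S -> cohen_macaulay_local S.

(* For schemes of finite type over an algebraically closed field, as here,
   smooth means nonsingular: all local rings are regular. *)
Definition smooth_scheme (X : stalks) := forall S, X S -> regular_local S.

(* Main.v *)
(** Let A be the local ring of C at a point x, a discrete valuation ring with
    uniformizer t. Trivializing the bundle and N at x presents each local ring
    S of X above x as a localization of A[v][w] / (w^l - b1 b2), where b2 is a
    unit of S and b1 is v, the equation of E, or v^p + h with
    h = (c_x^p - f) / u^p, the equation of C''. In the second case b1 is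
    irreducible because f is not a p-th power.

    Normality: l is invertible and k contains the l-th roots of unity, so
    averaging over the conjugates splits an integral fraction into integral
    components r_i w^i; as A[v] is normal and b1 is irreducible, each r_i has
    no denominator.

    Cohen-Macaulay: S is free over a localization of A[v], which provides a
    regular sequence as long as the dimension of S, itself bounded by
    integrality over A[v].

    Regularity: off the branch locus the cover is etale; on it, w takes the
    place of b1 among the parameters, so b1 has to be part of a system of
    parameters of A[v]. In the Tango case dh = - df / u^p does not vanish at x,
    hence an element h + a^p of the maximal ideal of A is t times a unit, and
    v^p + h = (v - a)^p + (h + a^p) is a parameter complementing v - a; if
    there is no such element, t complements v^p + h. *)

(* Points of the surface are arbitrary primes, so the dimension of [S] is not known beforehand, and
   the arguments branch on whether [pi] becomes a unit in [S] and on whether the nonunits coming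
   from A[v] are all multiples of [pi]. To avoid denominators, A[v] is left unlocalized: [S] is
   handled through a morphism [Phi] from A[v][w] that kills w^l - b, is injective in degrees below
   l, and has every element of [S] as a fraction of its values. The arithmetic of A[v] is Gauss's
   lemma for the single prime [pi], together with pseudo-division.

   [S] is a domain because w^l - branch is irreducible over the function field of P: the branch form
   has degree p in X_1, and l divides p + 1, hence is prime to p. The criterion used, a norm
   computed from a companion matrix, also serves for v^p + h.

   In the Tango case the derivation d/dt has to preserve A. This rests on K(C) having degree at most
   p over its p-th powers, which writes every element of A as a sum of terms a_i^p t^i with i < p
   and a_i in A. *)
From HB Require Import structures.
Require Import Defs.
From mathcomp Require Import all_boot all_order all_algebra.
From mathcomp Require Import generic_quotient fraction qpoly mxpoly boolp.
From mathcomp Require Import mpoly freeg cyclic separable cyclotomic zify ring.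
From mathcomp Require classical_sets.

Set Implicit Arguments.
Unset Strict Implicit.
Unset Printing Implicit Defensive.

Import Order.TTheory GRing.Theory Num.Theory.
Local Open Scope ring_scope.

(** * Regular sequences and prime chains *)

Section Span.
Variable S : comNzRingType.
Implicit Types (s t : seq S) (a b : S).

Lemma in_span_nil a : in_span [::] a <-> a = 0.
Proof.
split=> [[c ->]|->]; first by rewrite big_ord0.
by exists (fun=> 0); rewrite big_ord0.
Qed.

Lemma in_span_cons x s a :
  in_span (x :: s) a <-> exists c b, in_span s b /\ a = c * x + b.
Proof.
split=> [[c ->]|[c [b [[d ->] ->]]]].
  exists (c 0%N), (\sum_(i < size s) c i.+1 * s`_i); split.
    by exists (fun i => c i.+1).
  by rewrite big_ord_recl.
by exists (fun i => if i is j.+1 then d j else c); rewrite big_ord_recl.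
Qed.

Lemma in_span_ideal s : ideal (in_span s).
Proof.
split=> [|a b [c ->] [d ->]|a b [c ->]].
- by exists (fun=> 0); rewrite big1 // => i _; rewrite mul0r.
- exists (fun i => c i + d i); rewrite -big_split /=.
  by apply: eq_bigr => i _; rewrite mulrDl.
- exists (fun i => a * c i); rewrite mulr_sumr.
  by apply: eq_bigr => i _; rewrite mulrA.
Qed.

Lemma ideal_sum (I : S -> Prop) n (F : nat -> S) :
  ideal I -> (forall i, (i < n)%N -> I (F i)) -> I (\sum_(i < n) F i).
Proof.
move=> [I0 ID _]; elim: n => [|n IH] IF; first by rewrite big_ord0.
rewrite big_ord_recr /=; apply: ID; last exact: IF.
by apply: IH => i lt_in; apply: IF; apply: ltnW.
Qed.

Lemma in_span_min (I : S -> Prop) s a : ideal I ->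
  (forall i, (i < size s)%N -> I s`_i) -> in_span s a -> I a.
Proof.
move=> idI sI [c ->]; case: (idI) => _ _ IM.
by apply: (ideal_sum (F := fun i => c i * s`_i)) => // i lt_is; apply: IM; apply: sI.
Qed.

Lemma in_span_nth s i : (i < size s)%N -> in_span s s`_i.
Proof.
elim: s i => // x s IH [|i] /= lt_is; apply/in_span_cons.
  exists 1, 0; rewrite mul1r addr0; split=> //; case: (in_span_ideal s) => //.
by exists 0, s`_i; rewrite mul0r add0r; split=> //; apply: IH.
Qed.

Lemma in_span_mkseq (f : nat -> S) n a :
  in_span (mkseq f n) a <-> exists c : nat -> S, a = \sum_(i < n) c i * f i.
Proof.
rewrite /in_span size_mkseq; split=> [[c ->]|[c ->]]; exists c;
  by apply: eq_bigr => i _; rewrite nth_mkseq.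
Qed.

Lemma in_span1 x a : in_span [:: x] a <-> exists c, a = c * x.
Proof.
split=> [/in_span_cons[c [b [/in_span_nil -> ->]]]|[c ->]].
  by exists c; rewrite addr0.
by apply/in_span_cons; exists c, 0; rewrite addr0; split=> //; apply/in_span_nil.
Qed.

Lemma in_span2 x y a : in_span [:: x; y] a <-> exists c d, a = c * x + d * y.
Proof.
split=> [/in_span_cons[c [b [/in_span1[d ->] ->]]]|[c [d ->]]]; first by exists c, d.
by apply/in_span_cons; exists c, (d * y); split=> //; apply/in_span1; exists d.
Qed.

Lemma idealN (I : S -> Prop) a : ideal I -> I a -> I (- a).
Proof. by case=> _ _ IM Ia; rewrite -mulN1r; apply: IM. Qed.

Lemma idealB (I : S -> Prop) a b : ideal I -> I a -> I b -> I (a - b).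
Proof. by move=> idI Ia Ib; case: (idI) => _ ID _; apply: ID => //; apply: idealN. Qed.

Lemma prime_ideal_ideal (Q : S -> Prop) : prime_ideal Q -> ideal Q.
Proof. by case=> _ [Q0 _] QD QM _; split=> // a b; apply: QM. Qed.

Lemma prime_idealM (Q : S -> Prop) a b : prime_ideal Q -> Q (a * b) -> Q a \/ Q b.
Proof. by case=> _ _ _ _; apply. Qed.

Lemma prime_idealX (Q : S -> Prop) a n : prime_ideal Q -> Q (a ^+ n) -> Q a.
Proof.
move=> prQ; elim: n => [|n IH]; first by case: prQ => _ [_ Q1].
by rewrite exprS => /(prime_idealM prQ)[].
Qed.

Lemma prime_ideal_nonunit (Q : S -> Prop) a : prime_ideal Q -> Q a -> nonunit a.
Proof.
move=> prQ Qa [b ab1]; case: (prQ) => _ [_ Q1] _ QM _; apply: Q1.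
by rewrite -ab1 mulrC; apply: QM.
Qed.

Lemma nonunitMl a b : nonunit b -> nonunit (a * b).
Proof. by move=> nb [c abc]; apply: nb; exists (a * c); rewrite mulrA (mulrC b). Qed.

Lemma nonunit0 : nonunit (0 : S).
Proof. by case=> b; rewrite mul0r => /eqP; rewrite eq_sym oner_eq0. Qed.

Lemma nonunit1 : ~ nonunit (1 : S).
Proof. by apply; exists 1; rewrite mulr1. Qed.

Lemma unit_mul a b : ~ nonunit a -> ~ nonunit b -> ~ nonunit (a * b).
Proof.
move=> /contrapT[c ac] /contrapT[d bd]; apply; exists (c * d).
by rewrite mulrACA ac bd mulr1.
Qed.

Lemma nonunit_prime : (forall a b, nonunit a -> nonunit b -> nonunit (a + b)) ->
  prime_ideal (@nonunit S).
Proof.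
move=> locS; split=> //; first by split; [exact: nonunit0 | exact: nonunit1].
  by move=> a b _; apply: nonunitMl.
move=> a b _ _ nab; apply: contrapT => /not_orP[ua ub].
exact: (unit_mul ua ub).
Qed.

(** Krull's argument: an ideal maximal among those that contain [J] and miss [M], which exists by
    Zorn's lemma, is prime. *)
Lemma prime_ideal_avoiding (J M : S -> Prop) :
    ideal J -> M 1 -> (forall a b, M a -> M b -> M (a * b)) ->
    (forall a, J a -> ~ M a) ->
  exists Q, [/\ prime_ideal Q, forall a, J a -> Q a & forall a, Q a -> ~ M a].
Proof.
move=> idJ M1 MM JM.
pose good (X : S -> Prop) := [/\ ideal X, forall a, J a -> X a & forall a, X a -> ~ M a].
pose P : classical_sets.set (classical_sets.set S) := fun X => (forall a, ~ X a) \/ good X.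
have [F FP totF|Q [PQ maxQ]] := @classical_sets.Zorn_bigcup S P.
  have [[X [FX gX]]|noX] := pselect (exists X, F X /\ good X); last first.
    left=> a [X FX Xa]; case: (FP X FX) => [nX|gX]; first exact: (nX a).
    by apply: noX; exists X.
  right; split=> [|a Ja|a [Y FY Ya]].
  - split=> [|a b [Y FY Ya] [Z FZ Zb]|a b [Y FY Yb]].
    + by exists X => //; case: gX => -[].
    + have [YZ|ZY] := totF _ _ FY FZ.
        exists Z => //; case: (FP Z FZ) => [/(_ b)//|[[_ ZD _] _ _]].
        by apply: ZD => //; apply: YZ.
      exists Y => //; case: (FP Y FY) => [/(_ a)//|[[_ YD _] _ _]].
      by apply: YD => //; apply: ZY.
    + exists Y => //; case: (FP Y FY) => [/(_ b)//|[[_ _ YM] _ _]]; exact: YM.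
  - by exists X => //; case: gX => _ JX _; apply: JX.
  - by case: (FP Y FY) => [/(_ a)//|[_ _ YM]]; apply: YM.
have gQ : good Q.
  case: PQ => // nQ; case: (maxQ J); last by right; split.
  split; last by move=> JQ; apply: (nQ 0); apply: JQ; case: idJ.
  by move=> a /nQ.
case: (gQ) => idQ JQ QM; exists Q; split=> //; case: (idQ) => Q0 QD QMl.
(* A proper extension of Q by [a] meets M, by maximality. *)
have ext a : ~ Q a -> exists q c, Q q /\ M (q + c * a).
  move=> nQa; apply: contrapT => noM.
  apply: (maxQ (fun b => exists q c, Q q /\ b = q + c * a)).
    split=> [b Qb|QX]; first by exists b, 0; rewrite mul0r addr0.
    by apply: nQa; apply: QX; exists 0, 1; rewrite mul1r add0r.
  right; split=> [|b Jb|b [q [c [Qq ->]]] Mb].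
  - split=> [|b d [q [c [Qq ->]]] [q' [c' [Qq' ->]]]|b d [q [c [Qq ->]]]].
    + by exists 0, 0; rewrite mul0r addr0.
    + by exists (q + q'), (c + c'); rewrite mulrDl addrACA; split=> //; apply: QD.
    + by exists (b * q), (b * c); rewrite mulrDr mulrA; split=> //; apply: QMl.
  - by exists b, 0; rewrite mul0r addr0; split=> //; apply: JQ.
  - by apply: noM; exists q, c.
split=> //; first by split=> // Q1; apply: (QM 1).
  by move=> a b _; apply: QMl.
move=> a b _ _ Qab; apply: contrapT => /not_orP[/ext[q [c [Qq Ma]]] /ext[q' [c' [Qq' Mb]]]].
apply: (QM _ _ (MM _ _ Ma Mb)); rewrite mulrDl; apply: (QD).
  by rewrite mulrC; apply: (QMl).
rewrite mulrDr; apply: (QD); first exact: (QMl).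
by rewrite mulrACA; apply: QMl.
Qed.

(** The chain is built downwards from the maximal ideal. Below a prime containing the first m + 1
    elements there is one that contains the first m and misses the last, since that one is a
    nonzerodivisor modulo the others. *)
Lemma regular_seq_prime_chain s :
  (forall a b, nonunit a -> nonunit b -> nonunit (a + b :> S)) ->
  regular_seq s -> prime_chain S (size s).
Proof.
move=> locS; have prm := nonunit_prime locS => reg_s.
suff {reg_s} H n : (n <= size s)%N -> regular_seq s ->
  exists Q : nat -> S -> Prop,
    [/\ forall i, (i <= n)%N -> prime_ideal (Q i),
        forall i, (i < n)%N -> (forall a, Q i a -> Q i.+1 a) /\ (exists a, Q i.+1 a /\ ~ Q i a)
      & forall a, in_span (take (size s - n) s) a -> Q 0%N a].
  by have [Q [Q1 Q2 _]] := H _ (leqnn _) reg_s; exists Q.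
move=> + reg_s; elim: n => [_|n IH lt_ns].
  exists (fun=> @nonunit S); split=> // a.
  apply: in_span_min; first exact: prime_ideal_ideal.
  move=> i; rewrite subn0 take_size => lt_is; by case: (reg_s i lt_is).
have [Q [prQ ltQ sQ]] := IH (ltnW lt_ns).
pose m := (size s - n.+1)%N; pose x := s`_m.
have lt_ms : (m < size s)%N by rewrite ltn_subrL /=; apply: leq_ltn_trans lt_ns.
have Em : (size s - n)%N = m.+1 by rewrite /m subnSK.
have takeE : take m.+1 s = rcons (take m s) x by rewrite (take_nth 0).
have [nx regx] := reg_s m lt_ms.
have Qx : Q 0%N x.
  apply: sQ; rewrite Em; have -> : x = (take m.+1 s)`_m by rewrite nth_take.
  apply: in_span_nth.
  by rewrite size_takel.
have prQ0 := prQ 0%N isT.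
(* The primes avoiding every [u * x ^+ i], u outside Q 0, lie in Q 0 and miss x. *)
pose M b := exists u i, ~ Q 0%N u /\ b = u * x ^+ i.
have [||||Q' [prQ' JQ' QM']] := @prime_ideal_avoiding (in_span (take m s)) M.
- exact: in_span_ideal.
- by exists 1, 0%N; rewrite mul1r; split=> //; case: prQ0 => _ [].
- move=> _ _ [u [i [nu ->]]] [v [j [nv ->]]]; exists (u * v), (i + j)%N.
  rewrite mulrACA exprD; split=> // /(prime_idealM prQ0)[] //.
(* Regularity cancels the powers of [x] one by one, until [u] itself would lie in the span, hence in
   [Q 0]. *)
- move=> a + [u [i [nu Ea]]]; rewrite {a}Ea.
  elim: i => [|i IHi].
    rewrite mulr1 => Ju; apply: nu; apply: sQ; rewrite Em takeE -cats1.
    move: Ju; apply: in_span_min; first exact: in_span_ideal.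
    move=> j ltj; have -> : (take m s)`_j = (take m s ++ [:: x])`_j by rewrite nth_cat ltj.
    by apply: in_span_nth; rewrite size_cat ltn_addr.
  by rewrite exprS mulrCA => /regx.
have nQ'x : ~ Q' x.
  move=> /QM'; apply; exists 1, 1%N; rewrite mul1r expr1; split=> //.
  by case: prQ0 => _ [].
have Q'Q a : Q' a -> Q 0%N a.
  move=> /QM' nMa; apply: contrapT => nQa; apply: nMa.
  by exists a, 0%N; rewrite mulr1.
exists (fun i => if i is j.+1 then Q j else Q'); split=> [[|i] // lti||//]; first exact: prQ.
case=> [_|i /ltQ //]; split=> //; by exists x.
Qed.

Lemma prime_chain_le n m : (m <= n)%N -> prime_chain S n -> prime_chain S m.
Proof.
move=> le_mn [Q [prQ ltQ]]; exists Q; split=> i lti; first by apply: prQ; apply: leq_trans le_mn.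
by apply: ltQ; apply: leq_trans le_mn.
Qed.

(** A regular sequence yields a prime chain of its length, so a single sequence and a bound on
    chains determine dimension and depth at once. *)
Lemma krull_dim_depth s : noetherian_local S -> regular_seq s ->
  ~ prime_chain S (size s).+1 -> krull_dim S (size s) /\ depth S (size s).
Proof.
move=> [noeS locS] reg_s nch; split; first by split=> //; apply: regular_seq_prime_chain.
split; first by exists s.
move=> t /(regular_seq_prime_chain locS) cht.
rewrite leqNgt; apply/negP => lt_st; apply: nch; exact: prime_chain_le cht.
Qed.

End Span.

(** Hilbert's basis theorem. For an ideal that is not finitely generated, successive choices of
    minimal size have leading coefficients of which some new one is a combination of the earlier
    ones; subtracting the matching combination of polynomials contradicts minimality. *)
Lemma noetherian_poly (S : comNzRingType) : noetherian S -> noetherian {poly S}.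
Proof.
move=> noeS I idI; apply: contrapT => nfg; case: (idI) => I0 ID IM.
(* Pick successively an element of minimal size outside the span of the previous ones. *)
have min_ex (s : seq {poly S}) : (forall i, (i < size s)%N -> I s`_i) ->
    exists f, [/\ I f, ~ in_span s f
      & forall g, I g -> ~ in_span s g -> (size f <= size g)%N].
  move=> sI.
  have [f [If nf]] : exists f, I f /\ ~ in_span s f.
    apply: contrapT => nof; apply: nfg; exists s => f; split=> [If|]; last exact: (in_span_min idI sI).
    by apply: contrapT => nsf; apply: nof; exists f.
  have exn : exists n, `[< exists g, [/\ I g, ~ in_span s g & size g = n] >].
    by exists (size f); apply/asboolP; exists f.
  case: (ex_minnP exn) => n /asboolP[g [Ig ng <-]] ming; exists g; split=> // h Ih nh.
  by apply: ming; apply/asboolP; exists h.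
have [pick pickP] : exists pick : seq {poly S} -> {poly S}, forall s : seq {poly S},
    (forall i, (i < size s)%N -> I s`_i) -> [/\ I (pick s), ~ in_span s (pick s)
      & forall g, I g -> ~ in_span s g -> (size (pick s) <= size g)%N].
  have /choice[pick pickP] : forall s : seq {poly S}, exists f, (forall i, (i < size s)%N -> I s`_i) ->
    [/\ I f, ~ in_span s f & forall g, I g -> ~ in_span s g -> (size f <= size g)%N].
    move=> s; have [/min_ex[f]|] := pselect (forall i, (i < size s)%N -> I s`_i); first by exists f.
    by exists 0.
  by exists pick.
pose s_ n := iter n (fun s => rcons s (pick s)) [::].
pose f n := pick (s_ n).
have sE n : s_ n = mkseq f n by elim: n => //= n IH; rewrite -/(s_ n) mkseqS -IH.
have fP n : [/\ I (f n), ~ in_span (mkseq f n) (f n)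
    & forall g, I g -> ~ in_span (mkseq f n) g -> (size (f n) <= size g)%N].
  elim/ltn_ind: n => n IH; rewrite -sE; apply: pickP => i.
  by rewrite sE size_mkseq => lt_in; rewrite nth_mkseq //; case: (IH i lt_in).
have f_mono i n : (i <= n)%N -> (size (f i) <= size (f n))%N.
  move=> le_in; have [_ _ minf] := fP i; have [Ifn nfn _] := fP n; apply: minf => // spi.
  apply: nfn; move: spi => /in_span_mkseq[c E].
  apply/in_span_mkseq; exists (fun j => if (j < i)%N then c j else 0).
  rewrite E (big_ord_widen n (fun j => c j * f j)) // big_mkcond /=.
  by apply: eq_bigr => j _; case: ifP => // _; rewrite mul0r.
pose J a := exists n, in_span (mkseq (fun i => lead_coef (f i)) n) a.
have Jmono n m a : (n <= m)%N -> in_span (mkseq (fun i => lead_coef (f i)) n) a ->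
    in_span (mkseq (fun i => lead_coef (f i)) m) a.
  move=> le_nm; apply: in_span_min; first exact: in_span_ideal.
  move=> i; rewrite size_mkseq => lti; rewrite nth_mkseq //.
  have ltm : (i < m)%N by apply: leq_trans le_nm.
  rewrite -(nth_mkseq 0 (fun i => lead_coef (f i)) ltm).
  by apply: in_span_nth; rewrite size_mkseq.
have idJ : ideal J.
  split=> [|a b [n Ja] [m Jb]|a b [n Jb]].
  - by exists 0%N; apply/in_span_nil.
  - exists (maxn n m); case: (in_span_ideal (mkseq (fun i => lead_coef (f i)) (maxn n m))) => _ D _.
    by apply: D; [apply: Jmono Ja; apply: leq_maxl | apply: Jmono Jb; apply: leq_maxr].
  - by exists n; case: (in_span_ideal (mkseq (fun i => lead_coef (f i)) n)) => _ _; apply.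
have [t tP] := noeS J idJ.
have [N JN] : exists N, forall a, J a -> in_span (mkseq (fun i => lead_coef (f i)) N) a.
  suff [N tN] : exists N, forall i, (i < size t)%N -> in_span (mkseq (fun i => lead_coef (f i)) N) t`_i.
    exists N => a /tP; apply: in_span_min => //; exact: in_span_ideal.
  have : forall i, (i < size t)%N -> J t`_i by move=> i lti; apply/tP; apply: in_span_nth.
  elim: t {tP} => [_|a t IH tJ]; first by exists 0%N.
  have [|N tN] := IH; first by move=> i; apply: (tJ i.+1).
  have [m am] := tJ 0%N isT; exists (maxn N m) => -[_|i lti].
    exact: Jmono (leq_maxr _ _) am.
  exact: Jmono (leq_maxl _ _) (tN i lti).
have [IfN nfN minf] := fP N.
have [|c Ec] := (in_span_mkseq _ _ _).1 (JN (lead_coef (f N)) _).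
  exists N.+1; apply/in_span_mkseq; exists (fun i => (i == N)%:R).
  rewrite big_ord_recr /= eqxx mul1r big1 ?add0r // => i _.
  by rewrite (ltn_eqF (ltn_ord i)) mul0r.
(* The power of 'X brings [f i] to the size of [f N]; sizes are nondecreasing, so the subtraction is
   not truncated. *)
pose F i := c i *: 'X^(size (f N) - size (f i)) * f i.
pose g := f N - \sum_(i < N) F i.
have spF : in_span (mkseq f N) (\sum_(i < N) F i).
  by apply/in_span_mkseq; exists (fun i => c i *: 'X^(size (f N) - size (f i))).
have nsg : ~ in_span (mkseq f N) g.
  move=> spg; apply: nfN; rewrite -(subrK (\sum_(i < N) F i) (f N)) -/g.
  by case: (in_span_ideal (mkseq f N)) => _ D _; apply: D.
have Ig : I g.
  apply: idealB => //; apply: ideal_sum => // i lti; rewrite /F.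
  by apply: IM; case: (fP i).
have fN0 : f N != 0.
  by apply/eqP => E; apply: nfN; rewrite E; case: (in_span_ideal (mkseq f N)).
have := minf g Ig nsg; rewrite leqNgt => /negP; apply.
rewrite (polySpred fN0) ltnS; apply/leq_sizeP => j; rewrite leq_eqVlt.
have shift i j' : (i < N)%N -> (F i)`_j' = c i *
    (if (j' < size (f N) - size (f i))%N then 0 else (f i)`_(j' - (size (f N) - size (f i)))).
  by move=> _; rewrite /F -scalerAl coefZ coefXnM.
have fi0 i : f i != 0.
  by apply/eqP => E; have [_ nfi _] := fP i; apply: nfi; rewrite E; case: (in_span_ideal (mkseq f i)).
case/predU1P=> [<-|]; last rewrite -(polySpred fN0) => le_j.
  rewrite coefB coef_sum -[(f N)`_(size (f N)).-1]/(lead_coef _) Ec.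
  apply/eqP; rewrite subr_eq0; apply/eqP/eq_bigr => -[i /= lti] _; rewrite shift //.
  have le_iN := f_mono i N (ltnW lti).
  have si0 : (0 < size (f i))%N by rewrite size_poly_gt0.
  have sN0 : (0 < size (f N))%N by rewrite size_poly_gt0.
  have aux a b : (0 < b -> b <= a -> (a.-1 < a - b) = false /\ a.-1 - (a - b) = b.-1)%N.
    by move=> b0 le_ba; split; lia.
  by have [-> ->] := aux _ _ si0 le_iN.
rewrite coefB coef_sum nth_default // big1 ?subr0 // => -[i /= lti] _; rewrite shift //.
have le_iN := f_mono i N (ltnW lti).
case: ifP => _; first by rewrite mulr0.
rewrite nth_default ?mulr0 //.
have aux a b : (b <= a -> a <= j -> b <= j - (a - b))%N by move=> *; lia.
exact: aux.
Qed.

(** An ideal is generated by the images of generators of its preimage, as denominators are units. *)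
Lemma noetherian_localization (W S : comNzRingType) (Phi : {rmorphism W -> S}) :
  (forall s, exists a b, ~ nonunit (Phi b) /\ s * Phi b = Phi a) ->
  noetherian W -> noetherian S.
Proof.
move=> fracS noeW I idI; case: (idI) => I0 ID IM.
have [|s sP] := noeW (fun w => I (Phi w)).
  split=> [|a b|a b]; rewrite ?rmorph0 ?rmorphD ?rmorphM //; [exact: ID | exact: IM].
exists (map Phi s) => a; split=> [Ia|]; last first.
  apply: in_span_min => // i; rewrite size_map => lti; rewrite (nth_map 0) //.
  by apply/sP; apply: in_span_nth.
have [w [v [/contrapT[u vu] Ew]]] := fracS a.
have /sP[c Ec] : I (Phi w) by rewrite -Ew mulrC; apply: IM.
exists (fun i => u * Phi (c i)).
rewrite -[a]mulr1 -vu mulrA Ew mulrC Ec rmorph_sum mulr_sumr size_map.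
by apply: eq_bigr => i _; rewrite rmorphM mulrA (nth_map 0).
Qed.

(** * Polynomials over a discrete valuation ring *)

Lemma poly_pseudo_division (R : idomainType) (f h : {poly R}) : f != 0 ->
  exists k q r, lead_coef f ^+ k *: h = q * f + r /\ (size r < size f)%N.
Proof.
move=> f0; exists (Pdiv.Idomain.scalp h f), (Pdiv.Idomain.divp h f), (Pdiv.Idomain.modp h f).
by rewrite Pdiv.Idomain.divp_eq Pdiv.Idomain.ltn_modp.
Qed.

Lemma lead_coef_MXaddC (R : nzRingType) (p : {poly R}) c :
  lead_coef (p * 'X + c%:P) = if p == 0 then c else lead_coef p.
Proof.
have [->|p0] := eqVneq p 0; first by rewrite mul0r add0r lead_coefC.
by rewrite lead_coefDl ?lead_coefMX // size_polyC size_mulX // (leq_ltn_trans (leq_b1 _)) // ltnS size_poly_gt0.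
Qed.

Lemma size_sub_lead (R : nzRingType) (f : {poly R}) : f != 0 ->
  (size (f - lead_coef f *: 'X^((size f).-1))%R < size f)%N.
Proof.
move=> f0; rewrite [ltnRHS](polySpred f0) ltnS; apply/leq_sizeP => j le_j.
rewrite coefB coefZ coefXn; move: le_j; rewrite leq_eqVlt => /predU1P[<-|lt_j].
  by rewrite eqxx mulr1 lead_coefE subrr.
by rewrite gtn_eqF // mulr0 subr0 nth_default // -(prednK (n := size f)) // size_poly_gt0.
Qed.

Section PolyPrimes.
Variable A : idomainType.
Implicit Types (n : A -> Prop) (Q : {poly A} -> Prop) (f g h q r : {poly A}).

(** With [n] the contraction of a prime of A[t], this is membership in the extension of that
    contraction to A[t]. *)
Definition coefs_in n f := forall i, n f`_i.

Lemma poly_prime_coefs Q f : prime_ideal Q -> coefs_in (fun a => Q a%:P) f -> Q f.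
Proof.
move=> prQ Qf; rewrite -[f]coefK poly_def.
apply: (ideal_sum (F := fun i => f`_i *: 'X^i)); first exact: prime_ideal_ideal.
move=> i _; rewrite -mul_polyC mulrC; case: prQ => _ _ _ QM _; exact: QM.
Qed.

(** If the leading coefficient were in [Q], dropping the leading term would give a smaller element
    of the same kind. Pseudo-division by [f] thus multiplies only by scalars outside [Q]. *)
Lemma poly_prime_min Q : prime_ideal Q ->
    (exists2 h, Q h & ~ coefs_in (fun a => Q a%:P) h) ->
  exists f, [/\ Q f, ~ Q (lead_coef f)%:P &
    forall h, Q h -> ~ coefs_in (fun a => Q a%:P) h -> (size f <= size h)%N].
Proof.
move=> prQ [h0 Qh0 nh0]; set n := fun a => Q a%:P.
have idQ := prime_ideal_ideal prQ; case: (idQ) => Q0 QD QM.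
have exn : exists m, `[< exists g, [/\ Q g, ~ coefs_in n g & size g = m] >].
  by exists (size h0); apply/asboolP; exists h0.
case: (ex_minnP exn) => m /asboolP[f [Qf nf Ef]] minf.
have {}minf h : Q h -> ~ coefs_in n h -> (size f <= size h)%N.
  by move=> Qh nh; rewrite Ef; apply: minf; apply/asboolP; exists h.
exists f; split=> // nl.
have f0 : f != 0.
  by apply/eqP=> E; apply: nf => i; rewrite E coef0 /n polyC0.
pose t := (lead_coef f)%:P * 'X^((size f).-1); pose g := f - t.
have Qt : Q t by rewrite /t mulrC; apply: (QM).
have nt : coefs_in n t.
  move=> i; rewrite /t coefCM coefXn /n; case: eqP => _; first by rewrite mulr1.
  by rewrite mulr0 polyC0.
have Qg : Q g by apply: idealB.
have ng : ~ coefs_in n g.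
  move=> ng; apply: nf => i; rewrite -(subrK t f) -/g coefD /n polyCD.
  by apply: (QD); [apply: ng | apply: nt].
have := minf g Qg ng; rewrite leqNgt => /negP; apply.
by rewrite /g /t mul_polyC; exact: size_sub_lead.
Qed.

(** The remainder lies in [Q] and is shorter than [f], so minimality puts it in the extended ideal:
    [f] acts as a generator of [Q] over the residue field of the contraction. *)
Lemma poly_prime_division Q f : prime_ideal Q -> Q f -> ~ Q (lead_coef f)%:P ->
    (forall h, Q h -> ~ coefs_in (fun a => Q a%:P) h -> (size f <= size h)%N) ->
  forall h, Q h -> exists k q r,
    [/\ lead_coef f ^+ k *: h = q * f + r, (size r < size f)%N
      & coefs_in (fun a => Q a%:P) r].
Proof.
move=> prQ Qf nl minf h Qh; have idQ := prime_ideal_ideal prQ; case: (idQ) => Q0 QD QM.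
have f0 : f != 0 by apply/eqP => E; apply: nl; rewrite E lead_coef0 polyC0.
have [k [q [r [E lt_r]]]] := poly_pseudo_division h f0.
exists k, q, r; split=> //; apply: contrapT => nr.
have Qr : Q r.
  rewrite -(addKr (q * f) r) -E addrC -mul_polyC.
  by apply: idealB => //; apply: QM.
by have := minf r Qr nr; rewrite leqNgt lt_r.
Qed.

(* A chain of primes of A[t] with the same contraction to A has at most two terms. *)
Lemma poly_prime_fiber Q Q' : prime_ideal Q -> prime_ideal Q' ->
    (forall h, Q h -> Q' h) -> (exists h, Q' h /\ ~ Q h) ->
    (forall a, Q' a%:P -> Q a%:P) ->
  forall h, Q h -> coefs_in (fun a => Q a%:P) h.
Proof.
move=> prQ prQ' sub [h0 [Q'h0 nQh0]] contr; apply: contrapT => nQ.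
have idQ := prime_ideal_ideal prQ; case: (idQ) => Q0 QD QM.
have idQ' := prime_ideal_ideal prQ'; case: (idQ') => Q'0 Q'D Q'M.
have [|f [Qf nlf minf]] := poly_prime_min prQ.
  by apply: contrapT => H; apply: nQ => h Qh; apply: contrapT => nh; apply: H; exists h.
have coefsQ' h : coefs_in (fun a => Q' a%:P) h -> coefs_in (fun a => Q a%:P) h.
  by move=> H i; apply: contr.
have coefsQ h : coefs_in (fun a => Q a%:P) h -> coefs_in (fun a => Q' a%:P) h.
  by move=> H i; apply: sub; apply: H.
have nf : ~ coefs_in (fun a => Q' a%:P) f.
  by move=> /coefsQ' H; apply: nlf; rewrite lead_coefE.
have [|f' [Qf' nlf' minf']] := poly_prime_min prQ'; first by exists f => //; apply: sub.
have divf' := poly_prime_division prQ' Qf' nlf' minf'.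
have scaleQ k h : Q (lead_coef f' ^+ k *: h) -> Q h.
  rewrite -mul_polyC polyC_exp => /(prime_idealM prQ)[] // /(prime_idealX prQ) H.
  by case: nlf'; apply: sub.
(* Division by [f'] would otherwise put every element of [Q'] into [Q]. *)
have nQf' : ~ Q f'.
  move=> Qf1; apply: nQh0; have [k [q [r [E _ rP]]]] := divf' h0 Q'h0.
  apply: (scaleQ k); rewrite E; apply: (QD); first by apply: QM.
  by apply: poly_prime_coefs => //; apply: coefsQ'.
have [k [q [r [E lt_r rP]]]] := divf' f (sub _ Qf).
have Qr : Q r by apply: poly_prime_coefs => //; apply: coefsQ'.
have Qq : Q q.
  have : Q (q * f').
    by rewrite -(addrK r (q * f')) -E; apply: idealB => //; rewrite -mul_polyC; apply: QM.
  by case/(prime_idealM prQ).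
have nq : ~ coefs_in (fun a => Q a%:P) q.
  move=> qP; apply: nlf.
  have : Q' ((lead_coef f' ^+ k *: f)`_(size f).-1)%:P.
    rewrite E coefD polyCD; apply: (Q'D); last exact: rP.
    rewrite coefM; rewrite rmorph_sum.
    pose F i := (q`_i * f'`_((size f).-1 - i))%:P.
    apply: (ideal_sum (F := F)) => // i _; rewrite /F mulrC polyCM; apply: Q'M.
    by apply: sub; apply: qP.
  rewrite coefZ -lead_coefE polyCM polyC_exp => /(prime_idealM prQ')[|/contr //].
  by move/(prime_idealX prQ').
(* The quotient [q] is at least as long as [f], whereas [q * f'] has the length of [f]; so [f'] is a
   constant, equal to its leading coefficient, which is outside [Q']. *)
have le_fq := minf q Qq nq.
have q0 : q != 0 by apply/eqP => E0; apply: nq => i; rewrite E0 coef0 polyC0.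
have f'0 : f' != 0 by apply/eqP => E0; apply: nlf'; rewrite E0 lead_coef0 polyC0.
have szE : size (q * f') = (size q + (size f').-1)%N.
  by rewrite size_mul // [in LHS](polySpred f'0) addnS.
have lf'0 : lead_coef f' ^+ k != 0 by rewrite expf_neq0 // lead_coef_eq0.
have [lt1|/size1_polyC Ef'] := ltnP 1 (size f'); last first.
  by apply: nlf'; rewrite Ef' lead_coefC -Ef'.
have := congr1 (fun p : {poly A} => size p) E; rewrite size_scale // size_polyDl ?szE //; first lia.
by apply: (leq_trans lt_r); move: q0; rewrite -size_poly_gt0; lia.
Qed.

End PolyPrimes.

(** Such an element makes [A] a discrete valuation ring, expressed without naming a valuation. *)
Definition uniformizer (A : idomainType) (pi : A) :=
  [/\ pi != 0, nonunit pi
    & forall a, a != 0 -> exists n u, ~ nonunit u /\ a = u * pi ^+ n].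

Section DVR.
Variables (A : idomainType) (pi : A).
Hypothesis pi_unif : uniformizer pi.
Implicit Types (Q : {poly A} -> Prop) (f g h : {poly A}).

Let pi0 : pi != 0. Proof. by case: pi_unif. Qed.
Let pi_nonunit : nonunit pi. Proof. by case: pi_unif. Qed.

Lemma unif_dvd a : nonunit a <-> exists c, a = pi * c.
Proof.
split=> [na|[c ->]]; last by rewrite mulrC; apply: nonunitMl.
have [->|a0] := eqVneq a 0; first by exists 0; rewrite mulr0.
case: pi_unif => _ _ /(_ a a0)[[|n] [u [uu E]]].
  by case: uu; move: na; rewrite E mulr1.
by exists (u * pi ^+ n); rewrite E exprS mulrCA.
Qed.

Lemma unif_noetherian : noetherian A.
Proof.
move=> I idI; case: (idI) => I0 ID IM.
have [noI|] := pselect (forall a, I a -> a = 0).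
  by exists [::] => a; rewrite in_span_nil; split=> [/noI //|->].
move=> /existsNP[a /not_implyP[Ia /eqP a0]].
have [n [u [uu Ea]]] : exists n u, ~ nonunit u /\ a = u * pi ^+ n by case: pi_unif => _ _; apply.
have expi m v : ~ nonunit v -> I (v * pi ^+ m) -> I (pi ^+ m).
  by move=> /contrapT[w vw] /(IM w); rewrite mulrA (mulrC w) vw mul1r.
have exn : exists n, `[< I (pi ^+ n) >].
  by exists n; apply/asboolP; apply: (expi _ u) => //; rewrite -Ea.
case: (ex_minnP exn) => m /asboolP Im minm; exists [:: pi ^+ m] => b.
rewrite in_span1; split=> [Ib|[c ->]]; last exact: IM.
have [->|b0] := eqVneq b 0; first by exists 0; rewrite mul0r.
case: pi_unif => _ _ /(_ b b0)[j [v [vv Eb]]]; exists (v * pi ^+ (j - m)).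
rewrite -mulrA -exprD subnK //; apply: minm; apply/asboolP.
by apply: (expi _ v) => //; rewrite -Eb.
Qed.

Lemma unif_coefs_dvd f : (forall i, nonunit f`_i) <-> exists g, f = pi *: g.
Proof.
split=> [nf|[g ->] i]; last by rewrite coefZ; apply/unif_dvd; exists g`_i.
have /choice[c cP] : forall i, exists c, f`_i = pi * c by move=> i; apply/unif_dvd.
exists (\poly_(i < size f) c i); apply/polyP => i; rewrite coefZ coef_poly.
by case: ltnP => [_|le_i]; [exact: cP | rewrite nth_default // mulr0].
Qed.

(** Gauss's lemma. Leading terms divisible by [pi] are stripped off until both leading coefficients
    are units; then so is that of the product, which cannot be a multiple of [pi]. *)
Lemma unif_poly_prime f g :
  (exists h, f * g = pi *: h) -> (exists h, f = pi *: h) \/ (exists h, g = pi *: h).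
Proof.
have [m lem] := ubnP (size f + size g); elim: m => // m IH in f g lem *.
wlog [nlf f0]: f g lem / ~ nonunit (lead_coef f) /\ f != 0 => [W dvd_fg|].
  have [->|f0] := eqVneq f 0; first by left; exists 0; rewrite scaler0.
  have [->|g0] := eqVneq g 0; first by right; exists 0; rewrite scaler0.
  have [nlf|ulf] := pselect (nonunit (lead_coef f)); last by apply: (W f g).
  have [c Ec] := (unif_dvd _).1 nlf; have [h Eh] := dvd_fg.
  pose t : {poly A} := lead_coef f *: 'X^((size f).-1); pose f' := f - t.
  have Et : t = pi *: (c *: 'X^((size f).-1)) by rewrite scalerA -Ec.
  have lt_f' : (size f' < size f)%N by exact: size_sub_lead.
  case: (IH f' g) => [||[f1 Ef]|]; last by right.
  - by move: lem; rewrite ltnS; apply: leq_trans; rewrite -addSn leq_add2r.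
  - by exists (h - c *: 'X^((size f).-1) * g); rewrite mulrBl Eh Et scalerBr scalerAl.
  - by left; exists (f1 + c *: 'X^((size f).-1)); rewrite scalerDr -Ef -Et subrK.
have [->|g0] := eqVneq g 0; first by right; exists 0; rewrite scaler0.
have [nlg [h Eh]|ulg [h Eh]] := pselect (nonunit (lead_coef g)); last first.
  case: (unit_mul nlf ulg); rewrite -lead_coefM Eh lead_coefZ.
  by apply/unif_dvd; exists (lead_coef h).
have [c Ec] := (unif_dvd _).1 nlg.
pose t : {poly A} := lead_coef g *: 'X^((size g).-1); pose g' := g - t.
have Et : t = pi *: (c *: 'X^((size g).-1)) by rewrite scalerA -Ec.
have lt_g' : (size g' < size g)%N by exact: size_sub_lead.
case: (IH f g') => [||fd|[g1 Eg]]; [| |by left|].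
- by move: lem; rewrite ltnS; apply: leq_trans; rewrite -addnS leq_add2l.
- by exists (h - c *: 'X^((size g).-1) * f); rewrite mulrBr Eh Et scalerBr scalerAl (mulrC f).
- by right; exists (g1 + c *: 'X^((size g).-1)); rewrite scalerDr -Eg -Et subrK.
Qed.

(** The number of factors [pi] that can be taken out is bounded by the valuation of the leading
    coefficient. *)
Lemma unif_primitive f : f != 0 ->
  exists n g, f = pi ^+ n *: g /\ ~ exists h, g = pi *: h.
Proof.
move=> f0; have lf0 : lead_coef f != 0 by rewrite lead_coef_eq0.
case: pi_unif => _ _ /(_ _ lf0)[n [u [uu E]]].
elim: n f f0 {lf0} E => [|n IH] f f0 E.
  exists 0%N, f; rewrite scale1r; split=> // -[h Eh]; apply: uu.
  by rewrite -[u]mulr1 -[1](expr0 pi) -E Eh lead_coefZ; apply/unif_dvd; exists (lead_coef h).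
have [[g Eg]|nd] := pselect (exists g, f = pi *: g); last first.
  by exists 0%N, f; rewrite scale1r.
have g0 : g != 0 by apply: contra_neq f0 => g0; rewrite Eg g0 scaler0.
have [|m [h [Eh nh]]] := IH g g0.
  by apply: (mulfI pi0); rewrite -lead_coefZ -Eg E exprS mulrCA.
by exists m.+1, h; rewrite Eg Eh scalerA exprS.
Qed.

(** Together with the next lemma: a prime of A[t] lies over the maximal ideal of [A] or over zero,
    according as it contains [pi] or not. *)
Lemma poly_unif_contraction Q a :
  prime_ideal Q -> Q pi%:P -> Q a%:P <-> nonunit a.
Proof.
move=> prQ Qpi; split=> [/(prime_ideal_nonunit prQ) na [b ab]|/unif_dvd[c ->]].
  by apply: na; exists b%:P; rewrite -polyCM ab.
by rewrite mulrC polyCM; case: prQ => _ _ _ QM _; apply: QM.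
Qed.

Lemma poly_unif_contraction0 Q a : prime_ideal Q -> ~ Q pi%:P -> Q a%:P -> a = 0.
Proof.
move=> prQ nQpi Qa; apply/eqP/negP => /negP a0.
case: pi_unif => _ _ /(_ a a0)[n [u [/contrapT[v uv] Ea]]]; apply: nQpi.
apply: (prime_idealX (n := n) prQ); rewrite -polyC_exp -[_ ^+ _]mul1r -uv mulrAC -Ea.
by rewrite mulrC polyCM; case: prQ => _ _ _ QM _; apply: QM.
Qed.

(** The ideal generated by [pi] has height one: a prime inside it that misses [pi] would contain the
    primitive part of each of its nonzero elements. *)
Lemma poly_unif_height1 Q f : prime_ideal Q -> ~ Q pi%:P ->
  (forall h, Q h -> exists g, h = pi *: g) -> Q f -> f = 0.
Proof.
move=> prQ nQpi Qdvd Qf; apply/eqP/negP => /negP f0.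
have [n [g [Ef ng]]] := unif_primitive f0; apply: ng; apply: Qdvd.
move: Qf; rewrite Ef -mul_polyC polyC_exp => /(prime_idealM prQ)[] //.
by move/(prime_idealX prQ).
Qed.

(** If [Q2] lay over zero, so would [Q1], and both would sit in one fibre, which forces [Q1] to be
    zero. If [Q2] consisted of multiples of [pi], then [Q1] would equal [Q2] or, missing [pi], be
    zero. *)
Lemma poly_unif_chain2 Q0 Q1 Q2 :
    prime_ideal Q0 -> prime_ideal Q1 -> prime_ideal Q2 ->
    (forall h, Q0 h -> Q1 h) -> (exists h, Q1 h /\ ~ Q0 h) ->
    (forall h, Q1 h -> Q2 h) -> (exists h, Q2 h /\ ~ Q1 h) ->
  Q2 pi%:P /\ exists2 g, Q2 g & ~ exists h, g = pi *: h.
Proof.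
move=> pr0 pr1 pr2 sub01 [h1 [Q1h1 nQ0h1]] sub12 [h2 [Q2h2 nQ1h2]].
have Q00 : Q0 0 by case: pr0 => _ [].
have Q1n0 : ~ forall h, Q1 h -> h = 0 by move=> Q10; apply: nQ0h1; rewrite (Q10 _ Q1h1).
split.
  apply: contrapT => nQ2pi; apply: Q1n0 => h Q1h.
  have contr a : Q2 a%:P -> Q1 a%:P.
    by move=> /(poly_unif_contraction0 pr2 nQ2pi) ->; rewrite polyC0; apply: sub01.
  have coefs := poly_prime_fiber pr1 pr2 sub12 (ex_intro _ h2 (conj Q2h2 nQ1h2)) contr Q1h.
  apply/polyP => i; rewrite coef0.
  by apply: (poly_unif_contraction0 pr2 nQ2pi); apply: sub12; apply: coefs.
apply: contrapT => nog.
have Q2dvd h : Q2 h -> exists g, h = pi *: g.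
  by move=> Q2h; apply: contrapT => nh; apply: nog; exists h.
have [Q1pi|nQ1pi] := pselect (Q1 pi%:P).
  apply: nQ1h2; have [g ->] := Q2dvd _ Q2h2; rewrite -mul_polyC mulrC.
  by case: pr1 => _ _ _ QM _; apply: QM.
apply: Q1n0 => h; apply: (poly_unif_height1 pr1 nQ1pi) => h' /sub12; exact: Q2dvd.
Qed.

(** In a chain with three steps the last two primes contain [pi], hence have the same contraction;
    being in one fibre, the lower one consists of multiples of [pi], against [poly_unif_chain2]. *)
Lemma poly_unif_dim : ~ prime_chain {poly A} 3.
Proof.
case=> Q [prQ ltQ].
have [sub01 lt01] := ltQ 0%N isT; have [sub12 lt12] := ltQ 1%N isT.
have [sub23 lt23] := ltQ 2%N isT.
have pr i : (i <= 3)%N -> prime_ideal (Q i) by apply: prQ.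
have [Q2pi [g Q2g ng]] := poly_unif_chain2 (pr 0%N isT) (pr 1%N isT) (pr 2%N isT) sub01 lt01 sub12 lt12.
apply: ng; apply/unif_coefs_dvd => i.
have Q3pi : Q 3%N pi%:P by apply: sub23.
have contr a : Q 3%N a%:P -> Q 2%N a%:P.
  by move/(poly_unif_contraction _ (pr 3%N isT) Q3pi)/(poly_unif_contraction _ (pr 2%N isT) Q2pi).
apply/(poly_unif_contraction _ (pr 2%N isT) Q2pi).
exact: (poly_prime_fiber (pr 2%N isT) (pr 3%N isT) sub23 lt23 contr Q2g).
Qed.

(** Over the fraction field of [A] the prime is generated by an element of least degree; the
    constant [c] clears denominators. *)
Lemma poly_generic_generator Q : prime_ideal Q -> ~ Q pi%:P ->
  (exists r, Q r /\ r != 0) ->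
  exists f, [/\ f != 0, Q f & forall r, Q r -> exists q c,
    c != 0 /\ c *: r = q * f].
Proof.
move=> prQ upi [r0 [nr0 r00]].
have contr a : Q a%:P -> a = 0 by apply: poly_unif_contraction0 prQ upi.
have [|f [nf nlf minf]] := poly_prime_min prQ.
  exists r0 => // H; move/eqP: r00; apply; apply/polyP => i; rewrite coef0.
  exact: contr (H i).
have lf0 : lead_coef f != 0 by apply/eqP => E; apply: nlf; rewrite E polyC0; case: prQ => _ [].
exists f; split=> [||r nr]; rewrite -?lead_coef_eq0 //.
have [k [q [r1 [E _ cr]]]] := poly_prime_division prQ nf nlf minf nr.
exists q, (lead_coef f ^+ k); rewrite expf_neq0 // E; split=> //.
suff -> : r1 = 0 by rewrite addr0.
by apply/polyP => i; rewrite coef0; exact: contr (cr i).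
Qed.

(** The reduction of [Q] modulo [pi] is principal, over the residue field. Its generator lifts to a
    monic one, because a leading coefficient outside [Q] is a unit of [A]. *)
Lemma poly_special_generator Q g : prime_ideal Q -> Q pi%:P -> Q g ->
    ~ (exists h, g = pi *: h) ->
  exists f, [/\ Q f, f \is monic,
    forall h, Q h -> ~ (exists h', h = pi *: h') -> (size f <= size h)%N &
    forall r, Q r -> exists q r', r = q * f + pi *: r'].
Proof.
move=> prQ npi ng ngd.
have contr a : Q a%:P <-> nonunit a by apply: (poly_unif_contraction a prQ npi).
have dvdP h : coefs_in (fun a => Q a%:P) h <-> exists h', h = pi *: h'.
  rewrite -(unif_coefs_dvd); split=> H i; first by apply/contr; exact: H.
  by apply/contr.
have [|f [nf nlf minf]] := poly_prime_min prQ; first by exists g => // /dvdP.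
have /contrapT[u lu] : ~ nonunit (lead_coef f) by move/contr.
exists (u *: f); split.
- by rewrite -mul_polyC; case: prQ => _ _ _ QM _; apply: QM.
- by rewrite monicE lead_coefZ mulrC lu.
- move=> h nh nhd; apply: (leq_trans (size_scale_leq _ _)); apply: minf => //.
  by move/dvdP.
- move=> r nr; have [k [q [r1 [E _ cr]]]] := poly_prime_division prQ nf nlf minf nr.
  have [r' Er'] := (dvdP r1).1 cr.
  have luk : u ^+ k * lead_coef f ^+ k = 1 by rewrite -exprMn (mulrC u) lu expr1n.
  exists (u ^+ k * lead_coef f *: q), (u ^+ k *: r').
  have -> : r = u ^+ k *: (q * f + r1) by rewrite -E scalerA luk scale1r.
  rewrite Er' scalerDr -!scalerAl -!scalerAr !scalerA (mulrC pi).
  by rewrite -[u ^+ k * _ * u]mulrA lu mulr1.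
Qed.

End DVR.

(** * Chains of primes in integral extensions *)

Section Integrality.
Variables (R S : comNzRingType) (psi : {rmorphism R -> S}).

(** Induction on a monic equation for [y] modulo [Q]. Its constant term lies in [Q']; if it also
    lies in [Q], a factor [y], which is outside [Q], is cancelled. The descent ends because 1 is not
    in [Q]. *)
Lemma integral_incomparable (Q Q' : S -> Prop) y :
    prime_ideal Q -> prime_ideal Q' -> (forall a, Q a -> Q' a) ->
    Q' y -> ~ Q y -> integralOver psi y ->
  exists a, Q' (psi a) /\ ~ Q (psi a).
Proof.
move=> prQ prQ' sub Q'y nQy [p mon_p /rootP py].
have idQ := prime_ideal_ideal prQ; have idQ' := prime_ideal_ideal prQ'.
have [_ _ Q'M] := idQ'; have [Q0 _ _] := idQ.
have : Q (map_poly psi p).[y] by rewrite py.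
elim/poly_ind: p mon_p {py} => [|p c IH]; first by rewrite monicE lead_coef0 eq_sym oner_eq0.
rewrite monicE lead_coef_MXaddC rmorphD rmorphM /= map_polyX map_polyC hornerMXaddC /= => mon Qp.
have Q'c : Q' (psi c).
  rewrite -(addKr ((map_poly psi p).[y] * y) (psi c)) addrC.
  by apply: idealB => //; [exact: sub | exact: Q'M].
have [Qc|] := pselect (Q (psi c)); last by exists c.
have Qpy : Q ((map_poly psi p).[y] * y).
  by rewrite -(addrK (psi c) (_ * y)); apply: idealB.
case: ifP mon => [_ /eqP c1|_ mon].
  by case: prQ => _ [_ []]; rewrite -(rmorph1 psi) -c1.
by apply: IH; rewrite ?monicE //; case: (prime_idealM prQ Qpy).
Qed.

Lemma integral_prime_contraction (Q : S -> Prop) :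
  prime_ideal Q -> prime_ideal (fun a => Q (psi a)).
Proof.
case=> _ [Q0 Q1] QD QM Qpr; split=> //; first by rewrite rmorph0 rmorph1.
- by move=> a b; rewrite rmorphD; apply: QD.
- by move=> a b _; rewrite rmorphM; apply: QM.
- by move=> a b _ _; rewrite rmorphM; apply: Qpr.
Qed.

Lemma integral_chain n (u : S -> S) : (forall y, ~ nonunit (u y)) ->
    (forall y, integralOver psi (u y * y)) ->
  prime_chain S n ->
  exists Q : nat -> R -> Prop,
    [/\ forall i, (i <= n)%N -> prime_ideal (Q i),
        forall i, (i < n)%N ->
          (forall a, Q i a -> Q i.+1 a) /\ (exists a, Q i.+1 a /\ ~ Q i a)
      & forall i, (i <= n)%N -> forall a, Q i a -> nonunit (psi a)].
Proof.
move=> uu int_u [Q [prQ ltQ]]; exists (fun i a => Q i (psi a)); split=> [i lei|i lti|i lei a].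
- by apply: integral_prime_contraction; apply: prQ.
- have [sub [y [Qy nQy]]] := ltQ i lti; split=> [a|]; first exact: sub.
  have pri := prQ i (ltnW lti); have pri1 := prQ i.+1 lti.
  apply: (integral_incomparable pri pri1 sub) (int_u y).
    by case: pri1 => _ _ _ QM _; apply: QM.
  by move=> /(prime_idealM pri)[/(prime_ideal_nonunit pri)/uu|].
- by apply: prime_ideal_nonunit; apply: prQ.
Qed.

End Integrality.

(** * Cyclic covers *)

Lemma poly_horner_mod (R : comNzRingType) (f : {poly R}) (x : R) :
  exists c, f.[x] = f.[0] + x * c.
Proof.
have /factor_theorem[q Eq] : root (f - f.[0]%:P) 0 by apply/rootP; rewrite !hornerE subrr.
exists q.[x]; rewrite -{1}(subrK f.[0]%:P f) Eq !hornerE; ring.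
Qed.

(** The determinant is a polynomial in [x] with value [a ^+ n] at 0. *)
Lemma det_scalar_mod (R : comNzRingType) n (a x : R) (N : 'M[R]_n) :
  exists c, \det (a%:M + x *: N) = a ^+ n + x * c.
Proof.
pose M : 'M[{poly R}]_n := (a%:P)%:M + 'X *: map_mx polyC N.
have EM y : (\det M).[y] = \det (a%:M + y *: N).
  rewrite -horner_evalE -det_map_mx; congr (\det _).
  apply/matrixP => i j; rewrite !mxE /= horner_evalE !hornerE.
  by case: (i == j); rewrite ?mulr1n ?mulr0n !hornerE.
have [c Ec] := poly_horner_mod (\det M) x; exists c.
by rewrite -EM Ec EM scale0r addr0 det_scalar.
Qed.

(* [X] acts on [R[X] / (f)] with determinant [delta], and [X ^+ m] acts as [- h] modulo [x]. *)
Lemma companion_det (R : comNzRingType) n m (f q r : {poly R}) (h x : R) :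
    f \is monic -> size f = n.+2 -> 'X^m + h%:P = q * f + x *: r ->
  exists delta c, delta ^+ m = (- h) ^+ n.+1 + x * c.
Proof.
move=> mon szf E.
have [C charC] : exists C : 'M[R]_n.+1, char_poly C = f.
  have := companionmxK mon; move: (companionmx f).
  by rewrite szf => C; exists C.
have : C ^+ m = (- h)%:M + x *: horner_mx C r.
  apply: (addIr h%:M); rewrite addrAC -raddfD addNr raddf0 add0r.
  have := congr1 (horner_mx C) E.
  rewrite rmorphD rmorphXn /= horner_mx_X horner_mx_C => ->.
  by rewrite rmorphD rmorphM /= -{1}charC Cayley_Hamilton mulr0 add0r linearZ.
move=> EC; have [c Ec] := det_scalar_mod (- h) x (horner_mx C r).
exists (\det C), c; rewrite -Ec -EC.
elim: m {E EC} => [|m IH]; first by rewrite !expr0 det1.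
by rewrite !exprS IH det_mulmx.
Qed.

(** * Local rings of a cyclic cover: dimension, depth and regularity *)

Section CyclicLocal.
Variables (A : idomainType) (pi : A) (l : nat) (b : {poly A}).
Variables (S : comNzRingType) (Phi : {rmorphism {poly {poly A}} -> S}).
Hypotheses (pi_unif : uniformizer pi) (l_gt0 : (0 < l)%N).
Hypothesis Phi_root : Phi ('X^l - b%:P) = 0.
Hypothesis Phi_free : forall w : {poly {poly A}}, (size w <= l)%N -> Phi w = 0 -> w = 0.
Hypothesis Phi_frac : forall s, exists a b, ~ nonunit (Phi b) /\ s * Phi b = Phi a.
Hypothesis S_local : forall s t : S, nonunit s -> nonunit t -> nonunit (s + t).
Hypothesis S_dom : forall s t : S, s * t = 0 -> s = 0 \/ t = 0.

Let psi : {rmorphism {poly A} -> S} := Phi \o polyC.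
Let psiE r : psi r = Phi r%:P. Proof. by []. Qed.

Lemma cyclic_X_exp : Phi 'X ^+ l = psi b.
Proof.
by apply/eqP; rewrite -subr_eq0 psiE -rmorphXn -rmorphB /= Phi_root.
Qed.

Lemma cyclic_reduce (w : {poly {poly A}}) : exists w' : {poly {poly A}}, (size w' <= l)%N /\ Phi w' = Phi w.
Proof.
exists (Pdiv.Ring.rmodp w ('X^l - b%:P)); split.
  rewrite -ltnS -(size_XnsubC b l_gt0) Pdiv.Ring.ltn_rmodp.
  by rewrite -size_poly_eq0 size_XnsubC.
rewrite [w in RHS](Pdiv.RingMonic.rdivp_eq (monicXnsubC b l_gt0)).
by rewrite rmorphD rmorphM Phi_root mulr0 add0r.
Qed.

Lemma cyclic_horner (w : {poly {poly A}}) : Phi w = (map_poly psi w).[Phi 'X].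
Proof.
rewrite -[w in LHS]coefK poly_def rmorph_sum horner_poly; apply: eq_bigr => i _.
by rewrite -mul_polyC rmorphM rmorphXn.
Qed.

Lemma cyclic_integral (w : {poly {poly A}}) : integralOver psi (Phi w).
Proof.
rewrite cyclic_horner; apply: integral_horner.
  by apply/integral_poly => i; rewrite coef_map; apply: integral_id.
exists ('X^l - b%:P); first exact: monicXnsubC.
by apply/rootP; rewrite -cyclic_horner.
Qed.

Lemma cyclic_psi_inj r : psi r = 0 -> r = 0.
Proof.
move=> r0; apply: polyC_inj; rewrite polyC0; apply: Phi_free => //.
by rewrite (leq_trans (size_polyC_leq1 _)).
Qed.

Lemma cyclic_chain n : prime_chain S n ->
  exists Q : nat -> {poly A} -> Prop,
    [/\ forall i, (i <= n)%N -> prime_ideal (Q i),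
        forall i, (i < n)%N ->
          (forall a, Q i a -> Q i.+1 a) /\ (exists a, Q i.+1 a /\ ~ Q i a)
      & forall i, (i <= n)%N -> forall a, Q i a -> nonunit (psi a)].
Proof.
have /choice[v vP] : forall s, exists v, ~ nonunit (Phi v) /\ exists w, s * Phi v = Phi w.
  by move=> s; have [w [v [uv E]]] := Phi_frac s; exists v; split=> //; exists w.
apply: (integral_chain (u := fun s => Phi (v s))) => s; first by case: (vP s).
by have [_ [w E]] := vP s; rewrite mulrC E; apply: cyclic_integral.
Qed.

Lemma cyclic_local_noetherian : noetherian_local S.
Proof.
split=> //; apply: noetherian_localization Phi_frac _.
by do 2!apply: noetherian_poly; apply: unif_noetherian pi_unif.
Qed.

Lemma cyclic_dim3 : ~ prime_chain S 3.
Proof. by case/cyclic_chain => Q [prQ ltQ _]; apply: (poly_unif_dim pi_unif); exists Q. Qed.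

Lemma cyclic_chain2 : prime_chain S 2 ->
  nonunit (psi pi%:P) /\ exists2 g, nonunit (psi g) & ~ exists h, g = pi *: h.
Proof.
case/cyclic_chain => Q [prQ ltQ nQ].
have [sub01 lt01] := ltQ 0%N isT; have [sub12 lt12] := ltQ 1%N isT.
have [Q2pi [g Q2g ng]] := poly_unif_chain2 pi_unif (prQ 0%N isT) (prQ 1%N isT)
  (prQ 2%N isT) sub01 lt01 sub12 lt12.
by split; [apply: (nQ 2%N) | exists g => //; apply: (nQ 2%N)].
Qed.

Lemma cyclic_regular_seq1 (s : S) : nonunit s -> s != 0 -> regular_seq ([:: s] : seq S).
Proof.
move=> ns /eqP s0 [|//] _; split=> // a /in_span_nil sa; apply/in_span_nil.
by case: (S_dom sa).
Qed.

(** After clearing denominators, a relation between [pi] and [g] can be read on the coefficients of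
    the powers of w, where [pi] is prime and does not divide [g]. *)
Lemma cyclic_regular_seq2 g : nonunit (psi pi%:P) -> nonunit (psi g) ->
  ~ (exists h, g = pi *: h) -> regular_seq ([:: psi pi%:P; psi g] : seq S).
Proof.
move=> npi ng nd.
have pi0 : psi pi%:P != 0.
  apply/eqP => /cyclic_psi_inj/eqP; rewrite polyC_eq0; apply/negP; by case: pi_unif.
case=> [_|[_|//]]; first exact: (cyclic_regular_seq1 npi pi0 (i := 0%N)).
split=> //= a /in_span1[c Ec]; apply/in_span1.
have [w [v [uv Ea]]] := Phi_frac a; have [w' [v' [uv' Ec']]] := Phi_frac c.
have [w1 [szw1 Ew1]] := cyclic_reduce (v' * w).
have [w2 [szw2 Ew2]] := cyclic_reduce (v * w').
(* Both terms are reduced to degree less than [l], so equality in [S] is equality of polynomials. *)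
have : g *: w1 - pi%:P *: w2 = 0.
  apply: Phi_free.
    by rewrite (leq_trans (size_polyD _ _)) // size_polyN geq_max !(leq_trans (size_scale_leq _ _)).
  rewrite -!mul_polyC rmorphB !rmorphM Ew1 Ew2 !rmorphM -Ea -Ec' -!psiE; apply/eqP; rewrite subr_eq0; apply/eqP.
  transitivity (psi g * a * (Phi v' * Phi v)); first by ring.
  by rewrite Ec; ring.
move/subr0_eq => E12.
have /choice[d dP] : forall i, exists d, w1`_i = pi *: d.
  move=> i; have [] // := unif_poly_prime pi_unif (f := g) (g := w1`_i).
  by exists w2`_i; rewrite -coefZ E12 coefZ mul_polyC.
have Ew1' : Phi w1 = psi pi%:P * Phi (\poly_(i < size w1) d i).
  rewrite psiE -rmorphM; congr (Phi _); apply/polyP => i; rewrite coefCM coef_poly.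
  by case: ltnP => [_|le_i]; [rewrite dP mul_polyC | rewrite nth_default // mulr0].
have /contrapT[u uvv] := unit_mul uv uv'.
exists (u * Phi (\poly_(i < size w1) d i)).
rewrite -mulrA [X in u * X]mulrC -Ew1' Ew1 rmorphM -Ea.
by rewrite -[LHS]mulr1 -uvv; ring.
Qed.

(** The length of the longest chain decides: [pi] and an element prime to it for two steps, any
    nonzero nonunit of the domain [S] for one, the empty sequence for none. *)
Lemma cyclic_dim : exists s : seq S, regular_seq s /\ ~ prime_chain S (size s).+1.
Proof.
have [ch2|nch2] := pselect (prime_chain S 2).
  have [npi [g ng ngd]] := cyclic_chain2 ch2.
  exists ([:: psi pi%:P; psi g] : seq S); split; [exact: cyclic_regular_seq2 | exact: cyclic_dim3].
have [[Q [prQ ltQ]]|nch1] := pselect (prime_chain S 1); last by exists [::].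
have [_ [y [Qy nQy]]] := ltQ 0%N isT; exists [:: y]; split=> //.
apply: cyclic_regular_seq1; first exact: prime_ideal_nonunit (prQ 1%N isT) Qy.
by apply/eqP => y0; apply: nQy; rewrite y0; case: (prQ 0%N isT) => _ [].
Qed.

Lemma cyclic_cohen_macaulay : cohen_macaulay_local S.
Proof.
split; first exact: cyclic_local_noetherian.
have [s [reg_s nch]] := cyclic_dim; exists (size s).
exact: (krull_dim_depth cyclic_local_noetherian reg_s nch).
Qed.

Lemma cyclic_krull_dim0 : (forall s : S, nonunit s -> s = 0) -> krull_dim S 0.
Proof.
move=> fld.
suff /(krull_dim_depth cyclic_local_noetherian)[]: @regular_seq S [::] => //.
case=> Q [prQ ltQ]; have [_ [y [Qy nQy]]] := ltQ 0%N isT; apply: nQy.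
rewrite (fld y); last exact: prime_ideal_nonunit (prQ 1%N isT) Qy.
by case: (prQ 0%N isT) => _ [].
Qed.

(** A chain with two steps would make [pi] and some element not divisible by [pi] nonunits of [S];
    each alternative of the hypothesis excludes this. *)
Lemma cyclic_krull_dim1 (s : S) : nonunit s -> s != 0 ->
    (~ nonunit (psi pi%:P) \/ forall g, nonunit (psi g) -> exists h, g = pi *: h) ->
  krull_dim S 1.
Proof.
move=> ns s0 H; have reg_s := cyclic_regular_seq1 ns s0.
suff /(krull_dim_depth cyclic_local_noetherian reg_s)[] : ~ prime_chain S 2 by [].
by move=> /cyclic_chain2[npi [g ng ngd]]; case: H => [//|H]; exact/ngd/H.
Qed.

Lemma cyclic_krull_dim2 g : nonunit (psi pi%:P) -> nonunit (psi g) ->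
  ~ (exists h, g = pi *: h) -> krull_dim S 2.
Proof.
move=> npi ng ngd; have reg_s := cyclic_regular_seq2 npi ng ngd.
by case: (krull_dim_depth cyclic_local_noetherian reg_s cyclic_dim3).
Qed.

Let z := Phi 'X.

Let nonunitP : prime_ideal (@nonunit S). Proof. exact: nonunit_prime. Qed.
Let WP : prime_ideal (fun w => nonunit (Phi w)).
Proof. exact: (integral_prime_contraction Phi). Qed.
Let RP : prime_ideal (fun r => nonunit (psi r)).
Proof. exact: (integral_prime_contraction psi). Qed.

Let ideal_unit (I : S -> Prop) u s : ideal I -> ~ nonunit u -> I (u * s) -> I s.
Proof.
move=> [_ _ IM] /contrapT[v uv] /(IM v); by rewrite mulrA (mulrC v) uv mul1r.
Qed.

Lemma nonunit_sub (s t : S) : nonunit s -> nonunit t -> nonunit (s - t).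
Proof. by move=> ns nt; apply: (idealB (prime_ideal_ideal nonunitP)). Qed.

Lemma cyclic_coefs_ideal (I : S -> Prop) (w : {poly {poly A}}) : ideal I ->
    (forall r, nonunit (psi r) -> I (psi r)) ->
  coefs_in (fun r => nonunit (Phi r%:P)) w -> I (Phi w).
Proof.
move=> idI Ip cw; rewrite -[w]coefK poly_def rmorph_sum.
apply: (ideal_sum (F := fun i => Phi (w`_i *: 'X^i))) => // i _.
rewrite -mul_polyC mulrC rmorphM; case: idI => _ _ IM; apply: IM; exact: (Ip w`_i (cw i)).
Qed.

(* At a point off the branch locus the cover is etale, so the maximal ideal is
   generated from below. *)
Lemma cyclic_etale (I : S -> Prop) s : ideal I ->
    ~ nonunit (l%:R : S) -> ~ nonunit (psi b) ->
    (forall r, nonunit (psi r) -> I (psi r)) -> nonunit s -> I s.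
Proof.
move=> idI l_unit b_unit Ip ns; have [I0 ID IM] := idI.
have z_unit : ~ nonunit z.
  move=> nz; apply: b_unit; rewrite -cyclic_X_exp -/z -(prednK l_gt0) exprSr.
  exact: nonunitMl.
suff IW w : nonunit (Phi w) -> I (Phi w).
  have [w [v [uv E]]] := Phi_frac s; apply: (ideal_unit idI uv).
  by rewrite mulrC E; apply: IW; rewrite -E mulrC; apply: nonunitMl.
have idW := prime_ideal_ideal WP; have [_ WD WM] := idW.
(* Unless the prime of A[v][w] below the maximal ideal is extended from A[v], an [f] of minimal size
   outside the extension serves as its equation in the fibre. *)
have [allc|] := pselect (forall w, nonunit (Phi w) -> coefs_in (fun r => nonunit (Phi r%:P)) w).
  by move/allc; apply: cyclic_coefs_ideal.
move=> /existsNP[w0 /not_implyP[nw0 cw0]].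
have [|f [nf nlf minf]] := poly_prime_min WP; first by exists w0.
have divf := poly_prime_division WP nf nlf minf.
have uX k : ~ nonunit (Phi (lead_coef f)%:P ^+ k).
  by move/(prime_idealX nonunitP).
have [k [q [r [E _ cr]]]] : exists k q r, [/\ lead_coef f ^+ k *: ('X^l - b%:P) = q * f + r,
    (size r < size f)%N & coefs_in (fun r => nonunit (Phi r%:P)) r].
  by apply: divf; rewrite Phi_root; exact: nonunit0.
(* The root is simple: with [q] also in the prime, w^l - b would have a double root there, and its
   derivative l w^(l - 1) would be a nonunit. *)
have uq : ~ nonunit (Phi q).
  move=> nq; have [k' [q' [r' [E' _ cr']]]] := divf q nq.
  pose v := q' * f + r'.
  have nr' : nonunit (Phi r') by apply: (poly_prime_coefs WP).
  have nv : nonunit (Phi v).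
    by rewrite rmorphD rmorphM; apply: S_local => //; apply: nonunitMl.
  have EE : (lead_coef f ^+ k' * lead_coef f ^+ k) *: ('X^l - b%:P) =
      v * f + lead_coef f ^+ k' *: r.
    by rewrite -scalerA E scalerDr scalerAl E'.
  have := congr1 (@deriv _) EE; rewrite derivZ derivB derivC subr0 derivXn derivD derivM derivZ.
  move/(congr1 Phi) => D.
  have : nonunit (Phi ((lead_coef f ^+ k' * lead_coef f ^+ k) *: ('X^(l.-1) *+ l))).
    rewrite D rmorphD; apply: S_local; last first.
      rewrite -mul_polyC rmorphM; apply: nonunitMl; apply: (poly_prime_coefs WP) => i.
      by rewrite coef_deriv polyCMn rmorphMn -mulr_natl; apply: nonunitMl; apply: cr.
    rewrite rmorphD !rmorphM; apply: S_local; first exact: nonunitMl.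
    by rewrite mulrC; apply: nonunitMl.
  rewrite -mul_polyC -exprD polyC_exp rmorphM rmorphMn !rmorphXn /= -mulr_natl.
  have zX m : ~ nonunit (Phi 'X ^+ m) by move/(prime_idealX nonunitP).
  by case/(prime_idealM nonunitP) => [/uX //|/(prime_idealM nonunitP)[//|/zX]].
have If : I (Phi f).
  apply: (ideal_unit idI uq); rewrite -rmorphM.
  have -> : q * f = lead_coef f ^+ k *: ('X^l - b%:P) - r by rewrite E addrK.
  rewrite rmorphB -mul_polyC rmorphM Phi_root mulr0 sub0r; apply: idealN => //.
  exact: cyclic_coefs_ideal.
move=> nw; have [k' [q' [r' [E' _ cr']]]] := divf w nw.
apply: (ideal_unit idI (uX k')); rewrite -rmorphXn -rmorphM /= -polyC_exp mul_polyC E'.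
rewrite rmorphD rmorphM; apply: (ID); first exact: IM.
exact: cyclic_coefs_ideal.
Qed.

(** Modulo [z] a polynomial in w reduces to its constant term, so the maximal ideal is generated by
    [z] and by nonunits from A[v]. *)
Lemma cyclic_branch (I : S -> Prop) s : ideal I -> I z ->
    (forall r, nonunit (psi r) -> I (psi r)) -> nonunit z -> nonunit s -> I s.
Proof.
move=> idI Iz Ip nz ns; have [I0 ID IM] := idI.
have [w [v [uv E]]] := Phi_frac s; apply: (ideal_unit idI uv); rewrite mulrC E.
have : nonunit (Phi w) by rewrite -E mulrC; apply: nonunitMl.
elim/poly_ind: w {E} => [|p c _]; first by rewrite rmorph0.
rewrite rmorphD rmorphM -/z -psiE => npc; apply: (ID); first exact: IM.
apply: Ip; rewrite -(addKr (Phi p * z) (psi c)) addrC.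
by apply: nonunit_sub => //; apply: nonunitMl.
Qed.

Lemma psi_unit_const a : ~ nonunit (psi pi%:P) -> a != 0 -> ~ nonunit (psi a%:P).
Proof.
move=> upi a0 na; move/eqP: a0; apply.
exact: (poly_unif_contraction0 pi_unif RP upi na).
Qed.

(** Generators need be checked on A[v] only: the rest of the maximal ideal follows by [cyclic_etale]
    off the branch locus and by [cyclic_branch] on it. *)
Lemma cyclic_regular_span (s : seq S) : krull_dim S (size s) -> ~ nonunit (l%:R : S) ->
    (forall i, (i < size s)%N -> nonunit s`_i) ->
    (forall r, nonunit (psi r) -> in_span s (psi r)) ->
    ~ nonunit (psi b) \/ nonunit z /\ in_span s z ->
  regular_local S.
Proof.
move=> dimS ul ns Ip H; split; first exact: cyclic_local_noetherian.
exists (size s); split=> //; exists s; split=> // a; split; last first.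
  by apply: in_span_min => //; exact: prime_ideal_ideal.
case: H => [ub|[nz sz]] na.
  exact: (cyclic_etale (in_span_ideal s)).
exact: (cyclic_branch (in_span_ideal s)).
Qed.

(** Once [pi] is inverted all nonzero constants are units, and divisibility over the fraction field
    of [A] becomes divisibility in [S]. *)
Lemma psi_dvd_unit c r q f : c != 0 -> ~ nonunit (psi pi%:P) -> c *: r = q * f ->
  exists a, psi r = a * psi f.
Proof.
move=> c0 upi E; have /contrapT[v cv] := psi_unit_const upi c0.
exists (v * psi q); rewrite -mulrA -rmorphM -E -mul_polyC rmorphM mulrA.
by rewrite (mulrC v) cv mul1r.
Qed.

(** A complement [y] of [b1] is requested only where [pi] and [b1] are both nonunits. If [S] is not
    a field, [z] alone generates the maximal ideal at the remaining branch points, and off the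
    branch locus generators from A[v] serve. *)
Lemma cyclic_regular (b1 b2 : {poly A}) :
    b = b1 * b2 -> ~ nonunit (psi b2) -> irreducible_poly b1 ->
    ~ (exists h, b1 = pi *: h) -> ~ nonunit (l%:R : S) ->
    (nonunit (psi pi%:P) -> nonunit (psi b1) -> exists y, nonunit (psi y) /\
      forall r, nonunit (psi r) -> exists c d, r = c * b1 + d * y) ->
  regular_local S.
Proof.
move=> Eb ub2 irr_b1 b1_prim ul Hreg.
have [b1_gt1 b1_irr] := irr_b1.
have b10 : b1 != 0 by rewrite -size_poly_gt0 ltnW.
have pi0 : psi pi%:P != 0.
  by apply/eqP => /cyclic_psi_inj/eqP; rewrite polyC_eq0; apply/negP; case: pi_unif.
have psi0 r : r != 0 -> psi r != 0.
  by apply: contra_neq => /cyclic_psi_inj.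
have [fld|] := pselect (forall s : S, nonunit s -> s = 0).
  apply: (@cyclic_regular_span [::]) => //; first exact: cyclic_krull_dim0.
    by move=> r /fld ->; case: (in_span_ideal ([::] : seq S)).
  left=> /fld/eqP; apply/negP; apply: psi0; rewrite Eb mulf_neq0 //.
  by apply/eqP => E; apply: ub2; rewrite E rmorph0; exact: nonunit0.
move=> /existsNP[s0 /not_implyP[ns0 /eqP s00]].
(* Off the branch locus a zero contraction to A[v] would make the maximal ideal zero. *)
have np0 : ~ nonunit (psi b) -> exists r, nonunit (psi r) /\ r != 0.
  move=> ub; apply: contrapT => nor; move/eqP: s00; apply.
  apply: (cyclic_etale (I := fun s => s = 0)) ns0 => //.
    by split=> // [a c -> ->|a c ->]; rewrite ?addr0 ?mulr0.
  move=> r nr; have [->|r0] := eqVneq r 0; first by rewrite rmorph0.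
  by case: nor; exists r.
have [nb|ub] := pselect (nonunit (psi b)); last first.
  have [npi|upi] := pselect (nonunit (psi pi%:P)); last first.
    have [f [f0 nf fP]] := poly_generic_generator pi_unif RP upi (np0 ub).
    apply: (@cyclic_regular_span [:: psi f]) => //; last by left.
    - exact: (cyclic_krull_dim1 nf (psi0 _ f0) (or_introl upi)).
    - by case.
    - move=> r nr; have [q [c [c0 E]]] := fP r nr; apply/in_span1.
      exact: psi_dvd_unit E.
  have [all_dvd|] := pselect (forall g, nonunit (psi g) -> exists h, g = pi *: h).
    apply: (@cyclic_regular_span [:: psi pi%:P]) => //; last by left.
    - exact: (cyclic_krull_dim1 npi pi0 (or_intror all_dvd)).
    - by case.
    - move=> r /all_dvd[h ->]; apply/in_span1; exists (psi h).
      by rewrite -mul_polyC rmorphM mulrC.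
  move=> /existsNP[g /not_implyP[ng ngd]].
  have [f [nf _ _ fP]] := poly_special_generator pi_unif RP npi ng ngd.
  apply: (@cyclic_regular_span [:: psi f; psi pi%:P]) => //; last by left.
  - exact: (cyclic_krull_dim2 (g := g)).
  - by case=> [|[|//]].
  - move=> r /fP[q [r' ->]]; apply/in_span2; exists (psi q), (psi r').
    by rewrite rmorphD -mul_polyC !rmorphM (mulrC (psi r')).
have nz : nonunit z by move: nb; rewrite -cyclic_X_exp => /(prime_idealX nonunitP).
have nb1 : nonunit (psi b1).
  by move: nb; rewrite Eb rmorphM => /(prime_idealM nonunitP)[].
(* From w^l = b1 b2 with [b2] a unit: [z] can replace [b1] as a generator. *)
have b1z : exists c, psi b1 = c * z.
  have /contrapT[v b2v] := ub2; exists (v * z ^+ l.-1).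
  rewrite -mulrA -exprSr prednK // cyclic_X_exp -/psi Eb rmorphM.
  by rewrite mulrCA (mulrC v) b2v mulr1.
have z0 : z != 0.
  apply/eqP => E; move: b1z => [c]; rewrite E mulr0 => /eqP; apply/negP; exact: psi0.
have [npi|upi] := pselect (nonunit (psi pi%:P)); last first.
  have [f [f0 nf fP]] : exists f, [/\ f != 0, nonunit (psi f) & forall r, nonunit (psi r) ->
      exists q c, c != 0 /\ c *: r = q * f].
    by apply: (poly_generic_generator pi_unif RP upi); exists b1.
  have [q [c [c0 Ec]]] := fP b1 nb1.
  (* Over the fraction field [f] divides the irreducible [b1]; it is no constant, as nonzero
     constants are units here, so the two are associated. *)
  have [d fd] : exists d, psi f = d * psi b1.
    have szf : size f != 1%N.
      apply/negP => /size_poly1P[a a0 Ef]; move: nf; rewrite Ef.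
      exact: psi_unit_const.
    have /eqp_eq E : f %= b1.
      by apply: b1_irr szf _; apply/(Pdiv.Idomain.dvdpP); exists (c, q).
    have := psi_dvd_unit (r := f) (q := (lead_coef f)%:P) (f := b1) (c := lead_coef b1).
    by apply=> //; rewrite ?lead_coef_eq0 // mul_polyC.
  apply: (@cyclic_regular_span [:: z]) => //; last 1 first.
  - by right; split=> //; apply/in_span1; exists 1; rewrite mul1r.
  - exact: (cyclic_krull_dim1 nz z0 (or_introl upi)).
  - by case.
  - move=> r nr; have [q' [c' [c'0 E]]] := fP r nr.
    have [a Ea] := psi_dvd_unit c'0 upi E; have [e Ee] := b1z; apply/in_span1.
    by exists (a * d * e); rewrite Ea fd Ee !mulrA.
have [y [ny yP]] := Hreg npi nb1.
apply: (@cyclic_regular_span [:: z; psi y]) => //.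
- exact: (cyclic_krull_dim2 (g := b1)).
- by case=> [|[|//]].
- move=> r /yP[c [d ->]]; have [e Ee] := b1z; apply/in_span2; exists (psi c * e), (psi d).
  by rewrite rmorphD !rmorphM Ee mulrA.
- by right; split=> //; apply/in_span2; exists 1, 0; rewrite mul1r mul0r addr0.
Qed.

End CyclicLocal.

(** * Irreducibility of X^n + h and generators at closed points *)

Lemma coprime_bezout d p : coprime d p -> (0 < d)%N ->
  exists u v, (u * d = v * p + 1)%N.
Proof.
move=> cop d_gt0; have [u v E _] := egcdnP p d_gt0.
by exists u, v; rewrite E (eqP cop).
Qed.

Lemma coprime_ltn_prime d p : prime p -> (0 < d < p)%N -> coprime d p.
Proof.
by move=> pr /andP[d0 dp]; rewrite coprime_sym prime_coprime // gtnNdvd.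
Qed.

(** With u d = v p + 1, h is the quotient of h^(u d) by h^(v p), a p-th power as soon as h^d is
    one. *)
Lemma not_pth_power_exp (K : fieldType) p (h : K) : prime p -> (forall g, h <> g ^+ p) ->
  forall d delta, (0 < d < p)%N -> delta ^+ p <> h ^+ d.
Proof.
move=> pr_p nh d delta dP Ed; have p0 := prime_gt0 pr_p.
have [u [v Euv]] := coprime_bezout (coprime_ltn_prime pr_p dP) (proj1 (andP dP)).
have h0 : h != 0 by apply/eqP => h0; apply: (nh 0); rewrite h0 expr0n gtn_eqF.
apply: (nh (delta ^+ u / h ^+ v)).
rewrite expr_div_n -exprM (mulnC u) exprM Ed -!exprM (mulnC d) Euv addn1 exprSr.
by rewrite mulrAC divff ?expf_neq0 // mul1r.
Qed.

(** On the quotient by a factor of degree d, made monic over [K], multiplication by X has n-th power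
    - h; its determinant [delta] satisfies delta^n = (- h)^d. Used with n = p for the branch curve
    and n = l for the cover. *)
Lemma Xn_addC_irreducible (A : idomainType) (K : fieldType) (iota : {rmorphism A -> K})
    n (h : A) : injective iota -> (1 < n)%N ->
    (forall d delta, (0 < d < n)%N -> delta ^+ n <> (- iota h) ^+ d) ->
  irreducible_poly ('X^n + h%:P).
Proof.
move=> inj n_gt1 nh; have n_gt0 := ltnW n_gt1.
have szb : size ('X^n + h%:P : {poly A}) = n.+1.
  by rewrite size_polyDl size_polyXn // (leq_ltn_trans (size_polyC_leq1 _)).
split=> [|q szq dvd_q]; first by rewrite szb ltnS.
have b0 : 'X^n + h%:P != 0 :> {poly A} by rewrite -size_poly_gt0 szb.
have le_q : (size q <= n.+1)%N by rewrite -szb; apply: Pdiv.Idomain.dvdp_leq.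
have q0 : q != 0.
  by apply/eqP => q0; move: dvd_q; rewrite q0 Pdiv.Idomain.dvd0p (negPf b0).
rewrite -Pdiv.Idomain.dvdp_size_eqp // szb eqn_leq le_q /= leqNgt; apply/negP => lt_q.
pose f := (lead_coef (map_poly iota q))^-1 *: map_poly iota q.
have szmap r : size (map_poly iota r) = size r by rewrite size_map_inj_poly ?rmorph0.
have mq0 : map_poly iota q != 0 by rewrite -size_poly_gt0 szmap size_poly_gt0.
have lq0 : lead_coef (map_poly iota q) != 0 by rewrite lead_coef_eq0.
have monf : f \is monic by rewrite monicE lead_coefZ mulVf.
have szf : size f = (size q - 2).+2.
  rewrite size_scale ?invr_eq0 // szmap -size_poly_gt0 in q0 *.
  by move: q0 szq; case: (size q) => [|[|m]] // _ _; rewrite subSS subn1.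
have [[c q1] /= c0 E] := Pdiv.Idomain.dvdpP _ _ dvd_q.
have ic0 : iota c != 0 by rewrite -(rmorph0 iota) (inj_eq inj).
(* The summand [0 *: 0] fits the form of [companion_det], whose congruence modulo [x] is an equality
   for x = 0. *)
have Ef : 'X^n + (iota h)%:P =
    ((iota c)^-1 *: map_poly iota q1 * (lead_coef (map_poly iota q))%:P) * f + 0 *: 0.
  rewrite scaler0 addr0 -mulrA mul_polyC scalerA divff // scale1r -scalerAl -rmorphM -E.
  by rewrite -[c *: _]mul_polyC rmorphM /= map_polyC mul_polyC scalerA mulVf // scale1r rmorphD /= map_polyXn map_polyC.
have [delta [e Ed]] := companion_det monf szf Ef.
rewrite mul0r addr0 in Ed; apply: nh Ed.
move: szq lt_q; rewrite -size_poly_gt0 in q0 *; move: q0.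
by case: (size q) => [|[|m]] // _ _; rewrite !subSS subn0.
Qed.

Section SpecialGenerators.
Variables (A : idomainType) (pi : A).
Hypothesis pi_unif : uniformizer pi.
Variable Q : {poly A} -> Prop.
Hypotheses (prQ : prime_ideal Q) (Qpi : Q pi%:P).

Let QM f g : Q g -> Q (f * g).
Proof. by case: prQ => _ _ _ QM _; apply: QM. Qed.

Lemma special_generators_X : Q 'X ->
  exists y, Q y /\ forall r, Q r -> exists c d, r = c * 'X + d * y.
Proof.
move=> QX; exists pi%:P; split=> // r; elim/poly_ind: r => [|r c _] Qr.
  by exists 0, 0; rewrite !mul0r addr0.
have : Q c%:P.
  rewrite -(addKr (r * 'X) c%:P) addrC; apply: idealB => //; last exact: QM.
  exact: prime_ideal_ideal.
move/(poly_unif_contraction pi_unif c prQ Qpi)/(unif_dvd pi_unif) => [d ->].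
by exists r, d%:P; rewrite -polyCM (mulrC d).
Qed.

(** If no h + a^p is a nonunit, X^p + h stays irreducible over the residue field: a factor of degree
    d, 0 < d < p, would make (- h)^d, hence - h, a p-th power modulo [pi]. *)
Lemma special_generators_Xp p h : p \in [pchar A] -> Q ('X^p + h%:P) ->
    (forall a, nonunit (h + a ^+ p) -> exists u, ~ nonunit u /\ h + a ^+ p = pi * u) ->
  exists y, Q y /\ forall r, Q r -> exists c d, r = c * ('X^p + h%:P) + d * y.
Proof.
move=> charp Qb tango; have pr_p := pcharf_prime charp; have p0 := prime_gt0 pr_p.
have szb : size ('X^p + h%:P : {poly A}) = p.+1.
  by rewrite size_polyDl size_polyXn // (leq_ltn_trans (size_polyC_leq1 _)).
have monb : 'X^p + h%:P \is monic.
  by rewrite monicE lead_coefDl ?lead_coefXn // size_polyXn (leq_ltn_trans (size_polyC_leq1 _)).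
have b_prim : ~ exists g, 'X^p + h%:P = pi *: g.
  case=> g E; have : nonunit (1 : A); last exact: nonunit1.
  by rewrite -(eqP monb) E lead_coefZ; apply/(unif_dvd pi_unif); exists (lead_coef g).
have idQ := prime_ideal_ideal prQ.
have [[a na]|noa] := pselect (exists a, nonunit (h + a ^+ p)).
  have [u [/contrapT[v uv] Eu]] := tango a na.
  have charpX : p \in [pchar {poly A}] by rewrite pchar_poly.
  (* As [u] is a unit, this makes [pi] a combination of X^p + h and X - a. *)
  have Ey : ('X - a%:P) ^+ p = 'X^p + h%:P - (pi * u)%:P :> {poly A}.
    rewrite -[LHS](pFrobenius_autE charpX) rmorphB /= !pFrobenius_autE -Eu polyCD polyC_exp.
    by rewrite opprD addrA addrK.
  have Qy : Q ('X - a%:P).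
    apply: (prime_idealX (n := p) prQ); rewrite Ey; apply: idealB => //.
    by rewrite mulrC polyCM; apply: QM.
  exists ('X - a%:P); split=> // r Qr.
  have [q Eq] : exists q, r = q * ('X - a%:P) + (r.[a])%:P.
    have /factor_theorem[q Eq] : root (r - (r.[a])%:P) a.
      by apply/rootP; rewrite !hornerE subrr.
    by exists q; rewrite -Eq subrK.
  have : Q (r.[a])%:P.
    by rewrite -(addKr (q * ('X - a%:P)) (r.[a])%:P) addrC -Eq; apply: idealB => //; apply: QM.
  move/(poly_unif_contraction pi_unif _ prQ Qpi)/(unif_dvd pi_unif) => [d Ed].
  exists (d * v)%:P, (q - (d * v)%:P * ('X - a%:P) ^+ p.-1).
  have Epi : (pi * d)%:P = (d * v)%:P * (pi * u)%:P.
    by rewrite -polyCM; congr _%:P; rewrite -[LHS]mulr1 -uv; ring.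
  by rewrite mulrBl -mulrA -exprSr prednK // Ey {1}Eq Ed Epi; ring.
have [f [Qf monf minf divf]] := poly_special_generator pi_unif prQ Qpi Qb b_prim.
have le_f := minf _ Qb b_prim; rewrite szb in le_f.
have f_gt1 : (1 < size f)%N.
  rewrite ltnNge; apply/negP => /size1_polyC Ef; case: prQ => _ [_ Q1] _ _ _; apply: Q1.
  by move: monf Qf; rewrite Ef monicE lead_coefC => /eqP ->.
have [q [r E]] := divf _ Qb.
have [lt_f|ge_f] := ltnP (size f) p.+1.
  have szf : size f = (size f - 2).+2 by rewrite -addn2 subnK.
  have [delta [c Ed]] := companion_det monf szf E.
  set d := (size f - 2).+1 in Ed.
  have dP : (0 < d < p)%N by rewrite /d ltn0Sn /= -ltnS -szf.
  have [u [v Euv]] := coprime_bezout (coprime_ltn_prime pr_p dP) isT.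
  case: noa.
  have [nh|/contrapT[w hw]] := pselect (nonunit h).
    by exists 0; rewrite expr0n gtn_eqF // mulr0n addr0.
  (* Modulo [pi] the p-th power of this element is (- h)^(v p + 1) (- w)^(v p), which equals - h
     since h w = 1. *)
  exists (delta ^+ u * (- w) ^+ v).
  have [e Ee] : exists e, ((- h) ^+ d + pi * c) ^+ u = (- h) ^+ (d * u) + pi * e.
    have Es := subrXX (pi * c + (- h) ^+ d) ((- h) ^+ d) u; rewrite addrK in Es.
    exists (c * \sum_(i < u) (pi * c + (- h) ^+ d) ^+ (u.-1 - i) * (- h) ^+ d ^+ i).
    by rewrite [in LHS]addrC exprM mulrA -Es [RHS]addrC subrK.
  apply/(unif_dvd pi_unif); exists ((- w) ^+ (v * p) * e).
  rewrite exprMn -!exprM (mulnC u) exprM Ed Ee mulrDl mulnC Euv.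
  have -> : (- h) ^+ (v * p + 1) * (- w) ^+ (v * p) = - h.
    by rewrite addn1 exprSr mulrAC -exprMn mulrNN hw expr1n mul1r.
  by ring.
(* Here [f] has the size of X^p + h, so a remainder by the latter is too short to be outside the
   multiples of [pi]. *)
exists pi%:P; split=> // g Qg.
have Eg := Pdiv.RingMonic.rdivp_eq monb g; set g' := Pdiv.Ring.rmodp _ _ in Eg.
have Qg' : Q g'.
  rewrite -(addKr (Pdiv.Ring.rdivp g ('X^p + h%:P) * ('X^p + h%:P)) g') addrC -Eg.
  by apply: idealB => //; apply: QM.
have [g1 Eg'] : exists g1, g' = pi *: g1.
  apply: contrapT => nd; have := leq_trans ge_f (minf _ Qg' nd).
  by rewrite leqNgt -szb Pdiv.Ring.ltn_rmodp monic_neq0.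
exists (Pdiv.Ring.rdivp g ('X^p + h%:P)), g1.
by rewrite (mulrC g1) mul_polyC -Eg'.
Qed.

End SpecialGenerators.

(** * Integral closedness of the cover *)

Lemma integral_fraction (R : comNzRingType) (L : fieldType) (g : {rmorphism R -> L}) u v :
    injective g -> v != 0 -> integralOver g (g u / g v) ->
  exists n t, u ^+ n.+1 = v * t.
Proof.
move=> g_inj v0 [m mon_m /rootP m0].
have gv0 : g v != 0 by rewrite -(rmorph0 g) (inj_eq g_inj).
have szm : size m = (size m).-1.+1 by rewrite prednK // size_poly_gt0 monic_neq0.
set n := (size m).-1 in szm; exists n.
(* The monic equation of u / v is multiplied by v^n, and once more by u to keep the exponent
   positive. *)
exists (- u * \sum_(i < n) m`_i * u ^+ i * v ^+ (n.-1 - i)).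
apply: g_inj; apply/eqP; rewrite -subr_eq0; apply/eqP.
transitivity (g u * (g v ^+ n * (map_poly g m).[g u / g v])); last by rewrite m0 !mulr0.
rewrite horner_coef size_map_poly_id0; last by rewrite (monicP mon_m) rmorph1 oner_neq0.
have mn : m`_n = 1 by rewrite -lead_coefE (monicP mon_m).
rewrite szm big_ord_recr /= coef_map /= mn rmorph1 mul1r expr_div_n.
rewrite mulrDr (mulrCA (g v ^+ n) (g u ^+ n)) divff ?expf_neq0 // mulr1 mulrDr -exprS rmorphXn [RHS]addrC; congr (_ + _).
rewrite -rmorphN mulNr mulrN opprK !rmorphM mulrCA; congr (_ * _).
rewrite rmorph_sum !mulr_sumr; apply: eq_bigr => -[i /= lt_in] _.
have En : g v ^+ n = g v * g v ^+ (n.-1 - i) * g v ^+ i.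
  have n_gt0 : (0 < n)%N by apply: leq_ltn_trans lt_in.
  have le_in : (i <= n.-1)%N by rewrite -ltnS prednK.
  by rewrite -mulrA -exprD subnK // -exprS prednK.
have gvi0 : g v ^+ i != 0 by rewrite expf_neq0.
rewrite En !rmorphM !rmorphXn coef_map /= expr_div_n; move: gvi0.
move: (g v ^+ i) (g u ^+ i) (g m`_i) (g v ^+ (n.-1 - i)) => a b c d a0.
by field.
Qed.

Section NormalPoly.
Variables (A : idomainType) (pi : A).
Hypothesis pi_unif : uniformizer pi.
Implicit Types (f g q r u v : {poly A}).

Let pi0 : pi != 0. Proof. by case: pi_unif. Qed.

Let scale_eq0 c f : c != 0 -> (c *: f == 0) = (f == 0).
Proof. by move=> c0; rewrite -mul_polyC mulf_eq0 polyC_eq0 (negPf c0). Qed.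

Lemma poly_unif_X f n :
  (exists g, f ^+ n = pi *: g) -> (0 < n)%N -> exists g, f = pi *: g.
Proof.
case: n => // n [g E] _; elim: n g E => [|n IH] g E; first by exists g.
have /(unif_poly_prime pi_unif)[//|[h Eh]] : exists h, f * f ^+ n.+1 = pi *: h.
  by exists g; rewrite -exprS.
exact: IH Eh.
Qed.

(* Divisibility in [K[t]] descends to [A[t]] as soon as no power of [pi] is lost. *)
Lemma dvdp_unif u v : v != 0 -> v %| u ->
    (forall e q, pi ^+ e.+1 *: u = q * v -> exists q', q = pi *: q') ->
  exists q, u = q * v.
Proof.
move=> v0 /Pdiv.Idomain.dvdpP[[c q] /= c0 E] H.
have [e [w [/contrapT[w' ww'] Ec]]] : exists n (a : A), ~ nonunit a /\ c = a * pi ^+ n.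
  by case: pi_unif => _ _; apply.
have {}E : pi ^+ e *: u = (w' *: q) * v.
  by rewrite -scalerAl -E Ec !scalerA mulrA (mulrC w') ww' mul1r.
elim: e (w' *: q) {Ec} E => [|e IH] q' E; first by exists q'; rewrite -E scale1r.
have [q1 Eq1] := H _ _ E; apply: (IH q1).
have piP0 : pi%:P != 0 by rewrite polyC_eq0.
by apply: (mulfI piP0); rewrite !mul_polyC scalerA -exprS E Eq1 scalerAl.
Qed.

Lemma dvdp_coprime_part u v : v != 0 ->
  exists c1 c2 d u' v', [/\ c1 != 0 /\ c2 != 0, d != 0, c1 *: u = u' * d, c2 *: v = v' * d
    & coprimep u' v'].
Proof.
move=> v0; pose d := gcdp u v.
have d0 : d != 0 by rewrite gcdp_eq0 negb_and v0 orbT.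
exists (lead_coef d ^+ scalp u d), (lead_coef d ^+ scalp v d), d, (u %/ d), (v %/ d).
rewrite !expf_neq0 ?lead_coef_eq0 // !Pdiv.Idomain.divpK ?dvdp_gcdl ?dvdp_gcdr //.
by split=> //; rewrite coprimep_div_gcd // v0 orbT.
Qed.

Variables (L : fieldType) (G : {rmorphism {poly A} -> L}).
Hypothesis G_inj : injective G.

Let G0 u : (G u == 0) = (u == 0).
Proof. by rewrite -(inj_eq G_inj) rmorph0. Qed.

(** Over the fraction field, a denominator prime to the numerator divides one of its powers and is
    constant. A remaining denominator [pi] divides a power of the numerator, hence the numerator by
    Gauss's lemma. *)
Lemma poly_unif_normal u v : v != 0 -> integralOver G (G u / G v) -> exists q, u = q * v.
Proof.
move=> v0 int_uv; apply: dvdp_unif => // [|e q E].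
  have [c1 [c2 [d [u' [v' [[c10 c20] d0 Eu Ev cop]]]]]] := dvdp_coprime_part u v0.
  have v'0 : v' != 0.
    by apply: contra_neq v0 => v'0; apply/eqP; rewrite -(scale_eq0 _ c20) Ev v'0 mul0r.
  have Efrac : G u / G v = G (c2 *: u') / G (c1 *: v').
    apply/eqP; rewrite eqr_div ?G0 ?scale_eq0 //; apply/eqP.
    rewrite -!rmorphM; congr (G _); apply: (mulIf d0).
    rewrite -!mul_polyC; transitivity (c1%:P * u * (v' * d)); first by ring.
    by rewrite -Ev mul_polyC Eu -mul_polyC; ring.
  rewrite Efrac in int_uv.
  have [|n [t E]] := integral_fraction G_inj _ int_uv.
    by rewrite scale_eq0.
  have : v' %| u' ^+ n.+1.
    have : c2 ^+ n.+1 *: u' ^+ n.+1 = (c1 *: t) * v'.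
      by rewrite -exprZn E -!scalerAl (mulrC t).
    by move=> Et; apply/Pdiv.Idomain.dvdpP; exists (c2 ^+ n.+1, c1 *: t); rewrite //= expf_neq0.
  rewrite -[u' ^+ _]mul1r Gauss_dvdpl; last by rewrite coprimep_expr // coprimep_sym.
  rewrite Pdiv.Idomain.dvdp1 => /size_poly1P[c c0 Ec].
  rewrite -(Pdiv.Idomain.dvdpZr v u c10) Eu -(Pdiv.Idomain.dvdpZl v _ c20) Ev Ec.
  by rewrite mul_polyC Pdiv.Idomain.dvdpZl // dvdp_mull.
have Efrac : G u / G v = G q / G (pi ^+ e.+1)%:P.
  apply/eqP; rewrite eqr_div ?G0 ?polyC_eq0 ?expf_neq0 // -!rmorphM -E.
  by rewrite mulrC mul_polyC.
rewrite Efrac in int_uv; have [|n [t Et]] := integral_fraction G_inj _ int_uv.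
  by rewrite polyC_eq0 expf_neq0.
apply: (poly_unif_X (n := n.+1)) => //; exists (pi ^+ e *: t).
by rewrite Et mul_polyC scalerA exprS.
Qed.

(** The l-th power of r w^i / v lies over A[v]. As i < l, the irreducible [b1] cannot make up for an
    l-th power in the denominator. Nothing of this kind is known of [b2], hence the product
    [r * b2]. *)
Lemma root_normal (b1 b2 r v : {poly A}) l i : (i < l)%N -> v != 0 ->
    irreducible_poly b1 -> ~ (exists h, b1 = pi *: h) ->
    integralOver G (G (r ^+ l * (b1 * b2) ^+ i) / G (v ^+ l)) ->
  exists q, r * b2 = q * v.
Proof.
move=> lt_il v0 irr prim int_r.
have [|mu Emu] := poly_unif_normal _ int_r; first by rewrite expf_neq0.
have l_gt0 : (0 < l)%N by apply: leq_trans lt_il.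
pose r1 := r * b2; pose mu' := mu * b2 ^+ (l - i).
(* The extra l-th power of [b2] outweighs its i-th power, so that all of [b2] moves into [mu']. *)
have E1 : r1 ^+ l * b1 ^+ i = mu' * v ^+ l.
  rewrite /mu' mulrAC -Emu exprMn -!mulrA; congr (_ * _).
  by rewrite exprMn -mulrA -exprD subnKC ?(ltnW lt_il) // mulrC.
have [b1_gt1 b1_irr] := irr.
apply: dvdp_unif => // [|e q E].
  have [c1 [c2 [d [r' [v' [[c10 c20] d0 Er Ev cop]]]]]] := dvdp_coprime_part r1 v0.
  have v'0 : v' != 0.
    by apply: contra_neq v0 => v'0; apply/eqP; rewrite -(scale_eq0 _ c20) Ev v'0 mul0r.
  have dvd1 : v' ^+ l %| b1 ^+ i.
    rewrite -(Gauss_dvdpr _ (_ : coprimep (v' ^+ l) (r' ^+ l))); last first.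
      by rewrite coprimep_expl // coprimep_expr // coprimep_sym.
    have dl0 : d ^+ l != 0 by rewrite expf_neq0.
    rewrite -(Pdiv.Idomain.dvdp_mul2r _ _ dl0) mulrAC -!exprMn -Er -Ev.
    rewrite !exprZn Pdiv.Idomain.dvdpZl ?expf_neq0 // -scalerAl Pdiv.Idomain.dvdpZr ?expf_neq0 //.
    by rewrite E1 dvdp_mull.
  suff : size v' == 1%N.
    move=> /size_poly1P[c c0 Ec].
    rewrite -(Pdiv.Idomain.dvdpZr v _ c10) Er -(Pdiv.Idomain.dvdpZl v _ c20) Ev Ec.
    by rewrite mul_polyC Pdiv.Idomain.dvdpZl // dvdp_mull.
  rewrite -Pdiv.Idomain.dvdp1.
  have [cop1|ncop] := boolP (coprimep v' b1).
    have : coprimep (v' ^+ l) (b1 ^+ i) by rewrite coprimep_expl // coprimep_expr.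
    move/Gauss_dvdpl => /(_ 1); rewrite mul1r dvd1 => /esym H.
    by apply: Pdiv.Idomain.dvdp_trans H; apply: dvdp_exp.
  have b1v' : b1 %| v'.
    have sg : size (gcdp v' b1) != 1%N by [].
    have /andP[_ H] := b1_irr _ sg (dvdp_gcdr _ _).
    exact: Pdiv.Idomain.dvdp_trans H (dvdp_gcdl _ _).
  have b10 : b1 != 0 by apply: irredp_neq0.
  have : b1 ^+ l %| b1 ^+ i by apply: Pdiv.Idomain.dvdp_trans dvd1; apply: Pdiv.Idomain.dvdp_exp2r.
  move/(Pdiv.Idomain.dvdp_leq (expf_neq0 _ b10)).
  have sz0 : (0 < (size b1).-1)%N by rewrite -subn1 subn_gt0.
  move/(leq_sub2r 1); rewrite !subn1 !size_exp (leq_pmul2l sz0) => le_li.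
  by exfalso; move: lt_il; rewrite ltnNge le_li.
(* The same comparison at [pi], which is prime and does not divide [b1]. *)
have E2 : q ^+ l * b1 ^+ i = pi ^+ (e.+1 * l) *: mu'.
  apply: (mulIf (expf_neq0 l v0)); rewrite -scalerAl -E1 mulrAC -exprMn -E exprZn -exprM.
  by rewrite scalerAl.
have /(unif_poly_prime pi_unif)[[h Eh]|[h Eh]] : exists h, q ^+ l * b1 ^+ i = pi *: h.
- by exists (pi ^+ (e.+1 * l).-1 *: mu'); rewrite scalerA -exprS prednK // muln_gt0.
- by apply: poly_unif_X l_gt0; exists h.
- case: i Eh {lt_il int_r Emu mu' E1 E2} => [|i] Eh.
    case: (@nonunit1 A); have := congr1 (fun f : {poly A} => f`_0) Eh.
    by rewrite expr0 coefC coefZ /= => ->; apply/(unif_dvd pi_unif); exists h`_0.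
  by case: prim; apply: (poly_unif_X (n := i.+1)) => //; exists h.
Qed.

End NormalPoly.

Lemma integral_sum (R K : comNzRingType) (g : {rmorphism R -> K}) n (F : 'I_n -> K) :
  (forall i, integralOver g (F i)) -> integralOver g (\sum_i F i).
Proof.
move=> intF; apply: (big_ind (fun x => integralOver g x)) => //.
  exact: integral0. exact: integral_add.
Qed.

Lemma sum_root_of_unity (R : idomainType) (w : R) n : w ^+ n = 1 -> w != 1 ->
  \sum_(j < n) w ^+ j = 0.
Proof.
move=> wn; rewrite -subr_eq0 => w1; apply: (mulfI w1); rewrite mulr0 -subrX1 wn subrr //.
Qed.

Section CyclicNormal.
Variables (A : idomainType) (pi : A) (l : nat) (b b1 b2 : {poly A}).
Variables (S : comNzRingType) (Phi : {rmorphism {poly {poly A}} -> S}).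
Hypotheses (pi_unif : uniformizer pi) (l_gt0 : (0 < l)%N).
Hypothesis Phi_root : Phi ('X^l - b%:P) = 0.
Hypothesis Phi_free : forall w : {poly {poly A}}, (size w <= l)%N -> Phi w = 0 -> w = 0.
Hypothesis Phi_frac : forall s, exists a b, ~ nonunit (Phi b) /\ s * Phi b = Phi a.
Hypothesis S_dom : forall s t : S, s * t = 0 -> s = 0 \/ t = 0.

Let psi : {rmorphism {poly A} -> S} := Phi \o polyC.
Let psiE r : psi r = Phi r%:P. Proof. by []. Qed.

(** In a monic equation of [Phi w], zero constant terms are removed by cancelling [Phi w]; the first
    nonzero one is a multiple of [Phi w]. *)
Lemma cyclic_nonzero_norm (w : {poly {poly A}}) : Phi w != 0 ->
  exists w' r, r != 0 /\ Phi (w * w') = psi r.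
Proof.
move=> w0; have [m mon_m /rootP m0] := cyclic_integral l_gt0 Phi_root w.
elim/poly_ind: m mon_m m0 => [|m c IH]; first by rewrite monicE lead_coef0 eq_sym oner_eq0.
rewrite monicE lead_coef_MXaddC rmorphD rmorphM /= map_polyX map_polyC hornerMXaddC /=.
have [->|c0] := eqVneq c 0; last first.
  move=> _ E; exists (- (map_poly polyC m).[w]), c; split=> //.
  have Ec : psi c = - ((map_poly psi m).[Phi w] * Phi w) by apply/eqP; rewrite -addr_eq0 addrC E.
  by rewrite [RHS]Ec mulrN rmorphN rmorphM -horner_map -map_poly_comp mulrC.
rewrite rmorph0 addr0; case: ifP => [_ /eqP E|_ mon E].
  by case/eqP: (oner_neq0 {poly A}); rewrite -E.
apply: IH; first by rewrite monicE.
by case: (S_dom E) => // /eqP; rewrite (negPf w0).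
Qed.

Lemma cyclic_common_denominator (m : {poly S}) :
  exists v, ~ nonunit (Phi v) /\ forall i, exists a, m`_i * Phi v = Phi a.
Proof.
elim/poly_ind: m => [|m c [v [uv IH]]].
  exists 1; rewrite rmorph1; split=> [|i]; first exact: nonunit1.
  by exists 0; rewrite coef0 mul0r rmorph0.
have [a [v' [uv' E]]] := Phi_frac c; exists (v * v'); rewrite rmorphM; split.
  exact: unit_mul.
move=> i; rewrite coefD coefMX coefC; case: i => [|i] /=.
  by exists (v * a); rewrite add0r rmorphM -E; ring.
have [a' E'] := IH i; exists (a' * v'); rewrite addr0 rmorphM -E'; ring.
Qed.

Variables (L : fieldType) (f : {rmorphism S -> L}).
Hypothesis f_inj : injective f.

Let G : {rmorphism {poly A} -> L} := f \o psi.
Let G_inj : injective G.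
Proof.
move=> r r' /f_inj E; apply/eqP; rewrite -subr_eq0; apply/eqP.
by apply: (cyclic_psi_inj l_gt0 Phi_free); rewrite rmorphB /= -!psiE E subrr.
Qed.

(** Scaling the roots by a common denominator of the coefficients keeps the equation monic and turns
    its coefficients into values of [Phi], which are integral over A[v]. *)
Lemma cyclic_integral_descent y : integralOver f y ->
  exists v, ~ nonunit (Phi v) /\ integralOver G (f (Phi v) * y).
Proof.
move=> [m mon_m /rootP m0]; have [v [uv vP]] := cyclic_common_denominator m.
exists v; split=> //; set u := f (Phi v).
have szm : size m = (size m).-1.+1 by rewrite prednK // size_poly_gt0 monic_neq0.
set n := (size m).-1 in szm.
have mn : m`_n = 1 by rewrite -lead_coefE (monicP mon_m).
pose m' : {poly L} := \poly_(i < n.+1) (f m`_i * u ^+ (n - i)).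
have lm' : lead_coef m' = 1.
  rewrite lead_coef_poly //; last by rewrite mn subnn rmorph1 mulr1 oner_neq0.
  by rewrite mn subnn rmorph1 mulr1.
have int_Phi w : integralOver G (f (Phi w)).
  exact: integral_rmorph (cyclic_integral l_gt0 Phi_root w).
apply: (integral_root_monic (p := m')); first by rewrite monicE lm'.
  apply/rootP; rewrite horner_poly.
  transitivity (u ^+ n * (map_poly f m).[y]); last by rewrite m0 mulr0.
  rewrite horner_coef size_map_poly_id0; last by rewrite (monicP mon_m) rmorph1 oner_neq0.
  rewrite szm mulr_sumr; apply: eq_bigr => -[i /= lt_in] _.
  have -> : u ^+ n = u ^+ (n - i) * u ^+ i by rewrite -exprD subnK.
  by rewrite coef_map /= exprMn; ring.
apply/integral_poly => i; rewrite coef_poly; case: ifP => [lt_in|_]; last exact: integral0.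
have [->|ne_in] := eqVneq i n; first by rewrite mn subnn rmorph1 mulr1; exact: integral1.
have lt_in' : (i < n)%N by rewrite ltn_neqAle ne_in -ltnS.
have [a Ea] := vP i.
rewrite -(prednK (n := (n - i)%N)) ?subn_gt0 // exprS mulrA /u -rmorphM Ea -rmorphXn -rmorphM -rmorphXn -rmorphM.
exact: int_Phi.
Qed.

(* The conjugates of an integral element of the cyclic extension are integral. *)
Lemma cyclic_conjugate_integral (w : {poly {poly A}}) r xi :
    r != 0 -> xi ^+ l = G b -> integralOver G (f (Phi w) / G r) ->
  integralOver G ((map_poly G w).[xi] / G r).
Proof.
move=> r0 xil [m mon_m /rootP m0]; exists m => //; apply/rootP.
have Gr0 : G r != 0 by rewrite -(rmorph0 G) (inj_eq G_inj).
have szm : size m = (size m).-1.+1 by rewrite prednK // size_poly_gt0 monic_neq0.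
set n := (size m).-1 in szm.
have mapm_sz : size (map_poly G m) = n.+1.
  by rewrite size_map_poly_id0 // (monicP mon_m) rmorph1 oner_neq0.
(* This is r^n m(w / r) without denominators. Being in the kernel of [Phi], it is divisible by X^l -
   b and vanishes when X is replaced by any l-th root of b. *)
pose H := \sum_(i < n.+1) (m`_i)%:P * w ^+ i * r%:P ^+ (n - i).
have evalH (E : {rmorphism {poly {poly A}} -> L}) : (forall c, E c%:P = G c) ->
    E H = G r ^+ n * (map_poly G m).[E w / G r].
  move=> EC; rewrite horner_coef mapm_sz rmorph_sum mulr_sumr; apply: eq_bigr => -[i /= lt_in] _.
  rewrite !rmorphM !rmorphXn /= !EC coef_map /= expr_div_n.
  have -> : G r ^+ n = G r ^+ (n - i) * G r ^+ i by rewrite -exprD subnK.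
  have : G r ^+ i != 0 by rewrite expf_neq0.
  move: (G r ^+ i) (G m`_i) (E w ^+ i) (G r ^+ (n - i)) => x y z t x0.
  by field.
have H0 : Phi H = 0.
  apply: f_inj; rewrite rmorph0 -[f _]/((f \o Phi) H) evalH //.
  by rewrite /= m0 mulr0.
have EH := Pdiv.RingMonic.rdivp_eq (monicXnsubC b l_gt0) H.
set q := Pdiv.Ring.rdivp _ _ in EH; set r' := Pdiv.Ring.rmodp _ _ in EH.
have r'0 : r' = 0.
  apply: Phi_free; last by move: H0; rewrite EH rmorphD rmorphM Phi_root mulr0 add0r.
  by rewrite -ltnS -(size_XnsubC b l_gt0) Pdiv.Ring.ltn_rmodp -size_poly_eq0 size_XnsubC.
pose E : {rmorphism {poly {poly A}} -> L} := horner_eval xi \o map_poly G.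
have EC c : E c%:P = G c by rewrite /E /= map_polyC /horner_eval hornerC.
have := evalH E EC; rewrite EH r'0 addr0 rmorphM.
have -> : E ('X^l - b%:P) = 0.
  by rewrite rmorphB EC /E /= map_polyXn /horner_eval hornerXn xil subrr.
rewrite mulr0 => /esym/eqP; rewrite mulf_eq0 expf_eq0 (negPf Gr0) andbF /= => /eqP.
by [].
Qed.

Variables (omega linv : A).
Hypotheses (omega_prim : l.-primitive_root omega) (linvP : l%:R * linv = 1).

Lemma cyclic_components_integral (w : {poly {poly A}}) r i :
    (size w <= l)%N -> (i < l)%N -> r != 0 -> integralOver G (f (Phi w) / G r) ->
  integralOver G (G w`_i * f (Phi 'X) ^+ i / G r).
Proof.
move=> szw lt_il r0 int_w; set zeta := f (Phi 'X).
pose om := G omega%:P.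
have oml : om ^+ l = 1 by rewrite -rmorphXn -polyC_exp (prim_expr_order omega_prim) !rmorph1.
have omP j : om ^+ j = 1 -> (l %| j)%N.
  rewrite -rmorphXn -polyC_exp -(rmorph1 G) => /G_inj; rewrite -polyC1 => /polyC_inj/eqP.
  by rewrite -(prim_order_dvd omega_prim).
have int_j j : integralOver G ((map_poly G w).[om ^+ j * zeta] / G r).
  apply: cyclic_conjugate_integral => //.
  rewrite exprMn -exprM mulnC exprM oml expr1n mul1r -rmorphXn.
  by rewrite (cyclic_X_exp Phi_root).
(* Inverse Fourier transform over the conjugates; the exponent [j * (l - i)] stands for - j i. *)
have -> : G w`_i * zeta ^+ i / G r =
    G linv%:P * \sum_(j < l) om ^+ (j * (l - i)) * ((map_poly G w).[om ^+ j * zeta] / G r).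
  transitivity (G linv%:P * (l%:R * (G w`_i * zeta ^+ i / G r))).
    by rewrite mulrA -(rmorph_nat G) -rmorphM -polyC_natr -polyCM (mulrC linv) linvP !rmorph1 mul1r.
  congr (_ * _).
  have szG : (size (map_poly G w) <= l)%N by apply: leq_trans (size_poly _ _) szw.
  under [RHS]eq_bigr => j _.
    rewrite (horner_coef_wide _ szG) mulr_suml mulr_sumr.
    under eq_bigr => i' _ do rewrite coef_map /= exprMn.
    over.
  rewrite exchange_big /=.
  rewrite (bigD1 (Ordinal lt_il)) //= [X in _ + X]big1 ?addr0 => [|i' ne_i'i].
    transitivity (\sum_(j < l) (G w`_i * zeta ^+ i / G r)).
      by rewrite sumr_const card_ord mulr_natl.
    apply: eq_bigr => j _; rewrite -exprM.
    have -> : om ^+ (j * (l - i)) * (G w`_i * (om ^+ (j * i) * zeta ^+ i) / G r) =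
       om ^+ (j * (l - i)) * om ^+ (j * i) * (G w`_i * zeta ^+ i / G r) by ring.
    by rewrite -exprD -mulnDr subnK ?(ltnW lt_il) // mulnC exprM oml expr1n mul1r.
  transitivity (\sum_(j < l) (om ^+ (l - i + i')) ^+ j * (G w`_i' * zeta ^+ i' / G r)).
    apply: eq_bigr => j _; rewrite -!exprM mulnC mulnDl exprD mulnC (mulnC j i'); ring.
  rewrite -mulr_suml sum_root_of_unity ?mul0r //.
    by rewrite -exprM mulnC exprM oml expr1n.
  apply/eqP => /omP/dvdnP[c Ec]; move/eqP: ne_i'i; apply; apply: val_inj => /=.
  have := ltn_ord i'; case: c Ec => [|[|c]]; rewrite ?mulSn; lia.
apply: integral_mul; first exact: integral_id.
apply: integral_sum => j; apply: integral_mul => //.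
by rewrite -rmorphXn; exact: integral_id.
Qed.

Hypothesis b_fact : b = b1 * b2.
Hypotheses (b2_unit : ~ nonunit (psi b2)) (b1_irr : irreducible_poly b1).
Hypothesis b1_prim : ~ exists h, b1 = pi *: h.

(** Scaled by a unit, the fraction becomes [Phi w] over some [r] from A[v]. The components of [w]
    times [b2] are divisible by [r], and the units [b2] and [v] are divided out at the end. *)
Lemma cyclic_integrally_closed s t : t != 0 -> integralOver f (f s / f t) ->
  exists c, f c = f s / f t.
Proof.
move=> t0 int_st.
have f0 x : (f x == 0) = (x == 0) by rewrite -(rmorph0 f) (inj_eq f_inj).
have unit0 x : ~ nonunit x -> x != 0.
  by move=> ux; apply/eqP => x0; apply: ux; rewrite x0; exact: nonunit0.
have [v [uv int_v]] := cyclic_integral_descent int_st.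
have [a1 [v1 [uv1 E1]]] := Phi_frac s; have [a2 [v2 [uv2 E2]]] := Phi_frac t.
have wt0 : Phi (a2 * v1) != 0.
  by rewrite rmorphM -E2 -f0 !rmorphM !mulf_eq0 !f0 !negb_or t0 !unit0.
have [w' [r [r0 Er]]] := cyclic_nonzero_norm wt0.
have [w [szw Ew]] := cyclic_reduce l_gt0 Phi_root (v * (a1 * v2) * w').
have Gr0 : G r != 0 by rewrite -(rmorph0 G) (inj_eq G_inj).
have Ey : f (Phi v) * (f s / f t) = f (Phi w) / G r.
  apply/eqP; rewrite mulrA eqr_div //; last by rewrite f0.
  apply/eqP.
  rewrite -[G r]/(f (psi r)) -!rmorphM Ew -Er; congr (f _).
  by rewrite !rmorphM -E1 -E2; ring.
rewrite Ey in int_v.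
have /choice[q qP] : forall i, exists q, (i < l)%N -> w`_i * b2 = q * r.
  move=> i; have [lt_il|] := boolP (i < l)%N; last by exists 0.
  suff [q Eq] : exists q, w`_i * b2 = q * r by exists q.
  apply: (root_normal pi_unif G_inj lt_il r0 b1_irr b1_prim).
  have -> : G (w`_i ^+ l * (b1 * b2) ^+ i) / G (r ^+ l) = (G w`_i * f (Phi 'X) ^+ i / G r) ^+ l.
    have Ez : f (Phi 'X) ^+ l = G b by rewrite -rmorphXn (cyclic_X_exp Phi_root).
    rewrite [RHS]expr_div_n [in RHS]exprMn -[in RHS]exprM [in RHS]mulnC [in RHS]exprM Ez b_fact.
    by rewrite rmorphM !(rmorphXn G).
  have int_t := cyclic_components_integral szw lt_il r0 int_v.
  elim: (l in X in integralOver _ X) => [|n IH]; first by rewrite expr0; exact: integral1.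
  by rewrite exprS; apply: integral_mul.
pose w2 := \poly_(i < l) q i.
have Ew2 : w * b2%:P = w2 * r%:P.
  apply/polyP => i; rewrite !coefMC coef_poly; case: ifP => [lt_il|]; first exact: qP.
  by move/negbT; rewrite -leqNgt => le_li; rewrite nth_default ?mul0r // (leq_trans szw).
have /contrapT[c2 cb2] := b2_unit; have /contrapT[cv vcv] := uv.
exists (Phi w2 * c2 * cv).
have fv0 : f (Phi v) != 0 by rewrite f0 unit0.
apply: (mulfI fv0); rewrite Ey; apply: (mulIf Gr0); rewrite divfK //.
rewrite -[G r]/(f (psi r)) -!rmorphM; congr (f _).
transitivity (Phi (w2 * r%:P) * c2 * (Phi v * cv)); first by rewrite rmorphM -psiE; ring.
by rewrite vcv mulr1 -Ew2 rmorphM -psiE -mulrA cb2 mulr1.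
Qed.

End CyclicNormal.

Lemma cyclic_normal (A : idomainType) (pi : A) l (b1 b2 : {poly A}) (S : comNzRingType)
    (Phi : {rmorphism {poly {poly A}} -> S}) (omega linv : A) :
    uniformizer pi -> (0 < l)%N -> Phi ('X^l - (b1 * b2)%:P) = 0 ->
    (forall w : {poly {poly A}}, (size w <= l)%N -> Phi w = 0 -> w = 0) ->
    (forall s, exists a b, ~ nonunit (Phi b) /\ s * Phi b = Phi a) ->
    (forall s t : S, s * t = 0 -> s = 0 \/ t = 0) ->
    l.-primitive_root omega -> l%:R * linv = 1 ->
    ~ nonunit (Phi b2%:P) -> irreducible_poly b1 -> ~ (exists h, b1 = pi *: h) ->
  normal_domain S.
Proof.
move=> pi_unif l_gt0 Phi_root Phi_free Phi_frac S_dom om_prim linvP b2_unit b1_irr b1_prim.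
split=> // L f f_inj s t; rewrite -/(t != 0).
exact: (cyclic_integrally_closed pi_unif l_gt0 Phi_root Phi_free Phi_frac S_dom f_inj om_prim linvP).
Qed.

(** * Valuation rings of a curve *)

Section ValuationRing.
Variables (k : closedFieldType) (C : curve k) (x : point C).
Implicit Types f g : C.

Definition in_valring : {pred C} := [pred f | (f == 0) || (0 <= x f)].

Lemma val_add_lt f g : f != 0 -> g != 0 -> x f < x g -> f + g != 0 /\ x (f + g) = x f.
Proof.
move=> f0 g0 lt_fg.
have fg0 : f + g != 0.
  by apply: contraTneq lt_fg => /eqP; rewrite addr_eq0 => /eqP ->; rewrite Defs.valN ltxx.
split=> //; apply/le_anti; apply/andP; split; last first.
  by have := Defs.valD x f0 g0 fg0; rewrite min_l // ltW.
have ng0 : - g != 0 by rewrite oppr_eq0.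
have := Defs.valD x fg0 ng0; rewrite addrK => /(_ f0); rewrite Defs.valN minEle.
by case: ifP => // _; rewrite leNgt lt_fg.
Qed.

Lemma in_valring_subring : subring_closed in_valring.
Proof.
split=> [|f g|f g].
- by rewrite inE Defs.val1 lexx orbT.
- rewrite !inE; have [->|f0] := eqVneq f 0; first by rewrite sub0r oppr_eq0 Defs.valN.
  have [->|g0] := eqVneq g 0; first by rewrite subr0 (negPf f0).
  have [//|fg0] := eqVneq (f - g) 0 => /= xf xg.
  have ng0 : - g != 0 by rewrite oppr_eq0.
  by have := Defs.valD x f0 ng0 fg0; apply: le_trans; rewrite le_min xf Defs.valN.
- rewrite !inE; have [->|f0] := eqVneq f 0; first by rewrite mul0r eqxx.
  have [->|g0] := eqVneq g 0; first by rewrite mulr0 eqxx.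
  by move=> /= xf xg; rewrite Defs.valM // addr_ge0 // orbT.
Qed.

HB.instance Definition _ := GRing.isSubringClosed.Build C in_valring in_valring_subring.

Record valring := ValRing { valring_val : C; valring_valP : valring_val \in in_valring }.

HB.instance Definition _ := [isSub for valring_val].
HB.instance Definition _ := [Choice of valring by <:].
HB.instance Definition _ := [SubChoice_isSubComNzRing of valring by <:].

Definition valring_unit : {pred valring} :=
  [pred a : valring | (val a != 0) && ((val a)^-1 \in in_valring)].

Definition valring_inv (a : valring) : valring :=
  if a \in valring_unit then insubd a (val a)^-1 else a.

Lemma valring_mulVr : {in valring_unit, left_inverse 1 valring_inv *%R}.
Proof.
move=> a ua; rewrite /valring_inv ua; case/andP: ua => a0 va.
by apply: val_inj; rewrite rmorphM /= insubdK // mulVf.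
Qed.

Lemma valring_unitP (a b : valring) : b * a = 1 -> a \in valring_unit.
Proof.
move=> ba1; have E : val b * val a = 1 by rewrite -rmorphM ba1 rmorph1.
have a0 : val a != 0 by apply: contra_eq_neq E => ->; rewrite mulr0 eq_sym oner_eq0.
rewrite inE /= a0 /=; have -> : (val a)^-1 = val b by rewrite -[RHS](mulfK a0) E mul1r.
exact: valP.
Qed.

Lemma valring_inv_out : {in [predC valring_unit], valring_inv =1 id}.
Proof. by move=> a; rewrite inE /= /valring_inv => /negPf ->. Qed.

HB.instance Definition _ :=
  GRing.ComNzRing_hasMulInverse.Build valring valring_mulVr valring_unitP valring_inv_out.

Lemma valring_integral : GRing.integral_domain_axiom valring.
Proof.
by move=> a b /(congr1 val)/eqP; rewrite rmorphM rmorph0 mulf_eq0 -!val_eqE.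
Qed.

HB.instance Definition _ := GRing.ComUnitRing_isIntegral.Build valring valring_integral.

Definition valring_emb : {rmorphism valring -> C} := val.

Lemma valring_nonunit (a : valring) : nonunit a <-> valring_val a = 0 \/ 0 < x (valring_val a).
Proof.
split=> [na|na [b /(congr1 valring_val) ab]].
  have [a0|a0] := eqVneq (valring_val a) 0; [by left | right].
  have := valP a; rewrite inE (negPf a0) /= le_eqVlt => /predU1P[xa|//]; case: na.
  have va : (valring_val a)^-1 \in in_valring by rewrite inE Defs.valV // -xa oppr0 lexx orbT.
  by exists (ValRing va); apply: val_inj; rewrite rmorphM /= divff.
have {}ab : valring_val a * valring_val b = 1 by exact: ab.
case: na => [a0|xa].
  by move/eqP: ab; rewrite a0 mul0r eq_sym oner_eq0.
have /andP[a0 b0] : (valring_val a != 0) && (valring_val b != 0).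
  by rewrite -negb_or -mulf_eq0 ab oner_eq0.
have := congr1 x ab; rewrite Defs.valM // Defs.val1 => xab.
have := valP b; rewrite inE (negPf b0) /= => xb.
by have := ltr_wpDr xb xa; rewrite xab ltxx.
Qed.

Lemma valring_uniformizer (t : valring) : x (valring_val t) = 1 -> valring_val t != 0 -> uniformizer t.
Proof.
move=> xt t0; split; first by rewrite -val_eqE.
  by apply/valring_nonunit; right; rewrite xt.
move=> a a0; have va0 : valring_val a != 0 by rewrite -val_eqE in a0.
have := valP a; rewrite inE (negPf va0) /=; case E: (x (valring_val a)) => [n|//] _.
have tn0 : valring_val t ^+ n != 0 by rewrite expf_neq0.
pose c := valring_val a / valring_val t ^+ n.
have c0 : c != 0 by rewrite mulf_neq0 ?invr_eq0.
have xc : x c = 0 by rewrite Defs.valM ?invr_eq0 // Defs.valV // Defs.valX // xt E natz subrr.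
have vc : c \in in_valring by rewrite inE xc lexx orbT.
exists n, (ValRing vc); split; last by apply: val_inj; rewrite rmorphM rmorphXn /= divfK.
by move=> /valring_nonunit[/eqP|]; rewrite /= ?(negPf c0) ?xc.
Qed.

Lemma in_valring_cst (a : k) : cst C a \in in_valring.
Proof. by rewrite inE val_cst lexx orbT. Qed.

End ValuationRing.

(** * Function fields over their subfields of p-th powers *)

Lemma fraction_denominator (D : idomainType) (u : {fraction D}) :
  exists a b, b != 0 /\ u * tofrac b = tofrac a.
Proof.
elim/quotW: u => x; exists (frac x).1, (frac x).2; split; first exact: denom_ratioP.
apply/eqP; rewrite -[_ * _]/(FracField.mul _ _) !piE /FracField.equivf /FracField.mulf.
by rewrite !numden_Ratio ?mulf_neq0 ?denom_ratioP ?oner_eq0 //= !mulr1 mulrC.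
Qed.

Lemma fraction_common_denominator (D : idomainType) (I : finType) (u : I -> {fraction D}) :
  exists (d : D) (a : I -> D), d != 0 /\ forall i, u i * tofrac d = tofrac (a i).
Proof.
have /choice[a /choice[b abP]] : forall i, exists a b, b != 0 /\ u i * tofrac b = tofrac a.
  by move=> i; apply: fraction_denominator.
exists (\prod_i b i), (fun i => a i * \prod_(j | j != i) b j); split.
  by apply/prodf_neq0 => i _; case: (abP i).
move=> i; rewrite (bigD1 i) //= !rmorphM mulrA; case: (abP i) => _ ->.
by [].
Qed.

(** More rows than columns force a left kernel over the fraction field; clearing denominators brings
    a vector of it back to [D]. *)
Lemma wide_kernel (D : idomainType) (I J : finType) (M : I -> J -> D) : (#|J| < #|I|)%N ->
  exists r : I -> D, (exists i, r i != 0) /\ forall j, \sum_i r i * M i j = 0.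
Proof.
move=> ltJI.
pose N := \matrix_(i < #|I|, j < #|J|) (tofrac (M (enum_val i) (enum_val j)) : {fraction D}).
have ker0 : kermx N != 0.
  rewrite -mxrank_eq0 mxrank_ker -lt0n subn_gt0.
  by apply: leq_ltn_trans ltJI; apply: rank_leq_col.
pose v := nz_row (kermx N).
have v0 : v != 0 by rewrite nz_row_eq0.
have vN : v *m N = 0 by apply/sub_kermxP; apply: nz_row_sub.
have [d [a [d0 aP]]] := fraction_common_denominator (fun i => v 0 (enum_rank i)).
have td0 : tofrac d != 0 by rewrite tofrac_eq0.
exists a; split.
  have /rV0Pn[i vi] : v != 0 by [].
  exists (enum_val i); rewrite -tofrac_eq0 -aP enum_valK mulf_neq0 //.
move=> j; apply/eqP; rewrite -tofrac_eq0 rmorph_sum; apply/eqP.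
transitivity (tofrac d * (v *m N) 0 (enum_rank j)); last by rewrite vN mxE mulr0.
rewrite mxE mulr_sumr (reindex (@enum_val I I)) /=; last exact/onW_bij/enum_val_bij.
apply: eq_bigr => i _; rewrite mxE rmorphM /= -aP enum_valK enum_rankK mulrA.
by rewrite [_ * v _ _]mulrC.
Qed.

(** Constants are p-th powers, as [k] is algebraically closed, so the first p powers of X span over
    the p-th powers of polynomials. *)
Lemma poly_frobenius_coords (k : closedFieldType) p (P : {poly k}) : p \in [pchar k] ->
  exists R : 'I_p -> {poly k}, P = \sum_i R i ^+ p * 'X^i.
Proof.
move=> charp; have := prime_gt0 (pcharf_prime charp).
have charP : p \in [pchar {poly k}] by rewrite pchar_poly.
have FD (f g : {poly k}) : (f + g) ^+ p = f ^+ p + g ^+ p.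
  by rewrite -!(pFrobenius_autE charP) rmorphD.
case: p charp charP FD => // p charp charP FD _.
elim/poly_ind: P => [|P c [R ->]].
  by exists (fun=> 0); rewrite big1 // => i _; rewrite expr0n mul0r.
have [gamma Eg] : exists gamma : k, gamma ^+ p.+1 = c.
  have [gamma E] := solve_monicpoly (fun i => if i == 0%N then c else 0) (ltn0Sn p).
  exists gamma; rewrite E big_ord_recl /= expr0 mulr1 big1 ?addr0 // => i _.
  by rewrite /= mul0r.
(* Multiplication by X shifts the coordinates; the last one returns to position 0 because R^p X^p =
   (R X)^p. *)
exists (fun i => if unlift ord0 i is Some j then R (widen_ord (leqnSn p) j)
                 else R ord_max * 'X + gamma%:P).
rewrite [RHS]big_ord_recl /= unlift_none expr0 mulr1 FD exprMn -polyC_exp Eg.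
rewrite [X in X * 'X]big_ord_recr mulrDl mulr_suml /= -mulrA -exprSr addrAC addrC -!addrA.
rewrite [c%:P + _]addrC; congr (_ + (_ + _)).
by apply: eq_bigr => i _; rewrite liftK -mulrA -exprSr.
Qed.

Section FunctionField.
Variables (k : closedFieldType) (C : curve k) (p : nat).
Hypothesis charp : p \in [pchar k].

Let charC : p \in [pchar C]. Proof. by rewrite (fmorph_pchar (cst C)). Qed.
Let p_gt0 : (0 < p)%N. Proof. exact: prime_gt0 (pcharf_prime charp). Qed.

Let frobD n (F : 'I_n -> C) : (\sum_i F i) ^+ p = \sum_i F i ^+ p.
Proof.
exact: (rmorph_sum (pFrobenius_aut charC)).
Qed.

(** A spanning family of least size is free, since a relation would eliminate one of its members.
    Scalars in k[t] with a denominator [D] take the place of k(t). *)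
Lemma function_field_basis : exists n (ev : {rmorphism {poly k} -> C}) (b : 'I_n -> C),
  [/\ forall P, P != 0 -> ev P != 0,
      forall y, exists D P, D != 0 /\ ev D * y = \sum_i ev (P i) * b i
    & forall P, \sum_i ev (P i) * b i = 0 -> forall i, P i = 0].
Proof.
have [t [t_trans [b bP]]] := curveP C.
have [ev evE] : exists ev : {rmorphism {poly k} -> C}, forall P, ev P = (map_poly (cst C) P).[t].
  by exists (horner_eval t \o map_poly (cst C)).
pose spans n := exists b : 'I_n -> C,
  forall y, exists D P, D != 0 /\ ev D * y = \sum_i ev (P i) * b i.
have exn : exists n, `[< spans n >].
  exists (size b); apply/asboolP; exists (fun i => b`_i) => y.
  have [P [Q [Q0 ->]]] := bP y.
  exists (\prod_(i < size b) Q i), (fun i : 'I_(size b) => P i * \prod_(j < size b | j != i) Q j); split.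
    by apply/prodf_neq0.
  rewrite mulr_sumr; apply: eq_bigr => i _; rewrite mulrA; congr (_ * _).
  rewrite (bigD1 i) //= !rmorphM !evE mulrACA.
  have Qi0 : (map_poly (cst C) (Q i)).[t] != 0 by exact: t_trans.
  move: Qi0; move: (map_poly (cst C) (Q i)).[t] (map_poly (cst C) (P i)).[t] => u v u0.
  by field.
case: (ex_minnP exn) => n /asboolP[c cP] minn; exists n, ev, c; split=> // [P P0|P E i]; first by rewrite evE t_trans.
apply/eqP/negP => /negP Pi0; case: n => [|n] in c cP minn P E i Pi0 *; first by case: i Pi0.
suff /asboolP/minn : spans n by rewrite ltnn.
exists (fun j => c (fintype.lift i j)) => y; have [D [P' [D0 Ey]]] := cP y.
exists (D * P i), (fun j => P' (fintype.lift i j) * P i - P' i * P (fintype.lift i j)).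
split; first by rewrite mulf_neq0.
have Ei : ev (P i) * c i = - \sum_(j < n) ev (P (fintype.lift i j)) * c (fintype.lift i j).
  by apply/eqP; rewrite -addr_eq0; move/eqP: E; rewrite (bigD1_ord i).
rewrite rmorphM mulrAC Ey (bigD1_ord i) //= mulrC mulrDr mulrCA Ei.
rewrite mulrN !mulr_sumr addrC -sumrB; apply: eq_bigr => j _.
by rewrite rmorphB !rmorphM; ring.
Qed.

(* [C] has degree at most [p] over its subfield of [p]-th powers. *)
Lemma frobenius_dependent (v : 'I_p.+1 -> C) :
  exists c : 'I_p.+1 -> C, (exists i, c i != 0) /\ \sum_i c i ^+ p * v i = 0.
Proof.
have [n [ev [b [ev0 span free]]]] := function_field_basis.
have n_gt0 : (0 < n)%N.
  case: n b span free => // b span _; have [D [P [D0]]] := span 1.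
  by rewrite big_ord0 mulr1 => /eqP; rewrite (negPf (ev0 _ D0)).
have /choice[D /choice[P DP]] : forall e : 'I_n * 'I_p.+1, exists D P, D != 0 /\
    ev D * (b e.1 ^+ p * v e.2) = \sum_i ev (P i) * b i by move=> e; apply: span.
(* The factor D^(p - 1) turns the denominator into the p-th power D^p. *)
have /choice[R RP] : forall em : ('I_n * 'I_p.+1) * 'I_n, exists R : 'I_p -> {poly k},
    P em.1 em.2 * D em.1 ^+ p.-1 = \sum_i R i ^+ p * 'X^i.
  by move=> em; apply: poly_frobenius_coords.
(* After extraction of p-th roots the conditions on the coordinates are linear: n p equations in n
   (p + 1) unknowns. *)
pose M (e : 'I_n * 'I_p.+1) (mr : 'I_n * 'I_p) := R (e, mr.1) mr.2.
have [|r [[e0 re0] rM]] := @wide_kernel _ _ _ M.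
  by rewrite !card_prod !card_ord ltn_pmul2l.
exists (fun i => \sum_j ev (r (j, i) * D (j, i)) * b j); split.
  exists e0.2; apply/eqP => /free/(_ e0.1); rewrite -surjective_pairing => /eqP.
  by rewrite mulf_eq0 (negPf re0) /= (negPf (DP e0).1).
transitivity (\sum_e ev (r e) ^+ p * \sum_m ev (P e m * D e ^+ p.-1) * b m).
  under eq_bigr => i _ do rewrite frobD mulr_suml.
  rewrite exchange_big pair_bigA /=; apply: eq_bigr => e _; rewrite -surjective_pairing.
  have -> : \sum_m ev (P e m * D e ^+ p.-1) * b m = ev (D e ^+ p.-1) * \sum_m ev (P e m) * b m.
    by rewrite mulr_sumr; apply: eq_bigr => m _; rewrite rmorphM; ring.
  have Dp : ev (D e) ^+ p = ev (D e ^+ p.-1) * ev (D e).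
    by rewrite -rmorphM -exprSr prednK // rmorphXn.
  by rewrite -(DP e).2 rmorphM !exprMn Dp; ring.
transitivity (\sum_m \sum_(i < p) ev ((\sum_e r e * M e (m, i)) ^+ p * 'X^i) * b m).
  under eq_bigr => e _ do rewrite mulr_sumr.
  rewrite exchange_big /=; apply: eq_bigr => m _.
  under eq_bigr => e _ do rewrite (RP (e, m)) rmorph_sum mulr_suml mulr_sumr.
  rewrite exchange_big /=; apply: eq_bigr => i _.
  transitivity (\sum_e ev ((r e * M e (m, i)) ^+ p * 'X^i) * b m).
    by apply: eq_bigr => e _; rewrite exprMn !rmorphM (rmorphXn ev p (r e)); ring.
  rewrite -mulr_suml -rmorph_sum -mulr_suml; congr (ev (_ * _) * _).
  have charP : p \in [pchar {poly k}] by rewrite pchar_poly.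
  by apply/esym; exact: (rmorph_sum (pFrobenius_aut charP)).
rewrite big1 // => m _; rewrite big1 // => i _.
by rewrite rM expr0n gtn_eqF // mul0r rmorph0 mul0r.
Qed.

Variable x : point C.

(** The valuations of the nonzero terms are distinct modulo p, so no cancellation occurs and the sum
    has the least of them. *)
Lemma val_frobenius_sum (t : C) (c : nat -> C) m : t != 0 -> x t = 1 -> (m <= p)%N ->
    (exists2 i, (i < m)%N & c i != 0) ->
  let f := \sum_(i < m) c i ^+ p * t ^+ i in
  [/\ f != 0, exists i, [/\ (i < m)%N, c i != 0 & x f = x (c i) *+ p + i%:Z]
    & forall i, (i < m)%N -> c i != 0 -> x f <= x (c i) *+ p + i%:Z].
Proof.
move=> t0 xt; have term0 i : c i != 0 -> c i ^+ p * t ^+ i != 0.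
  by move=> ci0; rewrite mulf_neq0 ?expf_neq0.
have xterm i : c i != 0 -> x (c i ^+ p * t ^+ i) = x (c i) *+ p + i%:Z.
  by move=> ci0; rewrite Defs.valM ?expf_neq0 // !Defs.valX // xt natz.
elim: m => [|m IH] le_mp; first by case.
case=> i0 lt_i0 ci0; rewrite /= big_ord_recr /=; set f := \sum_(i < m) _.
have [cm0|cm0] := eqVneq (c m) 0.
  rewrite cm0 expr0n gtn_eqF // mul0r addr0.
  have lt_i0m : (i0 < m)%N.
    by move: lt_i0; rewrite ltnS leq_eqVlt => /predU1P[E|//]; rewrite E cm0 eqxx in ci0.
  have [|f0 [i [lti ci xf]] minf] := IH (ltnW le_mp) _; first by exists i0.
  split=> //; first by exists i; split=> //; apply: ltnW.
  move=> j; rewrite ltnS leq_eqVlt => /predU1P[->|ltj]; first by rewrite cm0 eqxx.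
  exact: minf.
have [[i1 lti1 ci1]|noi] := pselect (exists2 i, (i < m)%N & c i != 0); last first.
  have c0 i : (i < m)%N -> c i = 0.
    by move=> lti; apply/eqP/negP => /negP ci; apply: noi; exists i.
  have -> : f = 0.
    by rewrite /f big1 // => i _; rewrite c0 // expr0n gtn_eqF // mul0r.
  rewrite add0r; split; first exact: term0.
    by exists m; split; rewrite ?xterm.
  move=> j; rewrite ltnS leq_eqVlt => /predU1P[->|ltj]; first by rewrite xterm.
  by rewrite c0 // eqxx.
have [|f0 [i [lti ci xf]] minf] := IH (ltnW le_mp) _; first by exists i1.
have ne : x f != x (c m ^+ p * t ^+ m).
  rewrite xf xterm //; apply/eqP; move: (x (c i)) (x (c m)) => u w E.
  have {}E : (u - w) * p%:Z = m%:Z - i%:Z.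
    rewrite -mulrzz -pmulrn mulrnBl; move: E; move: (u *+ p) (w *+ p) => a b; lia.
  move: E; move: (u - w) => d E; have [d_le0|d_gt0] := leP d 0; nia.
have fg : f + c m ^+ p * t ^+ m != 0 /\
    x (f + c m ^+ p * t ^+ m) = Num.min (x f) (x (c m ^+ p * t ^+ m)).
  case: ltgtP ne => // [lt_fg|lt_gf] _; first by apply: val_add_lt => //; exact: term0.
  by rewrite addrC; apply: val_add_lt => //; exact: term0.
case: fg => fg0 xfg; split=> //.
  rewrite xfg minEle; case: ifP => _.
    by exists i; split=> //; apply: ltnW.
  by exists m; split; rewrite ?xterm.
move=> j; rewrite xfg ge_min ltnS leq_eqVlt => /predU1P[->|ltj] cj.
  by rewrite xterm // lexx orbT.
by rewrite minf.
Qed.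

Lemma derivation_exp (Delta : C -> C) f n : derivation Delta ->
  Delta (f ^+ n) = f ^+ n.-1 * Delta f *+ n.
Proof.
case=> DD DM Dcst; elim: n => [|n IH].
  by rewrite expr0 mulr0n -(rmorph1 (cst C)) Dcst.
case: n IH => [|n] IH; first by rewrite expr1 expr0 mul1r.
by rewrite exprS DM IH /= exprS; ring.
Qed.

(** Derivations kill p-th powers: once f is the sum of a_i^p t^i with a_i in the valuation ring,
    [Delta f] is the sum of i a_i^p t^(i - 1). *)
Lemma derivation_valring (t : C) (Delta : C -> C) f : t != 0 -> x t = 1 ->
    derivation Delta -> Delta t = 1 -> f \in in_valring x ->
  Delta f \in in_valring x.
Proof.
move=> t0 xt derD Dt1 xf; have [DD DM Dcst] := derD.
have D0 : Delta 0 = 0 by rewrite -[in LHS](rmorph0 (cst C)) Dcst.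
have [->|f0] := eqVneq f 0; first by rewrite D0 rpred0.
(* The p + 1 elements 1, t, ..., t^(p - 1), f are dependent over the p-th powers. *)
pose v (i : 'I_p.+1) := if unlift ord_max i is Some j then t ^+ j else f.
have [c [[i0 ci0]]] := frobenius_dependent v.
pose c' i := c (inord i).
rewrite big_ord_recr /= => E.
have {}E : (\sum_(i < p) c' i ^+ p * t ^+ i) + c ord_max ^+ p * f = 0.
  rewrite -[RHS]E /v unlift_none; congr (_ + _); apply: eq_bigr => i _.
  have -> : widen_ord (leqnSn p) i = fintype.lift ord_max i by apply: val_inj; rewrite /= /bump leqNgt ltn_ord.
  rewrite liftK; congr (c _ ^+ _ * _); apply: val_inj.
  by rewrite /= inordK ?(ltn_trans (ltn_ord i)) // /bump leqNgt ltn_ord.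
(* Otherwise the powers of t alone would be dependent, which their valuations forbid. *)
have cp0 : c ord_max != 0.
  apply/eqP => cp0; move: E; rewrite cp0 expr0n gtn_eqF // mul0r addr0.
  suff exc : exists2 i, (i < p)%N & c' i != 0.
    by have [/eqP] := val_frobenius_sum t0 xt (leqnn p) exc.
  exists (i0 : nat); last by rewrite /c' inord_val.
  have := ltn_ord i0; rewrite ltnS leq_eqVlt => /predU1P[Ei|//].
  by move: ci0; rewrite (_ : i0 = ord_max) ?cp0 ?eqxx //; apply: val_inj.
pose a i := - (c' i / c ord_max).
have Ef : f = \sum_(i < p) a i ^+ p * t ^+ i.
  have cpp0 : c ord_max ^+ p != 0 by rewrite expf_neq0.
  apply: (mulfI cpp0); move/eqP: E; rewrite addrC addr_eq0 => /eqP ->.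
  rewrite mulr_sumr -sumrN; apply: eq_bigr => i _.
  have -> : a i ^+ p = - (c' i ^+ p / c ord_max ^+ p).
    by rewrite -expr_div_n -!(pFrobenius_autE charC) -rmorphN.
  by rewrite mulrA mulrN mulrCA divff // mulr1 mulNr.
(* No term has smaller valuation than [f]; so p x(a_i) + i >= 0 with i < p, and x(a_i) >= 0. *)
have xa i : (i < p)%N -> a i \in in_valring x.
  move=> lti; rewrite inE; case: eqVneq => //= ai0.
  have exa : exists2 i, (i < p)%N & a i != 0 by exists i.
  have [_ _ /(_ i lti ai0)] := val_frobenius_sum t0 xt (leqnn p) exa.
  rewrite -Ef => le_i; move: xf; rewrite inE (negPf f0) /= => xf.
  have := le_trans xf le_i; rewrite pmulrn mulrzz.
  move: (x (a i)) => u; case: (leP 0 u) => // u_lt0; nia.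
rewrite Ef; have D_sum n (F : 'I_n -> C) : Delta (\sum_i F i) = \sum_i Delta (F i).
  by apply: (big_morph Delta) => //.
rewrite D_sum rpred_sum // => i _.
rewrite DM (derivation_exp (a i) p derD) (derivation_exp t i derD) Dt1 mulr1.
rewrite (mulrn_pchar charC) mul0r addr0 mulrnAr rpredMn // rpredM ?rpredX ?xa //.
by rewrite inE xt orbT.
Qed.

End FunctionField.

(** * Local structure of the surface *)

Lemma qpoly_domain (K : fieldType) (h : {poly K}) (a b : {poly %/ h}) :
  h \is monic -> irreducible_poly h -> a * b = 0 -> a = 0 \/ b = 0.
Proof.
move=> mon irr ab0; have h_gt1 : (1 < size h)%N by case: irr.
have Eh : mk_monic h = h by rewrite /mk_monic h_gt1 mon.
have small (c : {poly %/ h}) : h %| (c : {poly K}) -> c = 0.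
  move=> dvd_c; apply: val_inj => /=; apply/eqP; apply/negPn/negP => c0.
  by have := dvdp_leq c0 dvd_c; rewrite leqNgt -{2}Eh size_mk_monic.
have : h %| (a : {poly K}) * (b : {poly K}).
  have : Pdiv.Ring.rmodp ((a : {poly K}) * (b : {poly K})) (mk_monic h) = 0.
    by rewrite -poly_of_qpolyM ab0.
  move: (a : {poly K}) (b : {poly K}) => u v.
  by rewrite Eh /dvdp Pdiv.IdomainMonic.modpE // => /eqP.
have [cop|ncop] := boolP (coprimep h a).
  by rewrite Gauss_dvdpr // => /small; right.
left; apply: small; have [_ irr2] := irr.
have sg : size (gcdp h a) != 1%N by [].
have /andP[_ dvd_h] := irr2 _ sg (dvdp_gcdl _ _).
exact: dvdp_trans dvd_h (dvdp_gcdr _ _).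
Qed.

Local Notation widen := (widen_ord (leqnSn _)).

Lemma muni_eq0 (R : comNzRingType) n (P : {mpoly R[n.+1]}) : muni P = 0 -> P = 0.
Proof.
move=> P0; apply/mpolyP => m; rewrite mcoeff0.
pose m' := [multinom m (widen i) | i < n].
have : (muni P)`_(m ord_max)@_m' = 0 by rewrite P0 coef0 mcoeff0.
rewrite muniE coef_sum raddf_sum /=.
have Em m2 : (P@_m2 *: 'X_[[multinom m2 (widen i) | i < n]] *: 'X^(m2 ord_max))`_(m ord_max)@_m'
    = P@_m2 * (m2 == m)%:R.
  rewrite coefZ coefXn; case: eqP => [Emax|ne_max]; last first.
    rewrite mulr0 mcoeff0; case: eqP => [E|]; last by rewrite mulr0.
    by case: ne_max; rewrite E.
  rewrite mulr1 mcoeffZ mcoeffX; congr (_ * (_ : bool)%:R).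
  apply/eqP/eqP => [/mnmP E|->//]; apply/mnmP => i.
  have [->//|ne_i] := eqVneq i ord_max.
  have lti : (i < n)%N.
    by have := ltn_ord i; rewrite ltnS leq_eqVlt => /predU1P[Ei|//]; case/eqP: ne_i; apply: val_inj.
  have := E (Ordinal lti); rewrite !mnmE.
  by have -> : widen (Ordinal lti) = i by apply: val_inj.
under eq_bigr do rewrite Em.
have [supp|nsupp] := boolP (m \in msupp P); last by move=> _; apply: memN_msupp_eq0.
rewrite (bigD1_seq m) //= eqxx mulr1 big1 ?addr0 // => m2 ne.
by rewrite (negPf ne) mulr0.
Qed.

(** In the degrees of both sides, only that of [B ^+ d] is not visibly a multiple of [l]. *)
Lemma dvdn_degree_exp (R : comNzRingType) (T : idomainType) (mu : {rmorphism R -> {poly T}})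
    (B N D : R) l d : mu B != 0 -> mu D != 0 -> N ^+ l = B ^+ d * D ^+ l ->
  (l %| (size (mu B)).-1 * d)%N.
Proof.
move=> B0 D0 /(congr1 mu); rewrite rmorphM !rmorphXn => /(congr1 (fun f : {poly T} => (size f).-1)).
have Bd0 := expf_neq0 d B0; have Dl0 := expf_neq0 l D0.
rewrite size_mul // (polySpred Bd0) (polySpred Dl0) addSn addnS /= !size_exp => E.
have : (l %| (size (mu B)).-1 * d + (size (mu D)).-1 * l)%N by rewrite -E dvdn_mull.
by rewrite dvdn_addl // dvdn_mull.
Qed.

(** Under [muni] X_0 becomes a constant and X_1 the variable, so the form in brackets has degree
    p. *)
Lemma mpoly_X1_degree (K : fieldType) (a f : K) p l d (N D : {mpoly K[2]}) :
    D != 0 -> a != 0 -> (0 < p)%N ->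
    N ^+ l = (a *: ('X_0 * ('X_1 ^+ p - f *: 'X_0 ^+ p))) ^+ d * D ^+ l ->
  (l %| d * p)%N.
Proof.
move=> D0 a0 p0 E; pose B : {mpoly K[2]} := a *: ('X_0 * ('X_1 ^+ p - f *: 'X_0 ^+ p)).
have muniX i : muni 'X_i = 'X_[[multinom (U_(i)%MM : 'X_{1..2}) (widen j) | j < 1]] *: 'X^(i == ord_max)
    :> {poly {mpoly K[1]}}.
  by rewrite muniE msuppX big_seq1 mcoeffX eqxx scale1r mnmE.
have [c c0 muniX0] : exists2 c : {mpoly K[1]}, c != 0 & muni 'X_0 = c%:P :> {poly {mpoly K[1]}}.
  eexists; last by rewrite muniX expr0 alg_polyC.
  by rewrite -msupp_eq0 msuppX.
have muniX1 : muni 'X_1 = 'X :> {poly {mpoly K[1]}}.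
  rewrite muniX (_ : [multinom _ | _ < _] = 0%MM) ?mpolyX0 ?scale1r //.
  by apply/mnmP => -[[|//] lt_j]; rewrite mnmE mnm1E mnm0E.
have muni_neq0 (g : {mpoly K[2]}) : g != 0 -> muni g != 0 by apply: contra_neq => /muni_eq0.
have szB : (size (muni B)).-1 = p.
  rewrite muniZ muniM muniB muniZ !rmorphXn /= muniX0 muniX1 -polyC_exp -[_ *: (_)%:P]mul_polyC -polyCM.
  by rewrite size_scale ?mpolyC_eq0 // size_Cmul // size_XnsubC.
have B0 : B != 0.
  by apply/eqP => B0; move: p0; rewrite -szB B0 muni0 size_poly0.
rewrite mulnC -szB.
exact: (dvdn_degree_exp (mu := @muni 1 K) (muni_neq0 _ B0) (muni_neq0 _ D0) E).
Qed.

(** * Localizations of subrings *)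

Section LocalizationMorphism.
Variables (W T S : comNzRingType) (Theta : {rmorphism W -> T}).
Variables (B P : T -> Prop) (phi : T -> S).
Hypotheses (loc : is_localization B P phi) (prP : prime_in B P).
Hypothesis Theta_B : forall w, B (Theta w).

(** [phi] respects the operations on [B] only; composed with a morphism into [B] it becomes a ring
    morphism. *)
Definition loc_morphism w := phi (Theta w).

Lemma loc_morphism_zmod : zmod_morphism loc_morphism.
Proof.
have [[phi1 phiD phiM] _ _ _] := loc.
move=> w v; apply: (addIr (loc_morphism v)); rewrite subrK /loc_morphism.
by rewrite -phiD // -rmorphD subrK.
Qed.

Lemma loc_morphism_monoid : monoid_morphism loc_morphism.
Proof.
have [[phi1 phiD phiM] _ _ _] := loc.
by split=> [|w v]; rewrite /loc_morphism ?rmorph1 // rmorphM phiM.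
Qed.

HB.instance Definition _ := GRing.isZmodMorphism.Build W S loc_morphism loc_morphism_zmod.
HB.instance Definition _ := GRing.isMonoidMorphism.Build W S loc_morphism loc_morphism_monoid.

Lemma loc_prime : prime_ideal (fun w => P (Theta w)).
Proof.
have [_ [P0 P1] PD PM Ppr] := prP; split=> //; first by rewrite rmorph0 rmorph1.
- by move=> a b Pa Pb; rewrite rmorphD; apply: PD.
- by move=> a b _ Pb; rewrite rmorphM; apply: PM.
- by move=> a b _ _; rewrite rmorphM; apply: Ppr.
Qed.

Lemma loc_morphism_eq0 w : (forall s t : T, s * t = 0 -> s = 0 \/ t = 0) ->
  loc_morphism w = 0 <-> Theta w = 0.
Proof.
move=> domT; have [_ _ _ phi0] := loc; have [_ [P0 _] _ _ _] := prP.
rewrite phi0 //; split=> [[b [Bb nPb /domT[b0|//]]]|->]; first by case: nPb; rewrite b0.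
exists 1; rewrite mulr0; split=> //; first by rewrite -(rmorph1 Theta).
by case: prP => _ [].
Qed.

(** An inverse in [S] is a fraction over [B], hence over the values of [Theta]; clearing
    denominators puts a product of elements outside [P] into [P]. *)
Lemma loc_morphism_nonunit w : (forall s t : T, s * t = 0 -> s = 0 \/ t = 0) ->
    (forall z, B z -> exists v u, ~ P (Theta v) /\ z * Theta v = Theta u) ->
  nonunit (loc_morphism w) <-> P (Theta w).
Proof.
move=> domT fracB; have [[phi1 phiD phiM] unitB fracS _] := loc.
have prW := loc_prime; have [_ [P0 P1] PD PM Ppr] := prP.
split=> [nw|Pw [s ws]]; first by apply: contrapT => nPw; apply: unitB nw.
have [a [b [Ba Bb nPb E]]] := fracS s.
have [v [u [nPv Ev]]] := fracB a Ba; have [v' [u' [nPv' Ev']]] := fracB b Bb.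
have : loc_morphism (w * u * v' - u' * v) = 0.
  have Lu : loc_morphism u = s * phi b * loc_morphism v by rewrite E -phiM // Ev.
  have Lu' : loc_morphism u' = phi b * loc_morphism v' by rewrite -phiM // Ev'.
  rewrite rmorphB !rmorphM /= Lu Lu'.
  transitivity ((loc_morphism w * s - 1) * (phi b * loc_morphism v * loc_morphism v')); first by ring.
  by rewrite [loc_morphism w * s]ws subrr mul0r.
move/(loc_morphism_eq0 _ domT) => /(congr1 P) E0.
have : P (Theta (u' * v)).
  have idW := prime_ideal_ideal prW.
  have -> : u' * v = w * u * v' - (w * u * v' - u' * v) by ring.
  apply: (idealB idW); last by rewrite E0.
  by rewrite -mulrA mulrC; case: idW => _ _; apply.
rewrite rmorphM => /Ppr -/(_ (Theta_B _) (Theta_B _))[|//].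
by rewrite -Ev' => /Ppr -/(_ Bb (Theta_B _))[].
Qed.

Lemma loc_morphism_frac :
    (forall z, B z -> exists v u, ~ P (Theta v) /\ z * Theta v = Theta u) ->
  forall s, exists a b, ~ nonunit (loc_morphism b) /\ s * loc_morphism b = loc_morphism a.
Proof.
move=> fracB s; have [[phi1 phiD phiM] unitB fracS _] := loc; have [_ _ _ _ Ppr] := prP.
have [a [b [Ba Bb nPb E]]] := fracS s.
have [v [u [nPv Ev]]] := fracB a Ba; have [v' [u' [nPv' Ev']]] := fracB b Bb.
exists (u * v'), (u' * v); split.
  rewrite rmorphM; apply: unit_mul; last exact: unitB.
  apply: unitB => //; rewrite -Ev' => /Ppr -/(_ Bb (Theta_B _))[] //.
have Lu : loc_morphism u = s * phi b * loc_morphism v by rewrite E -phiM // Ev.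
have Lu' : loc_morphism u' = phi b * loc_morphism v' by rewrite -phiM // Ev'.
by rewrite !rmorphM /= Lu Lu'; ring.
Qed.

Lemma loc_local :
    (forall s t : T, s * t = 0 -> s = 0 \/ t = 0) ->
    (forall z, B z -> exists v u, ~ P (Theta v) /\ z * Theta v = Theta u) ->
  (forall s t : S, nonunit s -> nonunit t -> nonunit (s + t)) /\
  (forall s t : S, s * t = 0 -> s = 0 \/ t = 0).
Proof.
move=> domT fracB; have nonunitE w := loc_morphism_nonunit w domT fracB.
have eq0E w := loc_morphism_eq0 w domT.
have idW := prime_ideal_ideal loc_prime; have [_ PD _] := idW.
have unit_can s v : ~ nonunit (loc_morphism v) -> nonunit (s * loc_morphism v) -> nonunit s.
  by move=> uv; apply: contrapT => H; apply: H => nsv; apply: contrapT => us; apply: (unit_mul us uv).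
split=> s t.
  have [a [b [ub E]]] := loc_morphism_frac fracB s.
  have [a' [b' [ub' E']]] := loc_morphism_frac fracB t.
  move=> ns nt; apply: (unit_can _ (b * b')); first by rewrite rmorphM; apply: unit_mul.
  have -> : (s + t) * loc_morphism (b * b') = loc_morphism (a * b' + a' * b).
    by rewrite rmorphD !rmorphM /= -E -E'; ring.
  apply/nonunitE; apply: PD; apply/nonunitE; rewrite rmorphM /=.
    by rewrite -E mulrC; apply: nonunitMl; rewrite mulrC; apply: nonunitMl.
  by rewrite -E' mulrC; apply: nonunitMl; rewrite mulrC; apply: nonunitMl.
have [a [b [/contrapT[c bc] E]]] := loc_morphism_frac fracB s.
have [a' [b' [/contrapT[c' bc'] E']]] := loc_morphism_frac fracB t.
move=> st0; have : loc_morphism (a * a') = 0.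
  by rewrite rmorphM /= -E -E' mulrACA st0 mul0r.
have inj0 (u w z : S) : z * w = 1 -> u * z = 0 -> u = 0.
  by move=> zw uz; rewrite -[u]mulr1 -zw mulrA uz mul0r.
move/eq0E; rewrite rmorphM => /domT[] /eq0E; rewrite -?E -?E' => ?; [left|right].
  exact: inj0 bc _. exact: inj0 bc' _.
Qed.

Lemma localization_rmorphism :
    (forall s t : T, s * t = 0 -> s = 0 \/ t = 0) ->
    (forall z, B z -> exists v u, ~ P (Theta v) /\ z * Theta v = Theta u) ->
  exists Phi : {rmorphism W -> S},
  [/\ forall w, Phi w = 0 <-> Theta w = 0,
      forall w, nonunit (Phi w) <-> P (Theta w),
      forall s, exists a b, ~ nonunit (Phi b) /\ s * Phi b = Phi a,
      forall s t : S, nonunit s -> nonunit t -> nonunit (s + t)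
    & forall s t : S, s * t = 0 -> s = 0 \/ t = 0].
Proof.
move=> domT fracB; exists (loc_morphism : {rmorphism W -> S}).
have [locS domS] := loc_local domT fracB.
split=> [w|w|||] //; first exact: loc_morphism_eq0.
  exact: loc_morphism_nonunit.
exact: loc_morphism_frac.
Qed.

End LocalizationMorphism.

(** * Cyclic covers trivialized by a generator *)

Section CyclicCover.
Variables (A : idomainType) (Q : fieldType) (theta : {rmorphism {poly A} -> Q}).
Variables (l : nat) (br w : Q) (b : {poly A}) (M : nat -> Q -> Prop).
Hypotheses (theta_inj : injective theta) (w0 : w != 0) (l_gt0 : (0 < l)%N).
Hypothesis brE : br * w ^+ l = theta b.
Hypothesis irr : irreducible_poly ('X^l - br%:P).

Let h : {poly Q} := 'X^l - br%:P.
Let T := {poly %/ h}.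
Let mon_h : h \is monic. Proof. exact: monicXnsubC. Qed.
Let size_h : size h = l.+1. Proof. exact: size_XnsubC. Qed.
Let Eh : mk_monic h = h. Proof. by rewrite /mk_monic mon_h size_h ltnS l_gt0. Qed.

(** The outer variable goes to [w] times the class of 'X, where [w] is to generate M locally; [brE]
    then turns the equation with [br] into one with coefficient [b] in A[v]. *)
Definition cover_map : {rmorphism {poly {poly A}} -> {poly %/ ('X^l - br%:P)}} :=
  in_qpoly ('X^l - br%:P) \o comp_poly (w *: 'X) \o map_poly theta.

Let comp_coef (v : {poly {poly A}}) i : (map_poly theta v \Po (w *: 'X))`_i = theta v`_i * w ^+ i.
Proof.
have -> : map_poly theta v \Po (w *: 'X) = \poly_(j < size v) (theta v`_j * w ^+ j).
  rewrite comp_polyE size_map_inj_poly ?rmorph0 // poly_def; apply: eq_bigr => j _.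
  by rewrite coef_map exprZn scalerA.
rewrite coef_poly; case: ltnP => // le_i.
by rewrite nth_default ?rmorph0 ?mul0r.
Qed.

Lemma cover_map_coef (v : {poly {poly A}}) i : (size v <= l)%N ->
  (cover_map v : {poly Q})`_i = theta v`_i * w ^+ i.
Proof.
move=> szv; rewrite -comp_coef /cover_map /=; congr (_`_i).
rewrite Pdiv.Ring.rmodp_small // -/h Eh size_h ltnS.
apply/leq_sizeP => j le_j; rewrite comp_coef nth_default ?rmorph0 ?mul0r //.
exact: leq_trans le_j.
Qed.

Lemma cover_map_root : cover_map ('X^l - b%:P) = 0.
Proof.
have E : map_poly theta ('X^l - b%:P) \Po (w *: 'X) = (w ^+ l)%:P * h.
  rewrite rmorphB /= map_polyXn map_polyC rmorphB rmorphXn /= comp_polyX comp_polyC.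
  by rewrite exprZn -brE /h mulrBr mul_polyC -polyCM [br * _]mulrC.
transitivity (in_qpoly h (map_poly theta ('X^l - b%:P) \Po (w *: 'X))); first by [].
have E0 : in_qpoly h h = 0 by apply: val_inj; rewrite /= Eh Pdiv.RingMonic.rmodpp.
by rewrite E rmorphM [X in _ * X]E0 mulr0.
Qed.

Lemma cover_map_inj (v : {poly {poly A}}) : (size v <= l)%N -> cover_map v = 0 -> v = 0.
Proof.
move=> szv v0; apply/polyP => i; rewrite coef0; apply: theta_inj; rewrite rmorph0.
apply: (mulIf (expf_neq0 i w0)); rewrite mul0r -cover_map_coef // v0.
by rewrite coef0.
Qed.

Lemma cover_mapC (beta : {poly A}) (z : {poly %/ ('X^l - br%:P)}) i :
  (z * cover_map beta%:P : {poly %/ ('X^l - br%:P)})`_i = (z : {poly Q})`_i * theta beta.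
Proof.
have -> : cover_map beta%:P = theta beta *: 1.
  transitivity (in_qpoly h (map_poly theta beta%:P \Po (w *: 'X))); first by [].
  by rewrite map_polyC comp_polyC -(alg_polyC (theta beta)) in_qpolyZ in_qpoly1.
by rewrite mulrC -scalerAl mul1r poly_of_qpolyZ coefZ mulrC.
Qed.

Let B (z : {poly %/ ('X^l - br%:P)}) := forall i, (i < l)%N -> M i (z : {poly Q})`_i.

Hypothesis M_theta : forall i r, M i (theta r * w ^+ i).
Hypothesis M_frac : forall i z, (i < l)%N -> M i z -> exists beta alpha,
  z * theta beta = theta alpha * w ^+ i /\ exists gamma, M 0 gamma /\ gamma * theta beta = 1.

Lemma cover_map_in v : B (cover_map v).
Proof.
have -> : cover_map v = cover_map (Pdiv.Ring.rmodp v ('X^l - b%:P)).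
  rewrite [v in LHS](Pdiv.RingMonic.rdivp_eq (monicXnsubC b l_gt0)) rmorphD rmorphM.
  by rewrite cover_map_root mulr0 add0r.
move=> i lti; rewrite cover_map_coef //.
by rewrite -ltnS -(size_XnsubC b l_gt0) Pdiv.Ring.ltn_rmodp -size_poly_eq0 size_XnsubC.
Qed.

Variable P : {poly %/ ('X^l - br%:P)} -> Prop.
Hypothesis prP : prime_in B P.

(** [gamma], placed in degree zero, is an inverse inside [B], so a proper ideal cannot contain the
    element. *)
Lemma cover_map_unit beta : (exists gamma, M 0 gamma /\ gamma * theta beta = 1) ->
  ~ P (cover_map beta%:P).
Proof.
have [PB [P0 P1] PD PM _] := prP => -[gamma [Mg g1]] Pb; apply: P1.
pose z : {poly %/ ('X^l - br%:P)} := gamma *: 1.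
have zc i : (z : {poly Q})`_i = gamma * (i == 0%N)%:R.
  by rewrite poly_of_qpolyZ coefZ -[(1 : T)]/(qpoly1 h) /= coefC; case: i.
have -> : 1 = z * cover_map beta%:P.
  apply: val_inj; apply/polyP => i; rewrite [RHS]cover_mapC zc mulrAC g1 mul1r.
  by rewrite /= coefC; case: i.
apply: PM => // i lti; rewrite zc; case: i lti => [|i] lti; first by rewrite mulr1.
by rewrite mulr0 -(mul0r (w ^+ i.+1)) -(rmorph0 theta); apply: M_theta.
Qed.

(** The components have denominators of their own; the product of these is a common one, outside [P]
    by primality. *)
Lemma cover_map_frac z : B z -> exists v u, ~ P (cover_map v) /\ z * cover_map v = cover_map u.
Proof.
move=> Bz; have /choice[beta /choice[alpha E]] : forall i : 'I_l, exists beta alpha,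
    (z : {poly Q})`_i * theta beta = theta alpha * w ^+ i /\
    exists gamma, M 0 gamma /\ gamma * theta beta = 1.
  by move=> i; apply: M_frac => //; apply: Bz.
pose bt := \prod_i beta i.
pose u := \poly_(i < l) (if insub i is Some i' then alpha i' * \prod_(j | j != i') beta j else 0).
exists bt%:P, u; split.
  rewrite /bt rmorph_prod rmorph_prod; case: (prP) => _ [P0 P1] _ _ Ppr.
  suff H (s : seq 'I_l) : ~ P (\prod_(i <- s) cover_map (beta i)%:P) by apply: H.
  elim: s => [|i s IH]; rewrite ?big_nil // big_cons => /Ppr.
  case=> [|||//]; first exact: cover_map_in.
    by rewrite -rmorph_prod; exact: cover_map_in.
  by apply: cover_map_unit; case: (E i).
apply: val_inj; apply/polyP => i; rewrite [LHS]cover_mapC.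
have szu : (size u <= l)%N by apply: size_poly.
rewrite [RHS]cover_map_coef // coef_poly.
case: ltnP => [lti|le_i]; last first.
  rewrite rmorph0 mul0r nth_default ?mul0r // (leq_trans _ le_i) //.
  by rewrite -ltnS -size_h -[in X in (_ < X)%N]Eh; apply: size_mk_monic.
have [Ei _] := E (Ordinal lti).
rewrite insubT /= /bt (bigD1 (Ordinal lti)) //= !rmorphM mulrA Ei.
by rewrite mulrAC.
Qed.

Lemma cyclic_cover_stalk (S : comNzRingType) (phi : {poly %/ ('X^l - br%:P)} -> S) :
    is_localization B P phi ->
  exists Phi : {rmorphism {poly {poly A}} -> S},
  [/\ Phi ('X^l - b%:P) = 0,
      forall v : {poly {poly A}}, (size v <= l)%N -> Phi v = 0 -> v = 0,
      forall s, exists a c, ~ nonunit (Phi c) /\ s * Phi c = Phi a,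
      (forall s t : S, nonunit s -> nonunit t -> nonunit (s + t)) /\
      (forall s t : S, s * t = 0 -> s = 0 \/ t = 0)
    & forall beta, (exists gamma, M 0 gamma /\ gamma * theta beta = 1) ->
        ~ nonunit (Phi beta%:P)].
Proof.
move=> loc; have domT (s t : T) : s * t = 0 -> s = 0 \/ t = 0 by apply: qpoly_domain.
have [Phi [Phi0 PhiN Phif locS domS]] := localization_rmorphism loc prP cover_map_in domT cover_map_frac.
exists Phi; split=> // [|v szv /Phi0|beta /cover_map_unit nP /PhiN//].
- by apply/Phi0; exact: cover_map_root.
- exact: cover_map_inj.
Qed.

End CyclicCover.

(** * Affine charts of the projective bundle *)

Section Forms.
Variable K : fieldType.
Local Notation Q := {fraction {mpoly K[2]}}.

Definition fconst : {rmorphism K -> Q} := @FracField.tofrac {mpoly K[2]} \o @mpolyC 2 K.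

Lemma fconstZ (a : K) (f : {mpoly K[2]}) :
  FracField.tofrac (a *: f) = fconst a * FracField.tofrac f.
Proof. by rewrite -mul_mpolyC tofracM. Qed.

(** On forms this is division by a power of [n]; as a substitution it is a ring morphism. *)
Definition dehomog (n : Q) : {rmorphism {mpoly K[2]} -> Q} :=
  mmap fconst (fun i => tofrac 'X_i / n).

Lemma dehomogE (n : Q) (a : {mpoly K[2]}) i :
  a \is i.-homog -> dehomog n a = tofrac a / n ^+ i.
Proof.
move=> /dhomogP homa; rewrite /dehomog /= /mmap [in RHS](mpolyE a) rmorph_sum mulr_suml.
apply: eq_big_seq => m /homa Em.
rewrite -mul_mpolyC rmorphM -mulrA; congr (_ * _).
have {}Em : mdeg m = i := Em.
rewrite mpolyXE_id rmorph_prod -Em mdegE expr_sum -prodfV -big_split /=.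
by apply: eq_bigr => j _; rewrite rmorphXn /= expr_div_n.
Qed.

End Forms.

Lemma linformD (k : closedFieldType) (C : curve k) (a b : C) (v u : C * C) :
  linform (a * v.1 + b * u.1, a * v.2 + b * u.2) = a *: linform v + b *: linform u :> {mpoly C[2]}.
Proof. by rewrite /linform /= !scalerDl !scalerDr !scalerA addrACA. Qed.

Lemma linform_homog (k : closedFieldType) (C : curve k) (v : C * C) : linform v \is 1.-homog.
Proof. by rewrite /linform rpredD // rpredZ // dhomogX /= mdeg1. Qed.

Section Chart.
Variables (k : closedFieldType) (C : curve k) (D : divisor C) (c : point C -> C).
Variables (x : point C) (q : {mpoly C[2]} -> Prop).
Hypothesis qP : Proj_point D c x q.
Variables (vN vM : C * C) (h0 h1 : {poly C}).
Hypotheses (EvN : EE D c x vN) (EvM : EE D c x vM).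
Hypothesis EE_span : forall v, EE D c x v -> exists a b : valring x,
  v = (valring_val a * vN.1 + valring_val b * vM.1, valring_val a * vN.2 + valring_val b * vM.2).
Hypotheses (hN : vN.1 *: h0 + vN.2 *: h1 = 1) (hM : vM.1 *: h0 + vM.2 *: h1 = 'X).
Hypothesis qN : ~ q (linform vN).

Local Notation Q := {fraction {mpoly (ratfun C)[2]}}.
Local Notation SE := (SE D c x).
Let A := valring x.
Let N : {mpoly C[2]} := linform vN.
Let M : {mpoly C[2]} := linform vM.
Let n : Q := tofrac N.
Let SE_const' (a : A) : SE (valring_val a)%:MP.
Proof. by apply: SE_const; have := valring_valP a; rewrite /OC /= coeff0 oppr0. Qed.

Let SE_X d : SE (N ^+ d).
Proof.
elim: d => [|d IH]; last by rewrite exprS; apply: SE_mul => //; exact: SE_lin.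
by rewrite expr0 -mpolyC1; exact: (SE_const' 1).
Qed.

Let q_prime : prime_in SE q. Proof. by case: qP. Qed.

Let q_X d : ~ q (N ^+ d).
Proof.
elim: d => [|d IH]; first by rewrite expr0; case: q_prime => _ [].
rewrite exprS; case: q_prime => _ _ _ _ pr /pr[] //; exact: SE_lin.
Qed.

Let N0 : N != 0.
Proof. by apply/eqP => N0; apply: qN; rewrite -/N N0; case: q_prime => _ []. Qed.

Let n0 : n != 0. Proof. by rewrite tofrac_eq0. Qed.

(** [linform vN] is outside [q], so the point lies in the chart where this form is invertible; the
    variable goes to the affine coordinate there. *)
Definition chart_map : {rmorphism {poly valring x} -> Q} :=
  horner_eval (tofrac M / n) \o map_poly (fconst C \o (valring_emb x)).

Let chart_mapE al :
  chart_map al = (map_poly (fconst C \o valring_emb x) al).[tofrac M / n].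
Proof. by []. Qed.

Lemma chart_mapC a : chart_map a%:P = fconst C (valring_val a).
Proof. by rewrite chart_mapE map_polyC hornerC. Qed.

Lemma chart_mapX : chart_map 'X = tofrac M / n.
Proof. by rewrite chart_mapE map_polyX hornerX. Qed.

Lemma chart_dehomog a : SE a -> exists alpha, dehomog n a = chart_map alpha.
Proof.
elim=> [{}a xa|v Ev|P P' _ [al E] _ [al' E']|P P' _ [al E] _ [al' E']].
- have va : a \in in_valring x by move: xa; rewrite /OC inE /= coeff0 oppr0.
  by exists (ValRing va)%:P; rewrite chart_mapC /dehomog /= mmapC.
- have [a1 [b1 ->]] := EE_span Ev; exists (a1%:P + b1%:P * 'X).
  rewrite (dehomogE _ (linform_homog _)) linformD expr1 -/N -/M.
  rewrite [RHS]rmorphD [chart_map (_ * 'X)]rmorphM !chart_mapC chart_mapX.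
  by rewrite tofracD !fconstZ mulrDl mulfK // mulrA.
- by exists (al + al'); rewrite !rmorphD E E'.
- by exists (al * al'); rewrite !rmorphM E E'.
Qed.

(** Homogenization, inverse to [chart_dehomog] up to a power of [n]. *)
Lemma chart_homog (al : {poly valring x}) : exists d H,
  [/\ SE H, H \is d.-homog, tofrac H = n ^+ d * chart_map al
    & al != 0 -> H != 0].
Proof.
(* [h0] and [h1] are the values of 'X_0 and 'X_1 when the two basis forms are set to 1 and 'X; this
   evaluation recovers [al] from [H], whence [H] is nonzero. *)
pose de : {rmorphism {mpoly C[2]} -> {poly C}} := mmap polyC (fun i => if i == 0 then h0 else h1).
have deC a : de a%:MP = a%:P by rewrite /de /= mmapC.
have deL v : de (linform v) = v.1 *: h0 + v.2 *: h1.
  rewrite /linform rmorphD -!mul_mpolyC !rmorphM !deC !mul_polyC; congr (_ *: _ + _ *: _).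
    by rewrite /de /= mmapX mmap1U.
  by rewrite /de /= mmapX mmap1U.
have deN : de N = 1 by rewrite deL.
have deM : de M = 'X by rewrite deL.
suff [d [H [SH homH EH dH]]] : exists d H, [/\ SE H, H \is d.-homog,
    tofrac H = n ^+ d * chart_map al & de H = map_poly (valring_emb x) al].
  exists d, H; split=> //; apply: contra_neq => H0; move: dH; rewrite H0 rmorph0 => E.
  apply/polyP => i; rewrite coef0; apply: val_inj.
  by have := congr1 (fun f : {poly C} => f`_i) E; rewrite coef0 coef_map.
elim/poly_ind: al => [|al a [d [H [SH homH EH dH]]]].
  exists 0%N, 0; rewrite !rmorph0 mulr0; split=> //; last exact: dhomog0.
  by rewrite -mpolyC0; exact: (SE_const' 0).
exists d.+1, (H * M + (valring_val a)%:MP * N ^+ d.+1); split.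
- by apply: SE_add; apply: SE_mul => //; exact: SE_lin.
- rewrite rpredD //; first by rewrite -(addn1 d); apply: dhomogM => //; exact: linform_homog.
  rewrite mul_mpolyC rpredZ //.
  by have := dhomogMn d.+1 (linform_homog vN); rewrite mul1n.
- rewrite tofracD 2!tofracM tofracXn EH -/n [chart_map (_ + _)]rmorphD [chart_map (_ * 'X)]rmorphM chart_mapC chart_mapX.
  have aux (F : fieldType) (r s t m : F) : m != 0 ->
      m ^+ d * r * t + s * m ^+ d.+1 = m ^+ d.+1 * (r * (t / m) + s).
    by move=> m0; rewrite exprS; field.
  exact: aux n0.
- rewrite [de (_ + _)]rmorphD ![de (_ * _)]rmorphM [de (N ^+ _)]rmorphXn deN deM dH deC expr1n mulr1.
  have aux (R1 R2 : comNzRingType) (f : {rmorphism R1 -> R2}) (r : {poly R1}) e :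
      map_poly f (r * 'X + e%:P) = map_poly f r * 'X + (f e)%:P.
    by rewrite rmorphD rmorphM /= map_polyX map_polyC.
  by rewrite aux.
Qed.

Lemma chart_map_inj : injective chart_map.
Proof.
move=> r r' E; apply/eqP; rewrite -subr_eq0; apply/negPn/negP => nz.
have [d [H [_ _ EH H0]]] := chart_homog (r - r').
have := H0 nz; rewrite -tofrac_eq0 EH rmorphB E subrr mulr0 eqxx //.
Qed.

Lemma chart_OP_theta r m : OP D c (- m%:Z) x q (chart_map r / n ^+ m).
Proof.
have [d [H [SH homH EH _]]] := chart_homog r.
exists d, (d + m)%N, H, (N ^+ (d + m)); split=> //.
- split; first exact: SE_X.
  by have := dhomogMn (d + m) (linform_homog vN); rewrite mul1n.
- by rewrite PoszD opprD addNKr.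
- rewrite EH tofracXn exprD -/n.
  have aux (F : fieldType) (u v w : F) : u != 0 -> w != 0 -> v / w = u * v / (u * w).
    by move=> u0 w0; rewrite -mulf_div divff // mul1r.
  by apply: aux; rewrite expf_neq0.
Qed.

Lemma chart_unit_OP d (H : {mpoly C[2]}) be : SE H -> H \is d.-homog -> ~ q H ->
    tofrac H = n ^+ d * chart_map be ->
  exists g, OP D c (- 0%N%:Z) x q g /\ g * chart_map be = 1.
Proof.
move=> SH homH qH EH.
have H0 : H != 0 by apply/eqP => H0; apply: qH; rewrite H0; case: q_prime => _ [].
exists (tofrac (N ^+ d) / tofrac H); split.
  exists d, d, (N ^+ d), H; split; rewrite ?subrr //; split; first exact: SE_X.
  by have := dhomogMn d (linform_homog vN); rewrite mul1n.
have tH0 : tofrac H != 0 by rewrite tofrac_eq0.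
by rewrite mulrAC tofracXn -EH (divff tH0).
Qed.

Lemma chart_OP_frac z m : OP D c (- m%:Z) x q z -> exists be al,
  z * chart_map be = chart_map al / n ^+ m /\
  exists g, OP D c (- 0%N%:Z) x q g /\ g * chart_map be = 1.
Proof.
case=> i [j [a [b [[Sa homa] [Sb homb] qb Em Ez]]]].
have [al Ea] := chart_dehomog Sa; have [be Eb] := chart_dehomog Sb.
have {}Ea : tofrac a = n ^+ i * chart_map al.
  by rewrite -Ea (dehomogE _ homa) mulrC divfK ?expf_neq0.
have {}Eb : tofrac b = n ^+ j * chart_map be.
  by rewrite -Eb (dehomogE _ homb) mulrC divfK ?expf_neq0.
have Ej : j = (i + m)%N by apply/eqP; rewrite -eqz_nat PoszD; lia.
have [g [Og g1]] := chart_unit_OP Sb homb qb Eb.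
exists be, al; split; last by exists g.
have be0 : chart_map be != 0.
  by apply: contra_eq_neq g1 => ->; rewrite mulr0 eq_sym oner_eq0.
rewrite Ez Ea Eb Ej exprD.
have aux (F : fieldType) (u v w y : F) : u != 0 -> w != 0 -> y != 0 ->
    u * v / (u * w * y) * y = v / w.
  by move=> u0 w0 y0; rewrite -[u * w * y]mulrA -mulf_div divff // mul1r invfM mulrA divfK.
exact: aux (expf_neq0 _ n0) (expf_neq0 _ n0) be0.
Qed.

(* Twisting by [F]: [nu] generates [O_C(F)] at [x]. *)
Lemma chart_OPC_theta r m F nu : nu != 0 -> x nu = - coeff x F ->
  OPC D c (- m%:Z) F x q (chart_map r * (fconst C nu / n ^+ m)).
Proof.
move=> nu0 xnu; exists nu, (chart_map r / n ^+ m); split; last by rewrite mulrCA.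
  by rewrite /OC /= xnu lexx orbT.
exact: chart_OP_theta.
Qed.

Lemma chart_OPC_frac z m F nu : nu != 0 -> x nu = - coeff x F ->
    OPC D c (- m%:Z) F x q z -> exists be al,
  z * chart_map be = chart_map al * (fconst C nu / n ^+ m) /\
  exists g, OP D c (- 0%N%:Z) x q g /\ g * chart_map be = 1.
Proof.
move=> nu0 xnu [f [u [Ff Ou ->]]]; have [be [al [E G]]] := chart_OP_frac Ou.
have vf : f / nu \in in_valring x.
  rewrite inE; move: Ff; rewrite /OC /=; have [->|f0] := eqVneq f 0.
    by rewrite mul0r eqxx.
  move=> /= xf; rewrite Defs.valM ?invr_eq0 // Defs.valV // xnu opprK -lerBlDr sub0r.
  by rewrite xf orbT.
exists be, (al * (ValRing vf)%:P); split=> //.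
rewrite -mulrA E [chart_map (_ * _)]rmorphM chart_mapC /=.
have Ef : f = f / nu * nu by rewrite divfK.
rewrite {1}Ef -[FracField.tofrac _]/(fconst C (f / nu * nu)) rmorphM.
have aux (F' : fieldType) (r s t y : F') : r * s * (t * y) = t * r * (s * y) by ring.
exact: aux.
Qed.

End Chart.

(** * Equations of the stalks of the Raynaud surface *)

Section RaynaudStalk.
Variables (k : closedFieldType) (C : curve k) (p : nat) (R : raynaud_datum C p).
Hypothesis charp : p \in [pchar k].

Local Notation Q := {fraction {mpoly (ratfun C)[2]}}.
Local Notation D := (rd_D R).
Local Notation c := (rd_c R).
Local Notation f := (rd_f R).
Local Notation e := (rd_e R).
Local Notation l := (rd_l R).
Local Notation m := (p.+1 %/ rd_l R)%N.
Local Notation kap := (fconst C).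

Let p_pr : prime p. Proof. exact: pcharf_prime charp. Qed.
Let p_gt0 : (0 < p)%N. Proof. exact: prime_gt0. Qed.
Let l_gt1 : (1 < l)%N. Proof. exact: rd_l_ge2. Qed.
Let l_gt0 : (0 < l)%N. Proof. exact: ltnW. Qed.
Let charC : p \in [pchar C]. Proof. by rewrite (fmorph_pchar (cst C)). Qed.
Let mE : (m * l = p.+1)%N. Proof. by rewrite divnK // rd_l_dvdp. Qed.

Lemma rd_l_coprime : coprime l p.
Proof.
have [n E] := dvdnP (rd_l_dvdp R); rewrite coprime_sym prime_coprime //.
apply/negP => dvd_pl; have : (p %| p.+1)%N by apply: dvdn_trans (rd_l_dvdp R).
by rewrite -addn1 dvdn_addr // dvdn1 => /eqP p1; move: p_pr; rewrite p1.
Qed.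

Lemma eqC''E : eqC'' p f = 'X_1 ^+ p - f *: 'X_0 ^+ p :> {mpoly C[2]}.
Proof.
rewrite /eqC'' /eqGamma /linform /= scale1r comp_mpolyD comp_mpolyZ.
by rewrite !comp_mpolyXU -!tnth_nth !tnth_mktuple scaleNr addrC.
Qed.

Lemma eqEE : Defs.eqE C = 'X_0.
Proof. by rewrite /Defs.eqE /linform /= scale1r scale0r addr0. Qed.

(** The branch form has degree p in X_1; if its d-th power is an l-th power, l divides d p, hence d,
    which is impossible for 0 < d < l. *)
Lemma branch_irreducible : irreducible_poly ('X^l - (branch R)%:P).
Proof.
rewrite -polyCN; apply: (Xn_addC_irreducible (iota := idfun)) => //.
move=> d delta dP; rewrite /= opprK => E.
have [N [D' [D0 ED]]] := fraction_denominator delta.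
have tD0 : FracField.tofrac D' != 0 by rewrite tofrac_eq0.
have a0 : (rd_iso R)^-1 ^+ p != 0 by rewrite expf_neq0 // invr_eq0 rd_iso_neq0.
have : (l %| d * p)%N.
  apply: (mpoly_X1_degree (a := (rd_iso R)^-1 ^+ p) (f := f) (N := N) D0 a0 p_gt0).
  apply/eqP; rewrite -tofrac_eq tofracM !tofracXn -ED exprMn E; apply/eqP.
  by congr (_ ^+ _ * _); rewrite /branch eqEE eqC''E.
rewrite Gauss_dvdl ?rd_l_coprime //; move/dvdn_leq => /(_ (proj1 (andP dP))).
by rewrite leqNgt; case/andP: dP => _ ->.
Qed.

Section Stalk.
Variables (x : point C) (q : {mpoly C[2]} -> Prop).
Hypothesis qP : Proj_point D c x q.
Variables (S : comNzRingType) (P : cyclic_alg R -> Prop) (phi : cyclic_alg R -> S).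
Hypotheses (prP : prime_in (psiOX (R := R) x q) P)
  (loc : is_localization (psiOX (R := R) x q) P phi).

(** By the first two conditions the kernel of [Phi] is generated by X^l - b; by the third, [S]
    consists of fractions over the quotient. *)
Definition cyclic_presentation (b : {poly valring x}) (Phi : {rmorphism {poly {poly valring x}} -> S}) :=
  [/\ Phi ('X^l - b%:P) = 0,
      forall v : {poly {poly valring x}}, (size v <= l)%N -> Phi v = 0 -> v = 0,
      forall s, exists a c, ~ nonunit (Phi c) /\ s * Phi c = Phi a,
      forall s t : S, nonunit s -> nonunit t -> nonunit (s + t)
    & forall s t : S, s * t = 0 -> s = 0 \/ t = 0].

Lemma raynaud_chart (vN vM : C * C) (h0 h1 : {poly C}) (b : {poly valring x}) (nu : C) :
    EE D c x vN -> EE D c x vM ->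
    (forall v, EE D c x v -> exists a b : valring x,
      v = (valring_val a * vN.1 + valring_val b * vM.1,
           valring_val a * vN.2 + valring_val b * vM.2)) ->
    vN.1 *: h0 + vN.2 *: h1 = 1 -> vM.1 *: h0 + vM.2 *: h1 = 'X ->
    ~ q (linform vN) ->
    nu != 0 -> x nu = - coeff x (rd_N R *+ (p * e %/ l)) ->
    branch R * (kap nu / FracField.tofrac (linform vN) ^+ m) ^+ l = chart_map x vN vM b ->
  exists Phi : {rmorphism {poly {poly valring x}} -> S}, cyclic_presentation b Phi /\
    forall d H be, SE D c x H -> H \is d.-homog -> ~ q H ->
      FracField.tofrac H = FracField.tofrac (linform vN) ^+ d * chart_map x vN vM be ->
      ~ nonunit (Phi be%:P).
Proof.
move=> EvN EvM EE_span hN hM qN nu0 xnu brE.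
(* A generator of M at [q]: [nu] generates the twist by N^(pe/l), and the inverse m-th power of a
   form outside [q] generates O_P(-m), where m = (p + 1)/l. *)
pose w := kap nu / FracField.tofrac (linform vN) ^+ m.
have wX i : w ^+ i = kap (nu ^+ i) / FracField.tofrac (linform vN) ^+ (m * i).
  by rewrite /w expr_div_n -exprM [kap (nu ^+ i)]rmorphXn.
have nui0 i : nu ^+ i != 0 by rewrite expf_neq0.
have xnui i : x (nu ^+ i) = - coeff x (rd_N R *+ ((p * e %/ l) * i)).
  by rewrite Defs.valX // xnu !coeffMn mulrnA mulNrn.
have tN0 : FracField.tofrac (linform vN) != 0.
  rewrite tofrac_eq0; apply/eqP => E; apply: qN; rewrite E.
  by case: qP => -[_ [q0 _] _ _ _] _ _.
have knu0 : kap nu != 0 by rewrite fmorph_eq0.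
have w0 : w != 0 by exact: mulf_neq0 knu0 (invr_neq0 (expf_neq0 m tN0)).
have M0 g : OP D c (- 0%N%:Z) x q g -> MM R 0 x q g.
  move=> Og; rewrite /MM !muln0 mulr0n; exists 1, g; split=> //.
    by rewrite /OC /= coeff0 Defs.val1 oppr0 lexx orbT.
  by rewrite mpolyC1 tofrac1 mul1r.
have M_theta i r : MM R i x q (chart_map x vN vM r * w ^+ i).
  by rewrite wX; exact: (chart_OPC_theta qP EvN EvM hN hM qN).
have M_frac i z : (i < l)%N -> MM R i x q z -> exists be al,
    z * chart_map x vN vM be = chart_map x vN vM al * w ^+ i /\
    exists g, MM R 0 x q g /\ g * chart_map x vN vM be = 1.
  move=> _ Mz; rewrite wX.
  have [be [al [E [g [Og g1]]]]] := chart_OPC_frac qP EvN EvM EE_span qN (nui0 i) (xnui i) Mz.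
  by exists be, al; split=> //; exists g; split=> //; exact: M0.
have [Phi [root free frac [locS domS] unitP]] := cyclic_cover_stalk
  (chart_map_inj qP EvN EvM hN hM qN) w0 l_gt0 brE branch_irreducible M_theta M_frac prP loc.
exists Phi; split=> // d H be SH homH qH EH; apply: unitP.
have [g [Og g1]] := chart_unit_OP qP EvN SH homH qH EH.
by exists g; split=> //; apply: M0.
Qed.

Variable u : C.
Hypotheses (u0 : u != 0) (xu : x u = coeff x D).

Let X : {mpoly C[2]} := linform (1, 0).
Let Y : {mpoly C[2]} := linform (- (c x * u^-1), u^-1).
Let hC := (c x ^+ p - f) / u ^+ p.

Let in_val_hC : hC \in in_valring x.
Proof.
rewrite inE /hC; have [->|d0] := eqVneq (c x ^+ p - f) 0; first by rewrite mul0r eqxx.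
have := rd_cP R x; rewrite /OC /= -opprB oppr_eq0 (negPf d0) /= Defs.valN coeffN opprK coeffMn => hx.
rewrite Defs.valM ?invr_eq0 ?expf_neq0 // Defs.valV ?expf_neq0 // Defs.valX // xu subr_ge0 hx.
by rewrite orbT.
Qed.

Let h : valring x := ValRing in_val_hC.

Let EX : EE D c x (1, 0).
Proof. by rewrite /EE /OC /= eqxx mulr0 addr0 coeff0 Defs.val1 oppr0 lexx orbT. Qed.

Let EY : EE D c x (- (c x * u^-1), u^-1).
Proof. by rewrite /EE /OC /= Defs.valV // xu lexx orbT addNr eqxx. Qed.

Let EXY_span v : EE D c x v -> exists a b : valring x,
  v = (valring_val a * 1 + valring_val b * (- (c x * u^-1)),
       valring_val a * 0 + valring_val b * u^-1).
Proof.
case: v => v1 v2; rewrite /EE /OC /= coeff0 oppr0 => /andP[v2D vc].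
have va : v1 + c x * v2 \in in_valring x by [].
have vb : v2 * u \in in_valring x.
  rewrite inE; move: v2D; have [->|v20] := eqVneq v2 0; first by rewrite mul0r eqxx.
  by move=> /= v2D; rewrite Defs.valM // xu -lerBlDr sub0r v2D orbT.
exists (ValRing va), (ValRing vb); rewrite /= mulr0 add0r mulfK // mulr1.
by congr pair; rewrite mulrN mulrCA mulfK // addrK.
Qed.

(** In the basis X, Y of the bundle at [x] the equation of C'' is u^p (Y^p + h X^p): passing from
    X_1 to Y replaces [f] by f - c_x^p, which is divisible by u^p. *)
Lemma branch_local :
  branch R = kap ((rd_iso R)^-1 ^+ p * u ^+ p) * (FracField.tofrac X *
    (FracField.tofrac Y ^+ p + kap hC * FracField.tofrac X ^+ p)).
Proof.
have charM : p \in [pchar {mpoly C[2]}].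
  apply/andP; split; first exact: p_pr.
  by rewrite -mpolyC_nat (pcharf0 charC) mpolyC0.
have FB (P1 P2 : {mpoly C[2]}) : (P1 - P2) ^+ p = P1 ^+ p - P2 ^+ p.
  by rewrite -!(pFrobenius_autE charM) rmorphB.
have EXp : X = 'X_0 by exact: eqEE.
have EYp : Y ^+ p = (u ^- p) *: ('X_1 ^+ p - c x ^+ p *: 'X_0 ^+ p).
  have -> : Y = u^-1 *: ('X_1 - c x *: 'X_0).
    by rewrite /Y /linform /= scaleNr scalerBr scalerA addrC mulrC.
  by rewrite exprZn exprVn FB exprZn.
rewrite -!tofracXn -fconstZ -tofracD -tofracM -fconstZ; congr FracField.tofrac.
rewrite eqEE eqC''E EYp EXp -scalerA; congr (_ *: _).
rewrite scalerAr; congr (_ * _); rewrite /hC mulrC -scalerA -scalerDr scalerA.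
by rewrite divff ?expf_neq0 // scale1r scalerBl addrA subrK.
Qed.

(** If X is outside [q], the point is off E and v = Y / X. Otherwise Y is outside [q], v = X / Y is
    the equation of E, and the factor 1 + h v^p left from C'' is a unit, because E and C'' are
    disjoint. *)
Lemma raynaud_stalk_local : exists (b1 b2 : {poly valring x}) Phi,
  [/\ cyclic_presentation (b1 * b2) Phi, ~ nonunit (Phi b2%:P)
    & b1 = 'X \/ exists h' : valring x,
        valring_val h' = (c x ^+ p - f) / u ^+ p /\ b1 = 'X^p + h'%:P].
Proof.
have [nu nu0 xnu] := val_surj x (- coeff x (rd_N R *+ (p * e %/ l))).
(* [ep] compares local generators of N^(pe) and L^p; by [rd_isoP] its valuation is zero. *)
pose ep := nu ^+ l * ((rd_iso R)^-1 ^+ p * u ^+ p).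
have iso0 : (rd_iso R)^-1 ^+ p != 0 by rewrite expf_neq0 // invr_eq0 rd_iso_neq0.
have nul0 := expf_neq0 l nu0; have up0 := expf_neq0 p u0.
have ep0 : ep != 0 by exact: mulf_neq0 nul0 (mulf_neq0 iso0 up0).
have xep : x ep = 0.
  rewrite (Defs.valM x nul0 (mulf_neq0 iso0 up0)) (Defs.valM x iso0 up0) !Defs.valX ?invr_eq0 ?rd_iso_neq0 //.
  rewrite Defs.valV ?rd_iso_neq0 // xnu rd_isoP xu coeffMn mulNrn -mulrnA divnK; last first.
    by rewrite dvdn_mull // rd_l_dvde.
  by rewrite opprB mulrnBl -mulrnA (mulnC e) subrK addNr.
have vep : ep \in in_valring x by rewrite inE xep lexx orbT.
have vepV : ep^-1 \in in_valring x by rewrite inE Defs.valV // xep oppr0 lexx orbT.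
pose epA : valring x := ValRing vep.
have ep_unit (Phi : {rmorphism {poly {poly valring x}} -> S}) : ~ nonunit (Phi epA%:P%:P).
  apply; exists (Phi (ValRing vepV)%:P%:P); rewrite -rmorphM -!polyCM -[RHS](rmorph1 Phi).
  by congr (Phi _%:P%:P); apply: val_inj; rewrite rmorphM /= divff.
have wE t : (kap nu / t ^+ m) ^+ l = kap (nu ^+ l) / t ^+ p.+1.
  by rewrite expr_div_n -exprM mE [kap (nu ^+ l)]rmorphXn.
have epE : kap ep = kap (nu ^+ l) * kap ((rd_iso R)^-1 ^+ p * u ^+ p) by exact: rmorphM.
have [prq _ [v [Ev qv]]] := qP; have [qSE [q0 q1] qD qM qpr] := prq.
have tofrac0 (N : {mpoly C[2]}) : ~ q N -> FracField.tofrac N != 0.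
  by move=> qN; rewrite tofrac_eq0; apply/eqP => E; apply: qN; rewrite E.
have [qX|qX] := pselect (q X); last first.
  pose b1 : {poly valring x} := 'X^p + h%:P.
  have brE : branch R * (kap nu / FracField.tofrac X ^+ m) ^+ l =
      chart_map x (1, 0) (- (c x * u^-1), u^-1) (b1 * epA%:P).
    rewrite rmorphM [chart_map x _ _ (_ + _)]rmorphD rmorphXn chart_mapX !chart_mapC.
    rewrite wE branch_local -[kap (valring_val epA)]/(kap ep) epE.
    have aux (F : fieldType) (a' n' t s r : F) : t != 0 ->
        a' * (t * (s ^+ p + r * t ^+ p)) * (n' / t ^+ p.+1) = ((s / t) ^+ p + r) * (n' * a').
      by move=> t0; rewrite expr_div_n exprS; field; rewrite t0 expf_neq0.
    exact: aux (tofrac0 _ qX).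
  (* The value of 'X_1, which is u Y + c_x X, when X is set to 1 and Y to the chart coordinate. *)
  pose h1 : {poly C} := (c x)%:P + u *: 'X.
  have hN : (1 : C) *: (1 : {poly C}) + (0 : C) *: h1 = 1 by rewrite scale1r scale0r addr0.
  have hM : (- (c x * u^-1)) *: (1 : {poly C}) + u^-1 *: h1 = 'X.
    rewrite /= scalerDr scalerA mulVf // scale1r -[_ *: (c x)%:P]mul_polyC -polyCM alg_polyC addrA.
    by rewrite -polyCD mulrC addNr add0r.
  have [Phi [pres _]] := raynaud_chart EX EY EXY_span hN hM qX nu0 xnu brE.
  by exists b1, epA%:P, Phi; split=> //; right; exists h.
have qY : ~ q Y.
  move=> qY; apply: qv; have [a [b ->]] := EXY_span Ev.
  have SEv (d : valring x) : SE D c x (valring_val d)%:MP.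
    by apply: SE_const; have := valring_valP d; rewrite /OC inE /= coeff0 oppr0.
  have := linformD (valring_val a) (valring_val b) (1, 0) (- (c x * u^-1), u^-1) => /= ->.
  by rewrite -!mul_mpolyC; apply: (qD); apply: (qM).
pose b2 : {poly valring x} := 1 + h%:P * 'X^p.
have cb2 vN vM : chart_map x vN vM b2 = 1 + kap hC *
    (FracField.tofrac (linform vM) / FracField.tofrac (linform vN)) ^+ p.
  by rewrite rmorphD rmorph1 rmorphM rmorphXn chart_mapX chart_mapC.
have brE : branch R * (kap nu / FracField.tofrac Y ^+ m) ^+ l =
    chart_map x (- (c x * u^-1), u^-1) (1, 0) ('X * (epA%:P * b2)).
  rewrite rmorphM chart_mapX [chart_map x _ _ (_ * b2)]rmorphM cb2 chart_mapC.
  rewrite wE branch_local -[kap (valring_val epA)]/(kap ep) epE.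
  have aux (F : fieldType) (a' n' t s r : F) : s != 0 ->
      a' * (t * (s ^+ p + r * t ^+ p)) * (n' / s ^+ p.+1) = t / s * ((n' * a') * (1 + r * (t / s) ^+ p)).
    by move=> t0; rewrite expr_div_n exprS; field; rewrite t0 expf_neq0.
  exact: aux (tofrac0 _ qY).
have EYX_span w : EE D c x w -> exists a b : valring x,
    w = (valring_val a * - (c x * u^-1) + valring_val b * 1, valring_val a * u^-1 + valring_val b * 0).
  by move=> /EXY_span[a [b ->]]; exists b, a; congr pair; rewrite addrC.
(* Now Y is set to 1, and X, that is 'X_0, to the chart coordinate. *)
pose h1 : {poly C} := u%:P + c x *: 'X.
have hN : (- (c x * u^-1)) *: 'X + u^-1 *: h1 = 1.
  rewrite /= scalerDr scalerA -[_ *: u%:P]mul_polyC -polyCM mulVf // addrCA -scalerDl.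
  by rewrite mulrC addNr scale0r addr0.
have hM : (1 : C) *: 'X + (0 : C) *: h1 = 'X by rewrite scale1r scale0r addr0.
have [Phi [pres unitP]] := raynaud_chart EY EX EYX_span hN hM qY nu0 xnu brE.
exists 'X, (epA%:P * b2), Phi; split=> //; last by left.
rewrite polyCM rmorphM; apply: unit_mul => //.
(* This form dehomogenizes to [b2]. It is outside [q], which contains X but no power of Y. *)
pose H : {mpoly C[2]} := Y ^+ p + hC *: X ^+ p.
have Xhom n : X ^+ n \is n.-homog by have := dhomogMn n (linform_homog (1, 0) : X \is 1.-homog); rewrite mul1n.
have Yhom n : Y ^+ n \is n.-homog.
  by have := dhomogMn n (linform_homog (- (c x * u^-1), u^-1) : Y \is 1.-homog); rewrite mul1n.
have SE1 : SE D c x 1.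
  by rewrite -mpolyC1; apply: SE_const; rewrite /OC /= coeff0 Defs.val1 oppr0 lexx orbT.
have SEX (N : {mpoly C[2]}) n : SE D c x N -> SE D c x (N ^+ n).
  by move=> SN; elim: n => [|n IH]; rewrite ?expr0 // exprS; apply: SE_mul.
have SEh : SE D c x hC%:MP.
  by apply: SE_const; move: in_val_hC; rewrite /OC inE /= coeff0 oppr0.
have SEXp := SEX X p (SE_lin EX); have SEYp := SEX Y p (SE_lin EY).
have qXp : q (hC%:MP * X ^+ p).
  by apply: (qM) => //; rewrite -(prednK p_gt0) exprSr; apply: (qM) => //; apply: SEX; apply: SE_lin.
have nqYp n : ~ q (Y ^+ n).
  elim: n => [|n IH]; rewrite ?expr0 // exprS => /qpr[]//; [exact: SE_lin | exact: SEX (SE_lin EY)].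
apply: (unitP p H).
- by apply: SE_add => //; rewrite -mul_mpolyC; apply: SE_mul.
- exact: rpredD (Yhom p) (rpredZ hC (Xhom p)).
- move=> qH; apply: (nqYp p).
  have -> : Y ^+ p = H + (- 1)%:MP * (hC%:MP * X ^+ p).
    by rewrite mpolyCN mpolyC1 mulN1r mul_mpolyC addrK.
  apply: (qD) => //; apply: (qM) => //; apply: SE_const.
  by rewrite /OC /= Defs.valN coeff0 Defs.val1 oppr0 lexx orbT.
- rewrite tofracD fconstZ !tofracXn cb2.
  have aux (F : fieldType) (s t r : F) : s != 0 ->
      s ^+ p + r * t ^+ p = s ^+ p * (1 + r * (t / s) ^+ p).
    move=> /(expf_neq0 p); rewrite expr_div_n; move: (s ^+ p) (t ^+ p) => a b a0.
    by field.
  exact: aux (tofrac0 _ qY).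
Qed.

End Stalk.
End RaynaudStalk.

(** * Normality, depth and regularity of the stalks *)

Lemma closed_field_primitive_root (k : closedFieldType) n : n%:R != 0 :> k ->
  exists z : k, n.-primitive_root z.
Proof.
move=> n0; have n_gt0 : (0 < n)%N by rewrite lt0n; apply: contra_neq n0 => ->.
have [r Er] := closed_field_poly_normal ('X^n - 1 : {poly k}).
rewrite (monicP (monicXnsubC 1 n_gt0)) scale1r in Er.
have sr : size r = n by apply/succn_inj; rewrite -(size_prod_XsubC r id) -Er size_XnsubC.
have ur : uniq r by rewrite -separable_prod_XsubC -Er separable_Xn_sub_1.
have /hasP[z _ z_prim] : has n.-primitive_root r.
  apply: has_prim_root => //; rewrite ?sr //.
  by apply/allP => z zr; rewrite /root_of_unity Er root_prod_XsubC.
by exists z.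
Qed.

Section ValringConstants.
Variables (k : closedFieldType) (C : curve k) (x : point C).

Definition valring_cst (a : k) : valring x := ValRing (in_valring_cst x a).

Lemma valring_cst_zmod : zmod_morphism valring_cst.
Proof. by move=> a b; apply: val_inj; rewrite rmorphB /= rmorphB. Qed.

Lemma valring_cst_monoid : monoid_morphism valring_cst.
Proof. by split=> [|a b]; apply: val_inj; rewrite ?rmorph1 ?rmorphM /= ?rmorph1 ?rmorphM. Qed.

HB.instance Definition _ := GRing.isZmodMorphism.Build k (valring x) valring_cst valring_cst_zmod.
HB.instance Definition _ := GRing.isMonoidMorphism.Build k (valring x) valring_cst valring_cst_monoid.

Lemma valring_emb_inj : injective (valring_emb x). Proof. exact: val_inj. Qed.

End ValringConstants.

Section Smoothness.
Variables (k : closedFieldType) (C : curve k) (p : nat) (charp : p \in [pchar k]).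
Variables (x : point C) (t : valring x) (Delta : C -> C).
Hypotheses (t0 : valring_val t != 0) (xt : x (valring_val t) = 1).
Hypotheses (derD : derivation Delta) (Dt : Delta (valring_val t) = 1).

(** If [u] were a nonunit, h + a^p would be t^2 v; [Delta] kills a^p and preserves the valuation
    ring, so [Delta h] would be a multiple of t. *)
Lemma valring_tango (h : valring x) a : x (Delta (valring_val h)) = 0 -> Delta (valring_val h) != 0 ->
  nonunit (h + a ^+ p) -> exists u, ~ nonunit u /\ h + a ^+ p = t * u.
Proof.
move=> xDh Dh0 /(unif_dvd (valring_uniformizer xt t0))[u Eu]; exists u; split=> //.
move=> /(unif_dvd (valring_uniformizer xt t0))[v Ev].
have [DD DM _] := derD.
have charC : p \in [pchar C] by rewrite (fmorph_pchar (cst C)).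
have E : Delta (valring_val h) =
    valring_val t * (2 * valring_val v + valring_val t * Delta (valring_val v)).
  have := congr1 (fun y => Delta (valring_emb x y)) Eu.
  rewrite Ev rmorphD rmorphXn DD (derivation_exp _ _ derD) (mulrn_pchar charC) addr0.
  rewrite !rmorphM !DM /= Dt => ->; ring.
have vin : 2 * valring_val v + valring_val t * Delta (valring_val v) \in in_valring x.
  rewrite rpredD ?rpredM ?rpred_nat ?valring_valP //.
  exact: (derivation_valring charp t0 xt derD Dt (valring_valP v)).
move: Dh0 xDh; rewrite E mulf_eq0 negb_or => /andP[_ v0]; rewrite Defs.valM // xt.
by move: vin; rewrite inE (negPf v0) /=; move: (x _) => y; lia.
Qed.

End Smoothness.

Lemma monic_not_unif_multiple (A : idomainType) (pi : A) (b : {poly A}) :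
  uniformizer pi -> b \is monic -> ~ exists h, b = pi *: h.
Proof.
move=> pi_unif monb [h E]; case: (@nonunit1 A).
by rewrite -(monicP monb) E lead_coefZ; apply/(unif_dvd pi_unif); exists (lead_coef h).
Qed.

Section RaynaudLocalRings.
Variables (k : closedFieldType) (C : curve k) (p : nat) (R : raynaud_datum C p).
Hypothesis charp : p \in [pchar k].

Local Notation f := (rd_f R).
Local Notation l := (rd_l R).

Variables (x : point C) (u : C).
Hypotheses (u0 : u != 0) (xu : x u = coeff x (rd_D R)).

Let p_pr : prime p. Proof. exact: pcharf_prime charp. Qed.
Let p_gt1 : (1 < p)%N. Proof. exact: prime_gt1. Qed.
Let charC : p \in [pchar C]. Proof. by rewrite (fmorph_pchar (cst C)). Qed.
Let charV : p \in [pchar (valring x)]. Proof. by rewrite (fmorph_pchar (valring_cst x)). Qed.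

Definition branch_factor (b1 : {poly valring x}) :=
  b1 = 'X \/ exists h : valring x,
    valring_val h = (rd_c R x ^+ p - f) / u ^+ p /\ b1 = 'X^p + h%:P.

Lemma branch_factor_monic b1 : branch_factor b1 -> b1 \is monic.
Proof.
case=> [->|[h [_ ->]]]; first exact: monicX.
have lt : (size h%:P < size ('X^p : {poly valring x}))%N.
  by rewrite size_polyXn ltnS (leq_trans (size_polyC_leq1 _)) // ltnW.
by rewrite monicE lead_coefDl // lead_coefXn.
Qed.

Lemma branch_factor_irreducible b1 : branch_factor b1 -> irreducible_poly b1.
Proof.
case=> [->|[h [Eh ->]]].
  split=> [|q szq dvd_q]; first by rewrite size_polyX.
  have X0 : 'X != 0 :> {poly valring x} by rewrite polyX_eq0.
  rewrite -Pdiv.Idomain.dvdp_size_eqp // size_polyX eqn_leq.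
  have := Pdiv.Idomain.dvdp_leq X0 dvd_q; rewrite size_polyX => -> /=.
  rewrite ltn_neqAle eq_sym szq size_poly_gt0.
  by apply: contraTneq dvd_q => ->; rewrite Pdiv.Idomain.dvd0p.
apply: (Xn_addC_irreducible (iota := valring_emb x)) => //; first exact: valring_emb_inj.
apply: not_pth_power_exp => // g Eg.
(* From - h = g^p one gets (c_x + g u)^p = c_x^p - h u^p = f. *)
have [_ nf _] := rd_fP R; apply: nf; exists (rd_c R x + g * u).
have FD (a b : C) : (a + b) ^+ p = a ^+ p + b ^+ p by rewrite -!(pFrobenius_autE charC) rmorphD.
rewrite FD exprMn -Eg /= Eh mulNr divfK ?expf_neq0 //.
by rewrite opprB addrC subrK.
Qed.

Variables (S : comNzRingType) (b1 b2 : {poly valring x}).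
Variable (Phi : {rmorphism {poly {poly valring x}} -> S}).
Hypotheses (pres : cyclic_presentation R (b1 * b2) Phi) (b2_unit : ~ nonunit (Phi b2%:P)).
Hypothesis b1P : branch_factor b1.

Let l_gt0 : (0 < l)%N. Proof. exact: ltnW (rd_l_ge2 R). Qed.

Let l0 : l%:R != 0 :> k.
Proof.
rewrite -(dvdn_pcharf charp) -prime_coprime // coprime_sym.
exact: rd_l_coprime charp.
Qed.

Let lV : l%:R * valring_cst x l%:R^-1 = 1.
Proof. by rewrite -(rmorph_nat (valring_cst x)) -rmorphM divff // rmorph1. Qed.

Let unifP : exists t : valring x, uniformizer t.
Proof.
have [t [t0 xt]] := val_unif x.
have vt : t \in in_valring x by rewrite inE xt orbT.
by exists (ValRing vt); exact: valring_uniformizer.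
Qed.

Lemma raynaud_stalk_normal : normal_domain S.
Proof.
have [root free frac _ dom] := pres; have [t tP] := unifP.
have [z z_prim] := closed_field_primitive_root l0.
have om_prim : l.-primitive_root (valring_cst x z) by rewrite fmorph_primitive_root.
apply: (cyclic_normal tP l_gt0 root free frac dom om_prim lV b2_unit).
  exact: branch_factor_irreducible.
exact: monic_not_unif_multiple tP (branch_factor_monic b1P).
Qed.

Lemma raynaud_stalk_cohen_macaulay : cohen_macaulay_local S.
Proof.
have [root free frac locS dom] := pres; have [t tP] := unifP.
exact: (cyclic_cohen_macaulay tP l_gt0 root free frac locS dom).
Qed.

Lemma raynaud_stalk_regular : ord_diff x f (coeff x (rd_D R *+ p)) -> regular_local S.
Proof.
have [root free frac locS dom] := pres.
case=> t [Delta [[t0 xt] derD Dt Df0 xDf]].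
have vt : t \in in_valring x by rewrite inE xt orbT.
pose tV : valring x := ValRing vt.
have tP : uniformizer tV by exact: valring_uniformizer.
apply: (cyclic_regular tP l_gt0 root free frac locS dom erefl b2_unit).
- exact: branch_factor_irreducible.
- exact: monic_not_unif_multiple tP (branch_factor_monic b1P).
- apply; exists (Phi (valring_cst x l%:R^-1)%:P%:P).
  have -> : l%:R = Phi (l%:R)%:P%:P by rewrite !polyC_natr rmorph_nat.
  by rewrite -rmorphM -!polyCM lV rmorph1.
move=> Qt Qb1.
have prQ := integral_prime_contraction (Phi \o polyC) (nonunit_prime locS).
case: b1P Qb1 => [->|[h [Eh ->]]] Qb1; first exact: (special_generators_X tP prQ Qt).
apply: (special_generators_Xp tP prQ Qt charV Qb1) => a.
have [DD DM _] := derD.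
have Dp g : Delta (g ^+ p) = 0 by rewrite derivation_exp // mulrn_pchar.
have up0 : u ^+ p != 0 by rewrite expf_neq0.
(* [Delta] kills c_x^p and u^p, so it maps h u^p = c_x^p - f to - Delta f. *)
have Dh : Delta (valring_val h) = - (Delta f / u ^+ p).
  have := DM (valring_val h) (u ^+ p).
  rewrite Dp mulr0 add0r Eh divfK // => Dhu.
  have := DD (rd_c R x ^+ p - f) f; rewrite subrK Dp Dhu => /eqP.
  by rewrite eq_sym addr_eq0 => /eqP E; rewrite -mulNr -E mulfK.
apply: (valring_tango (t := tV) charp t0 xt derD Dt); last first.
  by rewrite Dh oppr_eq0 mulf_neq0 ?invr_eq0.
rewrite Dh Defs.valN Defs.valM ?invr_eq0 // Defs.valV // Defs.valX //.
by rewrite xDf xu coeffMn subrr.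
Qed.

End RaynaudLocalRings.

Theorem corollary7 (k : closedFieldType) (p : nat) (hp : p \in [pchar k])
    (C : curve k) (g : nat) (hg : genus C g) (g_ge2 : (2 <= g)%N)
    (hC : pre_tango_curve C p) (R : raynaud_datum C p) :
  [/\ normal_scheme (raynaud_stalk R),
      cohen_macaulay_scheme (raynaud_stalk R)
    & tango_curve C p g -> tango_structure p (rd_D R) (rd_f R) ->
      smooth_scheme (raynaud_stalk R)].
Proof.
have local S : raynaud_stalk R S -> exists (x : point C) u b1 b2 Phi,
    [/\ u != 0, x u = coeff x (rd_D R), @cyclic_presentation _ _ _ R x S (b1 * b2) Phi,
        ~ nonunit (Phi b2%:P) & branch_factor R u b1].
  case=> x [q [P [phi [qP prP loc]]]].
  (* The inverse of [u] generates O_C(D) at [x]. *)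
  have [u u0 xu] := val_surj x (coeff x (rd_D R)).
  have [b1 [b2 [Phi [pres b2u b1P]]]] := raynaud_stalk_local hp qP prP loc u0 xu.
  by exists x, u, b1, b2, Phi.
split=> [S|S|_ [_ _ divf] S] /local[x [u [b1 [b2 [Phi [u0 xu pres b2u b1P]]]]]].
- exact: (raynaud_stalk_normal hp u0 pres b2u b1P).
- exact: (raynaud_stalk_cohen_macaulay pres).
- exact: (raynaud_stalk_regular hp u0 xu pres b2u b1P (divf x)).
Qed.
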